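(* Let $\gamma:\mathbb{S}^2\to\mathbb{R}_{>0}$ be a smooth convex function, and let $\Sigma\subset\mathbb{R}^3$ be a connected, oriented, immersed, non-planar $\gamma$-anisotropic minimal surface with Gauss map $\nu:\Sigma\to\mathbb{S}^2$. Then the critical set of $\nu$, i.e. $\{p\in\Sigma : d\nu_p \text{ is not invertible}\}=\{p\in\Sigma: K^\Sigma(p)=0\}$, has no accumulation points in $\Sigma$.
   Context: $\gamma:\mathbb{S}^2\to\mathbb{R}_{>0}$ is a smooth positive function. It is called convex if $A_\gamma=(\nabla^{\mathbb{S}^2})^2\gamma+\gamma I$ is positive definite at every point of $\mathbb{S}^2$ (as an endomorphism of $T_\nu\mathbb{S}^2$). For an oriented immersed surface $\Sigma\to\mathbb{R}^3$ with unit normal field $\nu:\Sigma\to\mathbb{S}^2$ (the Gauss map), the anisotropic surface energy is $\mathcal{F}_\gamma(\Sigma)=\int_\Sigma\gamma(\nu)\,d\Sigma$, where $d\Sigma$ is the area element. $\Sigma$ is a $\gamma$-anisotropic minimal surface if $\frac{d}{dt}\big|_{t=0}\mathcal{F}_\gamma(\Sigma_t)=0$ for all compactly supported variations $\Sigma_t$ of $\Sigma$; equivalently the anisotropic mean curvature $H_\gamma=\mathrm{tr}(A_\gamma S)$ vanishes identically, where $S=-d\nu$ is the shape operator and $A_\gamma$ at $p\in\Sigma$ means $A_\gamma$ at $\nu(p)$, viewed as an endomorphism of $T_p\Sigma=T_{\nu(p)}\mathbb{S}^2$. $K^\Sigma=\det S$ is the Gaussian curvature. Non-planar means that the image of $\Sigma$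 is not contained in an affine plane. *)

(* Defs.v *)
From HB Require Import structures.
From mathcomp Require Import all_boot all_order all_algebra.
From mathcomp Require Import all_classical all_reals all_analysis.

Set Implicit Arguments.
Unset Strict Implicit.
Unset Printing Implicit Defensive.

Import Order.TTheory GRing.Theory Num.Theory.
Import numFieldNormedType.Exports.

Local Open Scope classical_set_scope.
Local Open Scope ring_scope.

Section Smoothness.
Context {R : realType} {V W : normedModType R}.

(* Only used on open [U] of finite-dimensional spaces, where this recursion on
   directional derivatives is the usual C^k. *)
Fixpoint Ck_on (k : nat) (U : set V) (f : V -> W) : Prop :=
  if k is k'.+1 then
    (forall x, U x -> differentiable f x) /\
    (forall v, Ck_on k' U (fun x => 'D_v f x))
  else forall x, U x -> {for x, continuous f}.

Definition smooth_on (U : set V) (f : V -> W) : Prop :=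
  forall k, Ck_on k U f.

End Smoothness.

Section Euclidean.
Context {R : realType}.

(* The library norm [`|x|] on ['rV[R]_n] is the sup norm, hence [enorm]. *)
Definition dot {n} (u v : 'rV[R]_n) : R := \sum_(i < n) u 0 i * v 0 i.

Definition enorm {n} (u : 'rV[R]_n) : R := Num.sqrt (dot u u).

End Euclidean.

(* Functions and vector fields on S^2 are represented by functions on R^3 of
   which only the values on [sphere] are used.  They are differentiated through
   their 0-homogeneous extension [radial f]: since x |-> x / |x| is a smooth
   retraction of R^3 \ {0} onto S^2, f is smooth on S^2 iff [radial f] is smooth
   on R^3 \ {0}, and df_x(u) = 'D_u (radial f) x for u tangent at x in S^2. *)
Section Sphere.
Context {R : realType}.

Definition sphere : set 'rV[R]_3 := [set x | enorm x = 1].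

Definition sphere_tangent (x : 'rV[R]_3) : set 'rV[R]_3 :=
  [set u | dot u x = 0].

Definition tangent_proj (x u : 'rV[R]_3) : 'rV[R]_3 := u - dot u x *: x.

Definition radial {T : Type} (f : 'rV[R]_3 -> T) (x : 'rV[R]_3) : T :=
  f ((enorm x)^-1 *: x).

Definition sphere_smooth (f : 'rV[R]_3 -> R) : Prop :=
  smooth_on [set x | x != 0] (radial f : 'rV[R]_3 -> R^o).

Definition sphere_grad (f : 'rV[R]_3 -> R) (x : 'rV[R]_3) : 'rV[R]_3 :=
  tangent_proj x
    (\row_i 'D_(delta_mx 0 i) (radial f : 'rV[R]_3 -> R^o) x).

(* The Levi-Civita connection of S^2 is the tangential part of the derivative
   in R^3; the Hessian at x is the endomorphism u |-> nabla_u (grad f). *)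
Definition sphere_hessian (f : 'rV[R]_3 -> R) (x u : 'rV[R]_3) : 'rV[R]_3 :=
  tangent_proj x ('D_u (radial (sphere_grad f)) x).

Definition A_gamma (gamma : 'rV[R]_3 -> R) (x u : 'rV[R]_3) : 'rV[R]_3 :=
  sphere_hessian gamma x u + gamma x *: u.

Definition convex_integrand (gamma : 'rV[R]_3 -> R) : Prop :=
  forall x, sphere x -> forall u, sphere_tangent x u -> u != 0 ->
    0 < dot (A_gamma gamma x u) u.

End Sphere.

Record chart (R : realType) (M : topologicalType) := Chart {
  chart_dom : set M;
  chart_map : M -> R * R;
  chart_inv : R * R -> M;
  chart_dom_open : open chart_dom;
  chart_im_open : open (chart_map @` chart_dom);
  chart_mapK : forall p, chart_dom p -> chart_inv (chart_map p) = p;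
  chart_map_continuous : forall p, chart_dom p -> {for p, continuous chart_map};
  chart_inv_continuous : forall x, (chart_map @` chart_dom) x ->
    {for x, continuous chart_inv} }.

Definition chart_im {R M} (c : chart R M) : set (R * R) :=
  chart_map c @` chart_dom c.

Record surface (R : realType) := Surface {
  surface_space :> topologicalType;
  surface_hausdorff : hausdorff_space surface_space;
  surface_second_countable : @second_countable surface_space;
  atlas : set (chart R surface_space);
  atlas_cover : forall p, exists2 c, atlas c & chart_dom c p;
  atlas_smooth : forall c c', atlas c -> atlas c' ->
    smooth_on (chart_map c @` (chart_dom c `&` chart_dom c'))
              (chart_map c' \o chart_inv c) }.

Section Immersions.
Context {R : realType} {S : surface R}.
Implicit Types (X nu : S -> 'rV[R]_3) (c : chart R S).

Definition smooth_map X : Prop :=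
  forall c, atlas c -> smooth_on (chart_im c) (X \o chart_inv c).

Definition immersion X : Prop :=
  smooth_map X /\
  forall c, atlas c -> forall x, chart_im c x ->
    forall v, 'D_v (X \o chart_inv c) x = 0 -> v = 0.

(* An orientation of an immersed surface is the choice of such a [nu]. *)
Definition unit_normal_field X nu : Prop :=
  [/\ smooth_map nu,
      forall p, sphere (nu p) &
      forall c, atlas c -> forall x, chart_im c x ->
        forall v, dot ('D_v (X \o chart_inv c) x) (nu (chart_inv c x)) = 0].

Definition planar X : Prop :=
  exists a : 'rV[R]_3, exists b : R, a != 0 /\ forall p, dot a (X p) = b.

Definition basis_vec (i : 'I_2) : R * R := if i == 0 then (1, 0) else (0, 1).

Definition chart_gram X Y c (x : R * R) : 'M[R]_2 :=
  \matrix_(i, j) dot ('D_(basis_vec i) (X \o chart_inv c) x)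
                     ('D_(basis_vec j) (Y \o chart_inv c) x).

(* Matrix of the shape operator - dnu in the basis (d_1 X, d_2 X). *)
Definition shape_matrix X nu c (x : R * R) : 'M[R]_2 :=
  invmx (chart_gram X X c x) *m (- chart_gram X nu c x).

Definition gauss_curvature X nu c (p : S) : R :=
  \det (shape_matrix X nu c (chart_map c p)).

Definition zero_curvature_set X nu : set S :=
  [set p | exists c, [/\ atlas c, chart_dom c p & gauss_curvature X nu c p = 0]].

(* In the chart c, dnu_p is the linear map v |-> 'D_v (nu \o chart_inv c) from
   R^2 to the tangent plane of S^2 at nu p. *)
Definition gauss_differential_invertible nu c (p : S) : Prop :=
  forall w, sphere_tangent (nu p) w ->
    exists! v, 'D_v (nu \o chart_inv c) (chart_map c p) = w.

Definition critical_set nu : set S :=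
  [set p | exists c, [/\ atlas c, chart_dom c p &
                         ~ gauss_differential_invertible nu c p]].

Definition area_density X c (x : R * R) : R :=
  Num.sqrt (\det (chart_gram X X c x)).

Definition chart_cover (K : set S) n (c : 'I_n -> chart R S) : Prop :=
  (forall i, atlas (c i)) /\ K `<=` \bigcup_i chart_dom (c i).

(* Integral of f over K against the area element of X, computed by cutting K
   into pieces each lying in one chart of a finite cover; for compact K the
   value does not depend on the cover. *)
Definition surface_integral X n (c : 'I_n -> chart R S) (K : set S)
    (f : S -> R) : R :=
  \sum_(i < n)
    Rintegral ((@lebesgue_measure R) \x (@lebesgue_measure R))%E
      (chart_map (c i) @` ((K `&` chart_dom (c i)) `\`
         \bigcup_(j in [set j : 'I_n | (j < i)%N]) chart_dom (c j)))
      (fun x => f (chart_inv (c i) x) * area_density X (c i) x).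

Definition aniso_energy (gamma : 'rV[R]_3 -> R) X nu n
    (c : 'I_n -> chart R S) (K : set S) : R :=
  surface_integral X c K (gamma \o nu).

(* (Y t, N t) for |t| < eps: a smooth family of oriented immersed surfaces
   starting at (X, nu) and equal to it off the compact set K. *)
Definition variation X nu (eps : R) (K : set S)
    (Y N : R -> S -> 'rV[R]_3) : Prop :=
  [/\ 0 < eps /\ compact K,
      Y 0 = X /\ N 0 = nu,
      forall t p, `|t| < eps -> ~ K p -> Y t p = X p,
      forall t, `|t| < eps -> immersion (Y t) /\ unit_normal_field (Y t) (N t) &
      forall c, atlas c ->
        let D := [set z : R * (R * R) | `|z.1| < eps /\ chart_im c z.2] in
        smooth_on D (fun z => Y z.1 (chart_inv c z.2)) /\
        smooth_on D (fun z => N z.1 (chart_inv c z.2))].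

(* The energy of the whole surface may be infinite; since Y t = X off K, only
   the energy of K varies. *)
Definition aniso_minimal (gamma : 'rV[R]_3 -> R) X nu : Prop :=
  forall eps K Y N, variation X nu eps K Y N ->
    forall n (c : 'I_n -> chart R S), chart_cover K c ->
      is_derive (0 : R) (1 : R)
        (fun t => aniso_energy gamma (Y t) (N t) c K : R^o) 0.

End Immersions.

(* Main.v *)
Require Import Defs.
From HB Require Import structures.
From mathcomp Require Import all_boot all_order all_algebra.
From mathcomp Require Import all_classical all_reals all_analysis.
From mathcomp Require Import measurable_realfun ring lra.
Set Implicit Arguments.
Unset Strict Implicit.
Unset Printing Implicit Defensive.
Import Order.TTheory GRing.Theory Num.Theory.
Import numFieldNormedType.Exports.
Local Open Scope classical_set_scope.
Local Open Scope ring_scope.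

(** The critical points of the Gauss map turn out to be zeros of a nonnegative function with a
    Bochner inequality, and such zeros are isolated unless the function vanishes identically.

    Near any point the surface is a graph z over two of its coordinates x, y. Let p, q be the slopes
    of z, let r, s, t be its second derivatives with respect to x and y, and let G (p, q) be the
    energy density of a graph with slopes p, q. If Gamma denotes the 1-homogeneous extension of gamma
    to space, then G is Gamma restricted to an affine plane avoiding the origin. Convexity of gamma
    says that the Hessian of Gamma is positive definite transversally to the radial direction, so
    the Hessian (a, b, c) of G is positive definite ([hess_hom_ext_gt0], [graph_integrand_hess]).

    Minimality is tested on vertical variations z + t phi, with phi a bump function in the chart. They
    stay graphs for all t ([variation_lifted]), and convexity of G bounds their energy from below by
    its formal first-order expansion. This identifies the first variation
    ([energy_slope_integral]), and integrating by parts gives the quasilinear elliptic equation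
    a r + 2 b s + c t = 0 ([euler_lagrange]).

    Put f = s^2 - r t. The determinant of the second fundamental form is a negative multiple of f, so
    that f = 0 exactly at the critical points of the Gauss map, which are the points of zero curvature
    ([second_form_det], [gauss_kernel]). By the equation f is nonnegative and comparable to the
    squared norm of the Hessian of z ([hdet_ge]). Let L = a D1 D1 + 2 b D1 D2 + c D2 D2, with Q its
    gradient form. Differentiating the equation twice, one finds that in dimension two the third
    derivatives cancel in f L f - Q f up to terms of fourth order in the Hessian, hence
    f L f - Q f >= - C f^2, which means L (ln f) >= - C where f is positive ([bochner_near]).

    A nonnegative function with this property has only isolated zeros, or vanishes near the point
    where they cluster. Indeed each zero allows one to subtract from ln f a logarithmic pole: by the
    maximum principle, N zeros near a point force f to be of order 2^-N around it
    ([zero_near_of_infinitely_many_zeros]).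

    So around a limit point of the critical set every point is critical. The interior of the critical
    set is then open and closed, hence it is the whole surface; the Gauss map is locally constant, and
    by connectedness the surface is planar ([all_critical], [planar_of_all_critical]). *)


(** * Calculus of iterated directional derivatives *)
Section CkCalculus.
Context {R : realType}.
Implicit Types (V W Z : normedModType R).

Lemma derive_diff V W (f : V -> W) x v : differentiable f x -> 'D_v f x = 'd f x v.
Proof. by move=> df; rewrite deriveE. Qed.

Lemma deriveDv V W (f : V -> W) x u v : differentiable f x ->
  'D_(u + v) f x = 'D_u f x + 'D_v f x.
Proof. by move=> df; rewrite !derive_diff// linearD. Qed.

Lemma deriveZv V W (f : V -> W) x a v : differentiable f x ->
  'D_(a *: v) f x = a *: 'D_v f x.
Proof. by move=> df; rewrite !derive_diff// linearZ. Qed.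

Lemma Ck_onS V W k (U : set V) (f : V -> W) : Ck_on k.+1 U f -> Ck_on k U f.
Proof.
elim: k f => [|k IH] f [df Df]; first by move=> x Ux; exact/differentiable_continuous/df.
by split=> // v; apply: IH; exact: Df.
Qed.

Lemma Ck_on_sub V W k (U U' : set V) (f : V -> W) :
  U' `<=` U -> Ck_on k U f -> Ck_on k U' f.
Proof.
move=> sub; elim: k f => [|k IH] f /=; first by move=> H x /sub; exact: H.
by case=> df Df; split=> [x /sub|v]; [exact: df|exact: IH].
Qed.

Lemma open_near_eq V W (U : set V) (f g : V -> W) x : open U -> U x ->
  (forall y, U y -> f y = g y) -> \forall y \near x, f y = g y.
Proof. by move=> oU Ux fg; apply: filterS fg _; exact: open_nbhs_nbhs. Qed.

Lemma near_eq_differentiable V W (f g : V -> W) x :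
  (\forall y \near x, f y = g y) -> differentiable f x -> differentiable g x.
Proof.
move=> fg df; have fgx : f x = g x by exact: nbhs_singleton fg.
have := df => /diff_locallyP [cdf dfE]; apply/diff_locallyP.
have fg0 : \forall h \near (0 : V), f (h + x) = g (h + x).
  by move: fg; rewrite (near_shift 0 x) subr0.
have H : g \o shift x = cst (g x) + 'd f x +o_ (0 : V) id.
  apply/eqaddoP => e e0.
  have /eqaddoP/(_ e e0) H := dfE.
  near=> h.
  have E : f (h + x) = g (h + x) by near: h.
  have : `|(f \o shift x - (cst (f x) + 'd f x)) h| <= e * `|h| by near: h.
  by rewrite /= !fctE /= E fgx.
have E : 'd g x = 'd f x :> (V -> W).
  exact: diff_unique.
by rewrite E.
Unshelve. all: by end_near. Qed.

Lemma Ck_on_eq V W k (U : set V) (f g : V -> W) : open U ->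
  (forall x, U x -> f x = g x) -> Ck_on k U f -> Ck_on k U g.
Proof.
move=> oU; elim: k f g => [|k IH] f g fg /=.
  move=> cf x Ux; have nfg := open_near_eq oU Ux fg.
  have : f y @[y --> x] --> f x by exact: cf.
  rewrite (fg x Ux); apply: cvg_trans; apply: near_eq_cvg.
  by apply: filterS nfg => y ->.
case=> df Df; split=> [x Ux|v].
  by apply: near_eq_differentiable (df x Ux); exact: open_near_eq oU Ux fg.
apply: IH (Df v) => x Ux; apply: near_eq_derive; exact: open_near_eq oU Ux fg.
Qed.

(** The recursion only involves values of f near each point, so regularity may be checked on an open
    cover; this is how maps given by different formulas in different charts are treated. *)
Lemma Ck_on_local V W k (U : set V) (f : V -> W) :
  (forall x, U x -> exists O : set V, [/\ open O, O x & Ck_on k O f]) -> Ck_on k U f.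
Proof.
elim: k f => [|k IH] f H /=.
  by move=> x Ux; have [B [_ Ox cO]] := H x Ux; exact: cO.
split=> [x Ux|v].
  by have [B [_ Ox [df _]]] := H x Ux; exact: df.
apply: IH => x Ux; have [B [oO Ox [_ Df]]] := H x Ux.
by exists B; split=> //; exact: Df.
Qed.

Lemma Ck_on_cst V W k (U : set V) (a : W) : Ck_on k U (fun _ : V => a).
Proof.
elim: k a => [|k IH] a /=; first by move=> x _; exact: cst_continuous.
split=> [x _|v]; first exact: differentiable_cst.
have -> : (fun x => 'D_v (fun _ : V => a) x) = fun _ => 0.
  by apply/funext => x; exact: derive_cst.
exact: IH.
Qed.

Lemma derive_lin V W Z (f : V -> W) (l : {linear W -> Z}) x v :
  continuous l -> differentiable f x -> 'D_v (fun y => l (f y)) x = l ('D_v f x).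
Proof.
move=> cl df.
have dl : differentiable l (f x) by exact: linear_differentiable.
rewrite !derive_diff//; last exact: differentiable_comp.
by rewrite [LHS](congr1 (@^~ v) (diff_comp df dl)) /= diff_lin.
Qed.

Lemma Ck_on_lin V W Z k (U : set V) (f : V -> W) (l : {linear W -> Z}) : open U ->
  continuous l -> Ck_on k U f -> Ck_on k U (fun x => l (f x)).
Proof.
move=> oU cl; elim: k f => [|k IH] f /=.
  move=> cf x Ux; exact: continuous_comp (cf x Ux) (cl _).
case=> df Df; split=> [x Ux|v].
  by apply: differentiable_comp (df x Ux) _; exact: linear_differentiable.
apply: Ck_on_eq (IH _ (Df v)) => // x Ux.
by rewrite derive_lin//; exact: df.
Qed.

Lemma Ck_onD V W k (U : set V) (f g : V -> W) : open U ->
  Ck_on k U f -> Ck_on k U g -> Ck_on k U (fun x => f x + g x).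
Proof.
move=> oU; elim: k f g => [|k IH] f g /=.
  by move=> cf cg x Ux; apply: continuousD; [exact: cf|exact: cg].
case=> df Df [dg Dg]; split=> [x Ux|v].
  by apply: differentiableD; [exact: df|exact: dg].
apply: Ck_on_eq (IH _ _ (Df v) (Dg v)) => // x Ux.
by rewrite -deriveD //; apply: diff_derivable; [exact: df|exact: dg].
Qed.

Lemma Ck_on_sum V W k (U : set V) n (f : 'I_n -> V -> W) : open U ->
  (forall i, Ck_on k U (f i)) -> Ck_on k U (fun x => \sum_(i < n) f i x).
Proof.
move=> oU; elim: n f => [|n IH] f Hf.
  by apply: Ck_on_eq (Ck_on_cst _ _ 0) => // x _; rewrite big_ord0.
apply: Ck_on_eq (Ck_onD oU (IH _ (fun i => Hf (widen_ord (leqnSn n) i))) (Hf ord_max)) => // x _.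
by rewrite big_ord_recr.
Qed.

Lemma Ck_onM V k (U : set V) (f g : V -> R^o) : open U ->
  Ck_on k U f -> Ck_on k U g -> Ck_on k U ((fun x => f x * g x) : V -> R^o).
Proof.
move=> oU; elim: k f g => [|k IH] f g /=.
  by move=> cf cg x Ux; apply: continuousM; [exact: cf|exact: cg].
move=> Hf Hg; have [df Df] := Hf; have [dg Dg] := Hg; split=> [x Ux|v].
  by apply: differentiableM; [exact: df|exact: dg].
apply: Ck_on_eq (Ck_onD oU (IH _ _ (Ck_onS Hf) (Dg v)) (IH _ _ (Ck_onS Hg) (Df v))) => // x Ux.
by rewrite (deriveM (diff_derivable (df x Ux)) (diff_derivable (dg x Ux))).
Qed.

Definition scalel W (w : W) (a : R^o) : W := a *: w.

Lemma scalel_linear W (w : W) : linear (scalel w).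
Proof. by move=> a u v; rewrite /scalel scalerDl scalerA. Qed.

HB.instance Definition _ W (w : W) :=
  GRing.isLinear.Build R R^o W *:%R (scalel w) (scalel_linear w).

Lemma Ck_onZl V W k (U : set V) (f : V -> R^o) (w : W) : open U ->
  Ck_on k U f -> Ck_on k U (fun x => f x *: w).
Proof.
move=> oU; apply: (@Ck_on_lin _ _ _ _ _ _ (scalel w)) => // x.
exact: scalel_continuous.
Qed.

(** Finite dimension in the form the chain rule uses: vectors are recovered from continuous
    coordinates. *)
Definition basis_pair W n (e : 'I_n -> W) (l : 'I_n -> {linear W -> R^o}) :=
  (forall i, continuous (l i)) /\ forall w, w = \sum_(i < n) l i w *: e i.

Definition findim W := exists n (e : 'I_n -> W) (l : 'I_n -> {linear W -> R^o}), basis_pair e l.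

(** The derivative of [g \o f] along [v] is the sum of the products of the coordinates of ['D_v f]
    with the partial derivatives of [g], evaluated along [f]. This finite sum is what makes the
    induction on the order possible, and the reason for the finiteness assumption. *)
Lemma Ck_on_comp_scalar V W k (U : set V) (U' : set W) (f : V -> W) (g : W -> R^o) :
  findim W -> open U -> (forall x, U x -> U' (f x)) ->
  Ck_on k U f -> Ck_on k U' g -> Ck_on k U (g \o f).
Proof.
move=> [n [e [l [cl El]]]] oU UU'; elim: k f g UU' => [|k IH] f g UU' /=.
  move=> cf cg x Ux; exact: continuous_comp (cf x Ux) (cg _ (UU' _ Ux)).
move=> Hf Hg; have [df Df] := Hf; have [dg Dg] := Hg; split=> [x Ux|v].
  by apply: differentiable_comp; [exact: df|apply: dg; exact: UU'].
have H i : Ck_on k U (fun x => l i ('D_v f x) * 'D_(e i) g (f x) : R^o).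
  by apply: Ck_onM => //; [exact: Ck_on_lin|apply: (IH f (fun y => 'D_(e i) g y)) => //; exact: Ck_onS].
apply: Ck_on_eq (Ck_on_sum oU H) => // x Ux.
rewrite [RHS]derive_diff; last by apply: differentiable_comp; [exact: df|apply: dg; exact: UU'].
rewrite [RHS](congr1 (@^~ v) (diff_comp (df x Ux) (dg _ (UU' _ Ux)))) /=.
have -> : 'd f x v = 'D_v f x by rewrite derive_diff //; exact: df.
rewrite [in RHS](El ('D_v f x)) linear_sum; apply: eq_bigr => i _.
rewrite linearZ /= -derive_diff; last by apply: dg; exact: UU'.
by [].
Qed.

Lemma Ck_on_comp V W Z k (U : set V) (U' : set W) (f : V -> W) (g : W -> Z) :
  findim W -> findim Z -> open U -> open U' -> (forall x, U x -> U' (f x)) ->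
  Ck_on k U f -> Ck_on k U' g -> Ck_on k U (g \o f).
Proof.
move=> fW [n [e [l [cl El]]]] oU oU' UU' Hf Hg.
have H i : Ck_on k U (fun x => l i (g (f x)) *: e i).
  apply: Ck_onZl => //.
  by apply: (@Ck_on_comp_scalar _ _ _ _ U' f (l i \o g)) => //; exact: Ck_on_lin.
by apply: Ck_on_eq (Ck_on_sum oU H) => // x Ux; rewrite -El.
Qed.

Lemma findim_R : findim R^o.
Proof.
exists 1%N, (fun _ => 1), (fun _ => idfun); split=> [_ x|w]; first exact: cvg_id.
by rewrite big_ord1 /=; rewrite /GRing.scale /= mulr1.
Qed.

Lemma findim_pair V W : findim V -> findim W -> findim (V * W)%type.
Proof.
move=> [n [e [l [cl El]]]] [m [e' [l' [cl' El']]]].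
exists (n + m)%N.
exists (fun i : 'I_(n + m) => match fintype.split i with inl j => (e j, 0) | inr j => (0, e' j) end).
exists (fun i : 'I_(n + m) => match fintype.split i with
  inl j => l j \o fst : {linear (V * W)%type -> R^o}
  | inr j => l' j \o snd : {linear (V * W)%type -> R^o} end).
split.
  move=> i; case: (fintype.split i) => j x /=.
    by apply: continuous_comp; [exact: cvg_fst|exact: cl].
  by apply: continuous_comp; [exact: cvg_snd|exact: cl'].
case=> v w; rewrite big_split_ord /=.
under eq_bigr => i _ do rewrite (unsplitK (inl i)) /=.
under [X in _ + X]eq_bigr => i _ do rewrite (unsplitK (inr i)) /=.
have fst_sum q (F : 'I_q -> V * W) : (\sum_(i < q) F i).1 = \sum_(i < q) (F i).1.
  exact: (big_morph fst).
have snd_sum q (F : 'I_q -> V * W) : (\sum_(i < q) F i).2 = \sum_(i < q) (F i).2.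
  exact: (big_morph snd).
apply: injective_projections => /=; rewrite ?fst_sum ?snd_sum /=.
  by rewrite [X in _ + X]big1 ?addr0 => [|i _]; [exact: El|rewrite scaler0].
by rewrite big1 ?add0r => [|i _]; [exact: El'|rewrite scaler0].
Qed.

Lemma findim_rV n : findim 'rV[R]_n.
Proof.
have lin (i : 'I_n) : linear (fun u : 'rV[R]_n => u 0 i : R^o).
  by move=> a u v; rewrite !mxE.
pose L i : {linear 'rV[R]_n -> R^o} := HB.pack (fun u : 'rV[R]_n => u 0 i : R^o)
  (GRing.isLinear.Build _ _ _ _ _ (lin i)).
exists n, (fun i => delta_mx 0 i), L; split=> [i u|w].
  exact: coord_continuous.
by rewrite [LHS]matrix_sum_delta big_ord1.
Qed.

End CkCalculus.

Section SmoothCalculus.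
Context {R : realType}.
Implicit Types (V W Z : normedModType R).

#[local] Hint Resolve findim_R : core.

Lemma Ck_on_linear V W k (U : set V) (l : {linear V -> W}) :
  continuous l -> Ck_on k U l.
Proof.
move=> cl; case: k => [|k] /=; first by move=> x _; exact: cl.
split=> [x _|v]; first exact: linear_differentiable.
have -> : (fun x => 'D_v l x) = fun _ => l v.
  by apply/funext => x; rewrite derive_diff ?diff_lin//; exact: linear_differentiable.
exact: Ck_on_cst.
Qed.

Lemma smooth_linear V W (U : set V) (l : {linear V -> W}) :
  continuous l -> smooth_on U l.
Proof. by move=> cl k; exact: Ck_on_linear. Qed.

Lemma smooth_id V (U : set V) : smooth_on U id.
Proof. by apply: (@smooth_linear _ _ _ idfun) => x; exact: cvg_id. Qed.

Lemma smooth_fst V W (U : set (V * W)) : smooth_on U fst.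
Proof. by apply: (@smooth_linear _ _ _ fst) => x; exact: cvg_fst. Qed.

Lemma smooth_snd V W (U : set (V * W)) : smooth_on U snd.
Proof. by apply: (@smooth_linear _ _ _ snd) => x; exact: cvg_snd. Qed.

Lemma smooth_sub V W (U U' : set V) (f : V -> W) :
  U' `<=` U -> smooth_on U f -> smooth_on U' f.
Proof. by move=> s sf k; exact: Ck_on_sub (sf k). Qed.

Lemma smooth_eq V W (U : set V) (f g : V -> W) : open U ->
  (forall x, U x -> f x = g x) -> smooth_on U f -> smooth_on U g.
Proof. by move=> oU fg sf k; exact: Ck_on_eq (sf k). Qed.

Lemma smooth_local V W (U : set V) (f : V -> W) :
  (forall x, U x -> exists B : set V, [/\ open B, B x & smooth_on B f]) -> smooth_on U f.
Proof.
move=> H k; apply: Ck_on_local => x Ux; have [B [oB Bx sB]] := H x Ux.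
by exists B; split=> //; exact: sB.
Qed.

Lemma smooth_cst V W (U : set V) (a : W) : smooth_on U (fun _ : V => a).
Proof. by move=> k; exact: Ck_on_cst. Qed.

Lemma smoothD V W (U : set V) (f g : V -> W) : open U ->
  smooth_on U f -> smooth_on U g -> smooth_on U (fun x => f x + g x).
Proof. by move=> oU sf sg k; apply: Ck_onD (sf k) (sg k). Qed.

Lemma smooth_lin V W Z (U : set V) (f : V -> W) (l : {linear W -> Z}) : open U ->
  continuous l -> smooth_on U f -> smooth_on U (fun x => l (f x)).
Proof. by move=> oU cl sf k; exact: Ck_on_lin (sf k). Qed.

Lemma smoothZ V W (U : set V) (a : R) (f : V -> W) : open U ->
  smooth_on U f -> smooth_on U (fun x => a *: f x).
Proof.
move=> oU; apply: (@smooth_lin _ _ _ _ _ ( *:%R a : {linear W -> W})) => //.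
exact: scaler_continuous.
Qed.

Lemma smoothN V W (U : set V) (f : V -> W) : open U ->
  smooth_on U f -> smooth_on U (fun x => - f x).
Proof.
move=> oU sf; have -> : (fun x => - f x) = (fun x => (-1) *: f x).
  by apply/funext => x; rewrite scaleN1r.
exact: smoothZ.
Qed.

Lemma smoothB V W (U : set V) (f g : V -> W) : open U ->
  smooth_on U f -> smooth_on U g -> smooth_on U (fun x => f x - g x).
Proof. by move=> oU sf sg; apply: smoothD => //; exact: smoothN. Qed.

Lemma smooth_sum V W (U : set V) n (f : 'I_n -> V -> W) : open U ->
  (forall i, smooth_on U (f i)) -> smooth_on U (fun x => \sum_(i < n) f i x).
Proof. by move=> oU sf k; apply: Ck_on_sum => // i; exact: sf. Qed.

Lemma smoothM V (U : set V) (f g : V -> R^o) : open U ->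
  smooth_on U f -> smooth_on U g -> smooth_on U ((fun x => f x * g x) : V -> R^o).
Proof. by move=> oU sf sg k; apply: Ck_onM (sf k) (sg k). Qed.

Lemma smoothZl V W (U : set V) (f : V -> R^o) (w : W) : open U ->
  smooth_on U f -> smooth_on U (fun x => f x *: w).
Proof. by move=> oU sf k; exact: Ck_onZl (sf k). Qed.

Lemma smooth_comp V W Z (U : set V) (U' : set W) (f : V -> W) (g : W -> Z) :
  findim W -> findim Z -> open U -> open U' -> (forall x, U x -> U' (f x)) ->
  smooth_on U f -> smooth_on U' g -> smooth_on U (fun x => g (f x)).
Proof. by move=> fW fZ oU oU' H sf sg k; exact: Ck_on_comp H (sf k) (sg k). Qed.

Lemma smooth_derive V W (U : set V) (f : V -> W) v :
  smooth_on U f -> smooth_on U (fun x => 'D_v f x).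
Proof. by move=> sf k; have [_ +] := sf k.+1; exact. Qed.

Lemma smooth_differentiable V W (U : set V) (f : V -> W) x :
  smooth_on U f -> U x -> differentiable f x.
Proof. by move=> sf; have [] := sf 1%N; move=> + _; exact. Qed.

Lemma smooth_continuous V W (U : set V) (f : V -> W) x :
  smooth_on U f -> U x -> {for x, continuous f}.
Proof. by move=> sf; exact: (sf 0%N). Qed.

Lemma smooth_coord V n (U : set V) (f : V -> 'rV[R]_n) i : open U ->
  smooth_on U f -> smooth_on U ((fun x => f x 0 i) : V -> R^o).
Proof.
move=> oU.
have lin : linear (fun u : 'rV[R]_n => u 0 i : R^o) by move=> a u v; rewrite !mxE.
pose l : {linear 'rV[R]_n -> R^o} := HB.pack (fun u : 'rV[R]_n => u 0 i : R^o)
  (GRing.isLinear.Build _ _ _ _ _ lin).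
by apply: (@smooth_lin _ _ _ _ _ l) => // u; exact: coord_continuous.
Qed.

Lemma smooth_row V n (U : set V) (f : V -> 'rV[R]_n) : open U ->
  (forall i, smooth_on U ((fun x => f x 0 i) : V -> R^o)) -> smooth_on U f.
Proof.
move=> oU sf.
apply: (@smooth_eq _ _ _ (fun x => \sum_(i < n) f x 0 i *: delta_mx 0 i)) => //.
  by move=> x _; rewrite [RHS]matrix_sum_delta big_ord1.
by apply: smooth_sum => // i; apply: smoothZl => //; exact: sf.
Qed.

Lemma derive_coord V n (f : V -> 'rV[R]_n) i x v : differentiable f x ->
  'D_v f x 0 i = 'D_v ((fun x => f x 0 i) : V -> R^o) x.
Proof. by move=> df; rewrite derive_mx ?mxE//; exact: diff_derivable. Qed.

Lemma smooth_pair V W Z (U : set V) (f : V -> W) (g : V -> Z) : open U ->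
  smooth_on U f -> smooth_on U g -> smooth_on U (fun x => (f x, g x)).
Proof.
move=> oU sf sg.
have lin1 : linear (fun w : W => (w, 0 : Z)).
  by move=> a u v; apply: injective_projections; rewrite /= ?scaler0 ?addr0.
have lin2 : linear (fun w : Z => (0 : W, w)).
  by move=> a u v; apply: injective_projections; rewrite /= ?scaler0 ?addr0.
pose l1 : {linear W -> (W * Z)%type} := HB.pack (fun w : W => (w, 0 : Z))
  (GRing.isLinear.Build _ _ _ _ _ lin1).
pose l2 : {linear Z -> (W * Z)%type} := HB.pack (fun w : Z => (0 : W, w))
  (GRing.isLinear.Build _ _ _ _ _ lin2).
apply: (@smooth_eq _ _ _ (fun x => l1 (f x) + l2 (g x))) => //.
  by move=> x _; apply: injective_projections; rewrite /= ?addr0 ?add0r.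
apply: smoothD => //; apply: smooth_lin => // x.
  by apply: cvg_pair; [exact: cvg_id|exact: cvg_cst].
by apply: cvg_pair; [exact: cvg_cst|exact: cvg_id].
Qed.

(** Bootstrapping: when the derivative is expressed through functions of the same family, smoothness
    follows by induction on the order. *)
Lemma Ck_on_derive1 k (U : set R^o) (h h' : R^o -> R^o) : open U ->
  (forall x, U x -> is_derive (x : R^o) (1 : R^o) h (h' x)) -> Ck_on k U h' -> Ck_on k.+1 U h.
Proof.
move=> oU dh ch'; split=> [x Ux|v].
  by apply/derivable1_diffP; have [] := dh x Ux.
apply: (@Ck_on_eq _ _ _ _ _ (fun x => v * h' x)) => //.
  move=> x Ux; have [dx <-] := dh x Ux.
  rewrite -[in RHS](mulr1 v) -[v * 1]/(v *: (1 : R^o)) deriveZv//.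
  exact/derivable1_diffP.
by apply: Ck_onM => //; exact: Ck_on_cst.
Qed.

Definition nz : set R^o := [set x : R^o | x != 0].
Definition pos : set R^o := [set x : R^o | 0 < x].

Lemma open_nz : open nz.
Proof. exact: (@open_neq R 0). Qed.

Lemma open_pos : open pos.
Proof. exact: open_gt. Qed.

Lemma smooth_invR : smooth_on nz (fun x : R^o => x^-1 : R^o).
Proof.
elim=> [|k IH].
  by move=> x x0; exact: inv_continuous.
apply: (@Ck_on_derive1 _ _ _ (fun x => - (x^-1 * x^-1))).
- exact: open_nz.
- move=> x x0.
  have dx : derivable (id : R^o -> R^o) x 1 by exact: derivable_id.
  apply: DeriveDef; first exact: derivableV.
  by rewrite deriveV// derive_id /GRing.scale /= mulr1 expr2 invfM.
- apply: (@Ck_on_eq _ _ _ _ _ (fun x : R^o => (-1) * (x^-1 * x^-1))).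
  + exact: open_nz.
  + by move=> x _; rewrite mulN1r.
  + apply: Ck_onM; [exact: open_nz|exact: Ck_on_cst|].
    by apply: Ck_onM => //; exact: open_nz.
Qed.

Lemma smooth_sqrtR : smooth_on pos (fun x : R^o => Num.sqrt x : R^o).
Proof.
elim=> [|k IH].
  by move=> x x0; exact: sqrt_continuous.
apply: (@Ck_on_derive1 _ _ _ (fun x => (2 * Num.sqrt x)^-1) open_pos).
apply: (@Ck_on_comp _ _ _ _ _ _ nz (fun x : R^o => 2 * Num.sqrt x : R^o) (fun x : R^o => x^-1 : R^o) findim_R findim_R open_pos open_nz).
- by move=> x x0; rewrite /nz /= mulf_neq0// gt_eqF// sqrtr_gt0.
- by apply: Ck_onM => //; exact: Ck_on_cst.
- exact: smooth_invR.
Qed.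

Lemma smoothV V (U : set V) (f : V -> R^o) : open U -> (forall x, U x -> f x != 0) ->
  smooth_on U f -> smooth_on U ((fun x => (f x)^-1) : V -> R^o).
Proof.
move=> oU f0 sf; apply: (@smooth_comp _ _ _ _ nz f (fun x : R^o => x^-1 : R^o)) => //.
- exact: smooth_invR.
Qed.

Lemma smooth_sqrt V (U : set V) (f : V -> R^o) : open U -> (forall x, U x -> 0 < f x) ->
  smooth_on U f -> smooth_on U ((fun x => Num.sqrt (f x)) : V -> R^o).
Proof.
move=> oU f0 sf; apply: (@smooth_comp _ _ _ _ pos f (fun x : R^o => Num.sqrt x : R^o)) => //.
- exact: smooth_sqrtR.
Qed.

End SmoothCalculus.

(** * Plane calculus *)
Section SegmentCalculus.
Context {R : realType} {V : normedModType R}.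
Implicit Types (z u v : V).

Lemma growth_seg (W : normedModType R) (f : V -> W) z v (t : R) :
  (fun h : R => h^-1 *: ((f \o (fun s : R => z + s *: v)) (h *: (1 : R^o) + t) - f (z + t *: v))) =
  (fun h : R => h^-1 *: (f (h *: v + (z + t *: v)) - f (z + t *: v))).
Proof.
apply/funext => h; rewrite /comp; congr (_ *: (f _ - _)).
have -> : h *: (1 : R^o) + t = h + t :> R by congr (_ + _); exact: mulr1.
by rewrite scalerDl addrCA.
Qed.

Lemma is_derive_seg (W : normedModType R) (f : V -> W) z v (t : R) :
  differentiable f (z + t *: v) ->
  is_derive (t : R^o) (1 : R^o) (fun s : R^o => f (z + s *: v)) ('D_v f (z + t *: v)).
Proof.
move=> df; have dv := diff_derivable (v := v) df; split.
  rewrite /derivable; have := growth_seg f z v t; rewrite /comp => ->; exact: dv.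
by rewrite /derive; have := growth_seg f z v t; rewrite /comp => ->.
Qed.

Lemma mvt_seg (f : V -> R^o) z v : (forall t : R, 0 <= t <= 1 -> differentiable f (z + t *: v)) ->
  exists2 t : R, 0 < t < 1 & f (z + v) - f z = 'D_v f (z + t *: v).
Proof.
move=> df.
have [||c c01] := @MVT R (fun s : R => f (z + s *: v))
   (fun s : R => 'D_v f (z + s *: v)) 0 1 ltr01.
- move=> x; rewrite in_itv /= => /andP[/ltW x0 /ltW x1].
  by apply: is_derive_seg; apply: df; rewrite x0 x1.
- apply: derivable_within_continuous => x; rewrite in_itv /= => x01.
  by have [] := is_derive_seg (df x x01).
by rewrite scale1r scale0r addr0 subr0 mulr1 => E; exists c => //; move: c01; rewrite in_itv.
Qed.

Lemma itv01W (t : R) : 0 < t < 1 -> 0 <= t <= 1.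
Proof. by case/andP=> /ltW -> /ltW ->. Qed.

Lemma ball_convex z e a b (t : R) : ball z e a -> ball z e b -> 0 <= t <= 1 ->
  ball z e (a + t *: (b - a)).
Proof.
rewrite -ball_normE /ball_ /= => za zb /andP[t0 t1].
have -> : z - (a + t *: (b - a)) = (1 - t) *: (z - a) + t *: (z - b).
  rewrite scalerBl scale1r -[RHS]addrA [- _ + _]addrC -scalerBr.
  have -> : z - b - (z - a) = a - b by rewrite opprB addrC subrKA.
  by rewrite opprD addrA -scalerN opprB.
apply: le_lt_trans (ler_normD _ _) _.
rewrite !normrZ (ger0_norm t0) ger0_norm ?subr_ge0//.
have [->|tn0] := eqVneq t 0; first by rewrite subr0 mul1r mul0r addr0.
have t0' : 0 < t by rewrite lt_neqAle eq_sym tn0.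
rewrite [ltRHS](_ : e = (1 - t) * e + t * e); last by ring.
by apply: ler_ltD; [rewrite ler_wpM2l ?subr_ge0// ltW|rewrite ltr_pM2l].
Qed.

Lemma mvt_ball (f : V -> R^o) z e a b : (forall y, ball z e y -> differentiable f y) ->
  ball z e a -> ball z e b ->
  exists2 y, ball z e y & f b - f a = 'D_(b - a) f y.
Proof.
move=> df za zb; have [|t /itv01W t01 E] := @mvt_seg f a (b - a).
  by move=> t t01; apply: df; exact: ball_convex.
by exists (a + t *: (b - a)); [exact: ball_convex|rewrite -E [a + _]addrC subrK].
Qed.

Lemma ball_add z (e : R) w : `|w| < e -> ball z e (z + w).
Proof. by move=> we; rewrite -ball_normE /ball_ /= opprD addrA subrr sub0r normrN. Qed.

Lemma derive_translate (W : normedModType R) (f : V -> W) v x u :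
  'D_u (fun y => f (y + v)) x = 'D_u f (x + v).
Proof.
rewrite /derive.
have -> : (fun h : R => h^-1 *: (((fun y => f (y + v)) \o shift x) (h *: u) - f (x + v))) =
  (fun h : R => h^-1 *: ((f \o shift (x + v)) (h *: u) - f (x + v))) => //.
by apply/funext => h; rewrite /= addrA.
Qed.

(** The second difference over a parallelogram, by two applications of the mean value theorem. *)
Lemma schwarz_near (f : V -> R^o) z u v (e : R) :
  (forall y, ball z e y -> differentiable f y) ->
  (forall y, ball z e y -> differentiable (fun x => 'D_u f x) y) -> `|u| + `|v| < e ->
  exists2 y, ball z e y &
   f (z + u + v) - f (z + u) - (f (z + v) - f z) = 'D_v (fun x => 'D_u f x) y.
Proof.
move=> df ddf uve.
have bnd (t s : R) : 0 <= t <= 1 -> 0 <= s <= 1 -> ball z e (z + (t *: u + s *: v)).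
  move=> /andP[t0 t1] /andP[s0 s1]; apply: ball_add.
  apply: le_lt_trans uve; apply: le_trans (ler_normD _ _) _; rewrite !normrZ !ger0_norm//.
  by apply: lerD; rewrite ler_piMl.
have b0 (t : R) : 0 <= t <= 1 -> ball z e (z + t *: u).
  by move=> t01; have := bnd t 0 t01; rewrite lexx ler01 scale0r addr0; exact.
have b1 (t : R) : 0 <= t <= 1 -> ball z e (z + t *: u + v).
  by move=> t01; have := bnd t 1 t01; rewrite lexx ler01 scale1r addrA; exact.
pose g y : R^o := f (y + v) - f y.
have dsh (t : R) : 0 <= t <= 1 -> differentiable (fun y => f (y + v)) (z + t *: u).
  move=> t01; apply: differentiable_comp; last by apply: df; exact: b1.
  by apply: differentiableD => //; exact: differentiable_cst.
have [t t01|t /itv01W t01 Et] := @mvt_seg g z u.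
  by apply: differentiableB; [exact: (dsh t t01)|exact: (df _ (b0 t t01))].
have [s s01|s /itv01W s01 Es] := @mvt_seg (fun x => 'D_u f x) (z + t *: u) v.
  by apply: ddf; rewrite -addrA; exact: bnd.
exists (z + t *: u + s *: v); first by rewrite -addrA; exact: bnd.
rewrite -Es [LHS]Et /g deriveB; last 2 first.
- exact: (diff_derivable (dsh t t01)).
- exact: (diff_derivable (df _ (b0 t t01))).
by rewrite derive_translate.
Qed.

(** The second difference is symmetric in its two increments, so both mixed derivatives are limits of
    the same quotient. *)
Lemma schwarz (U : set V) (f : V -> R^o) z u v : open U -> smooth_on U f -> U z ->
  'D_v (fun y => 'D_u f y) z = 'D_u (fun y => 'D_v f y) z.
Proof.
move=> oU sf Uz; apply/eqP; apply/negPn/negP => ne.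
pose d := `|'D_v (fun y => 'D_u f y) z - 'D_u (fun y => 'D_v f y) z| / 2.
have d0 : 0 < d by rewrite divr_gt0// normr_gt0 subr_eq0.
have cont a b : \forall y \near z, `|'D_a (fun y => 'D_b f y) z - 'D_a (fun y => 'D_b f y) y| < d.
  have : {for z, continuous (fun y => 'D_a (fun y => 'D_b f y) y)}.
    by apply: smooth_continuous Uz; do 2 apply: smooth_derive.
  by move/cvgrPdist_lt; apply.
have : nbhs z (U `&` [set y | `|'D_v (fun y => 'D_u f y) z - 'D_v (fun y => 'D_u f y) y| < d]
   `&` [set y | `|'D_u (fun y => 'D_v f y) z - 'D_u (fun y => 'D_v f y) y| < d]).
  by apply: filterI; [apply: filterI; [exact: open_nbhs_nbhs|exact: cont]|exact: cont].
move=> /nbhs_ballP[e /= e0 He].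
have [r r0 ruv] : exists2 r : R, 0 < r & `|r *: u| + `|r *: v| < e.
  exists (e / 2 / (`|u| + `|v| + 1)); first by rewrite !divr_gt0// ltr_wpDl// addr_ge0.
  have p0 : 0 < `|u| + `|v| + 1 by rewrite ltr_wpDl// addr_ge0.
  rewrite [`|_ *: u|]normrZ [`|_ *: v|]normrZ -mulrDr ger0_norm ?divr_ge0// ?ltW//.
  apply: (@le_lt_trans _ _ (e / 2)); last by rewrite ltr_pdivrMr// ltr_pMr// ltr1n.
  rewrite -[leLHS]mulrA ger_pMr ?divr_gt0// ler_pdivrMl// mulr1 lerDl.
  by [].
have df y : ball z e y -> differentiable f y.
  by move=> /He[[Uy _] _]; exact: smooth_differentiable Uy.
have ddf a y : ball z e y -> differentiable (fun x => 'D_a f x) y.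
  by move=> /He[[Uy _] _]; apply: (smooth_differentiable _ Uy); exact: smooth_derive.
have dZ a b y : ball z e y -> 'D_(r *: a) (fun x => 'D_(r *: b) f x) y = r * (r * 'D_a (fun x => 'D_b f x) y).
  move=> By; have [[Uy _] _] := He _ By.
  rewrite deriveZv; last first.
    apply: (smooth_differentiable _ Uy); exact: smooth_derive.
  congr (_ * _); have -> : r * 'D_a (fun x => 'D_b f x) y = 'D_a (fun x => r *: 'D_b f x) y.
    by rewrite deriveZ//; apply: diff_derivable; exact: ddf.
  apply: near_eq_derive; apply: open_near_eq Uy _ => // x Ux.
  by rewrite deriveZv//; exact: smooth_differentiable Ux.
have [||y1 B1 E1] := @schwarz_near f z (r *: u) (r *: v) e df => //.
  by move=> y; apply: ddf.
have [||y2 B2 E2] := @schwarz_near f z (r *: v) (r *: u) e df => //.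
- by move=> y; apply: ddf.
- by rewrite addrC.
have E : 'D_v (fun y => 'D_u f y) y1 = 'D_u (fun y => 'D_v f y) y2.
  have rn : r != 0 by rewrite gt_eqF.
  apply: (mulfI rn); apply: (mulfI rn).
  apply: etrans (esym (dZ v u y1 B1)) _; apply: etrans _ (dZ u v y2 B2).
  apply: etrans (esym E1) _; apply: etrans _ E2.
  rewrite [z + r *: v + r *: u]addrAC.
  by rewrite opprB addrCA addrAC addrA [in RHS]opprB; ring.
have [[_ /= C1] _] := He _ B1; have [_ /= C2] := He _ B2.
have := ler_distD ('D_v (fun y => 'D_u f y) y1) ('D_v (fun y => 'D_u f y) z) ('D_u (fun y => 'D_v f y) z).
rewrite {2}E [X in _ <= _ + X]distrC => /le_lt_trans/(_ (ltrD C1 C2)).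
by rewrite /d -splitr ltxx.
Qed.

End SegmentCalculus.

(** * Derivations of the plane *)
HB.lock Definition px (R : realType) (f : R * R -> R^o) (w : R * R) : R^o :=
  'D_((1, 0) : R * R) f w.
HB.lock Definition py (R : realType) (f : R * R -> R^o) (w : R * R) : R^o :=
  'D_((0, 1) : R * R) f w.

Section ChainRule.
Context {R : realType} {V W Z : normedModType R}.

Lemma derive_comp (f : V -> W) (g : W -> Z) x v :
  differentiable f x -> differentiable g (f x) ->
  'D_v (fun y => g (f y)) x = 'D_('D_v f x) g (f x).
Proof.
move=> df dg; have dgf : differentiable (g \o f) x by exact: differentiable_comp.
rewrite (derive_diff v dgf) [LHS](congr1 (@^~ v) (diff_comp df dg)) /=.
by rewrite (derive_diff v df) (derive_diff _ dg).
Qed.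

Lemma derive_pair (f : V -> W) (g : V -> Z) x v :
  differentiable f x -> differentiable g x ->
  'D_v (fun y => (f y, g y)) x = ('D_v f x, 'D_v g x).
Proof.
move=> df dg; have dp := differentiable_pair df dg.
rewrite (derive_diff v dp) [LHS](congr1 (@^~ v) (diff_pair df dg)) /=.
by rewrite (derive_diff v df) (derive_diff v dg).
Qed.

End ChainRule.

Section PointwiseRules.
Context {R : realType} {V : normedModType R}.

Lemma derive_add (f g : V -> R^o) w v : differentiable f w -> differentiable g w ->
  'D_v ((fun z => f z + g z) : V -> R^o) w = 'D_v f w + 'D_v g w.
Proof. by move=> df dg; exact: (deriveD (diff_derivable df) (diff_derivable dg)). Qed.

Lemma derive_opp (f : V -> R^o) w v : differentiable f w ->
  'D_v ((fun z => - f z) : V -> R^o) w = - 'D_v f w.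
Proof. by move=> df; exact: (deriveN (diff_derivable df)). Qed.

Lemma derive_mul (f g : V -> R^o) w v : differentiable f w -> differentiable g w ->
  'D_v ((fun z => f z * g z) : V -> R^o) w = f w * 'D_v g w + g w * 'D_v f w.
Proof. by move=> df dg; exact: (deriveM (diff_derivable df) (diff_derivable dg)). Qed.

Lemma derive_eq_open (W : normedModType R) (U : set V) (f g : V -> W) w v : open U -> U w ->
  (forall z, U z -> f z = g z) -> 'D_v f w = 'D_v g w.
Proof. by move=> oU Uw fg; apply: near_eq_derive; exact: open_near_eq oU Uw fg. Qed.

Lemma chain1 (phi : R^o -> R^o) (phi' : R) (f : V -> R^o) w v :
  is_derive (f w) (1 : R^o) phi phi' -> differentiable f w ->
  'D_v ((fun y => phi (f y)) : V -> R^o) w = phi' * 'D_v f w.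
Proof.
move=> [dphi Ephi] df.
have dphi' : differentiable phi (f w) by apply/derivable1_diffP.
rewrite (derive_comp v df dphi') -Ephi.
have {1}-> : 'D_v f w = 'D_v f w *: (1 : R^o) by rewrite /GRing.scale /= mulr1.
by rewrite deriveZv// mulrC.
Qed.

End PointwiseRules.

Section Derivations.
Context {R : realType}.
Notation P := (R * R)%type.
Implicit Types (f g h : P -> R^o) (w : P) (U : set P) (e : P -> P).

Lemma pxEd f w : px f w = 'D_((1, 0) : P) f w. Proof. by rewrite px.unlock. Qed.
Lemma pyEd f w : py f w = 'D_((0, 1) : P) f w. Proof. by rewrite py.unlock. Qed.

Lemma smooth_px U f : smooth_on U f -> smooth_on U (px f).
Proof. by rewrite px.unlock; exact: smooth_derive. Qed.

Lemma smooth_py U f : smooth_on U f -> smooth_on U (py f).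
Proof. by rewrite py.unlock; exact: smooth_derive. Qed.

Lemma pyx U f w : open U -> smooth_on U f -> U w -> py (px f) w = px (py f) w.
Proof. by move=> oU sf Uw; rewrite !px.unlock !py.unlock; exact: (schwarz _ _ oU sf). Qed.

Lemma derive_xy (W : normedModType R) (f : P -> W) w (v : P) : differentiable f w ->
  'D_v f w = v.1 *: 'D_((1, 0) : P) f w + v.2 *: 'D_((0, 1) : P) f w.
Proof.
move=> df; rewrite -!deriveZv// -deriveDv//; congr ('D_ _ f w).
by case: v => a b; apply: injective_projections => /=; rewrite /GRing.scale /= !(mulr0, mulr1, addr0, add0r).
Qed.

Lemma smooth_field U f e : open U -> smooth_on U f -> smooth_on U e ->
  smooth_on U ((fun w => 'D_(e w) f w) : P -> R^o).
Proof.
move=> oU sf se.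
apply: (@smooth_eq _ _ _ _ (fun w => (e w).1 * px f w + (e w).2 * py f w : R^o)) => //.
  by move=> w Uw; rewrite pxEd pyEd [RHS]derive_xy//; exact: smooth_differentiable Uw.
have s1 : smooth_on U ((fun w => (e w).1) : P -> R^o).
  by apply: (@smooth_lin _ _ _ _ _ e (fst : {linear (R^o * R^o)%type -> R^o})) => // z; exact: cvg_fst.
have s2 : smooth_on U ((fun w => (e w).2) : P -> R^o).
  by apply: (@smooth_lin _ _ _ _ _ e (snd : {linear (R^o * R^o)%type -> R^o})) => // z; exact: cvg_snd.
exact: (smoothD oU (smoothM oU s1 (smooth_px sf)) (smoothM oU s2 (smooth_py sf))).
Qed.

Lemma exists_small (d e : R) : 0 < d -> 0 < e -> exists2 t : R, 0 < t & (t < d) && (t < e).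
Proof.
move=> d0 e0; have m0 : 0 < Num.min d e by rewrite lt_min d0.
exists (Num.min d e / 2); first by rewrite divr_gt0.
by rewrite -lt_min ltr_pdivrMr// ltr_pMr// ltr1n.
Qed.

(** The first and second derivative tests, applied to the restriction of [h] to a line. *)
Lemma max_second_order U h w (v : P) : open U -> smooth_on U h -> U w ->
  (forall y, U y -> h y <= h w) -> 'D_v h w = 0 /\ 'D_v (fun y => 'D_v h y) w <= 0.
Proof.
move=> oU sh Uw hmax.
have [e e0 eU] : exists2 e : R, 0 < e & forall t : R, `|t| < e -> U (w + t *: v).
  have /nbhs_ballP[e /= e0 He] := open_nbhs_nbhs (conj oU Uw).
  exists (e / (`|v| + 1)); first by rewrite divr_gt0// ltr_wpDl.
  move=> t te; apply: He; apply: ball_add; rewrite normrZ.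
  apply: le_lt_trans (_ : `|t| * `|v| <= `|t| * (`|v| + 1)) _.
    by rewrite ler_wpM2l// lerDl.
  by rewrite -ltr_pdivlMr// ltr_wpDl.
have dh t : `|t| < e -> differentiable h (w + t *: v).
  by move=> te; exact: (smooth_differentiable sh (eU _ te)).
have dDh : differentiable (fun y => 'D_v h y) (w + (0 : R) *: v).
  apply: (smooth_differentiable (smooth_derive v sh)).
  by apply: eU; rewrite normr0.
have w0 : w + (0 : R) *: v = w by rewrite scale0r addr0.
have in_e t : t \in `](- e), e[ -> `|t| < e by rewrite in_itv /= ltr_norml.
have z_e : 0 \in `](- e), e[ by rewrite in_itv /= oppr_lt0 e0.
have d0 : 'D_v h w = 0.
  have [||||_ E] := @derive1_at_max R (fun t => h (w + t *: v)) (- e) e 0.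
  - by rewrite ge0_cp// ltW.
  - by move=> t /in_e te; have [] := is_derive_seg (dh t te).
  - exact: z_e.
  - by move=> t /in_e te; rewrite w0; apply: hmax; exact: eU.
  have := is_derive_seg (dh 0 (in_e _ z_e)); rewrite w0 => -[_] <-; exact: E.
split=> //; rewrite leNgt; apply/negP.
have [dk Ek] := is_derive_seg dDh.
rewrite w0 in Ek.
pose k (t : R) : R := 'D_v h (w + t *: v).
have k0 : k 0 = 0 by rewrite /k w0.
have kc : (fun t : R => t^-1 *: (k (t *: (1 : R^o) + 0) - k 0)) t @[t --> 0^'] --> 'D_v (fun y => 'D_v h y) w.
  by rewrite -Ek; exact: dk.
move: kc; move: ('D_v (fun y => 'D_v h y) w) => A kc pos2.
have : \forall t \near 0^', 0 < t^-1 *: (k (t *: (1 : R^o) + 0) - k 0).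
  by move/cvgrPdist_lt : kc => /(_ _ pos2); apply: filterS => t; rewrite ltr_distlC subrr => /andP[].
move=> /nbhs_ballP[d /= dpos Hd]; clear kc Ek dk dDh A pos2.
have [t t0 /andP[td te]] := exists_small dpos e0.
have wU (s : R) : 0 <= s <= 1 -> `|s * t| < e.
  move=> /andP[s0 s1]; have tge := ltW t0; rewrite ger0_norm ?mulr_ge0//.
  by apply: le_lt_trans te; rewrite ler_piMl.
have [r r01|c /andP[c0 c1] Es] := @mvt_seg _ _ h w (t *: v).
  by rewrite scalerA; apply: dh; exact: wU.
have := hmax (w + t *: v) (eU _ _); rewrite gtr0_norm// => /(_ te).
have c01 := itv01W (introT andP (conj c0 c1)).
rewrite -subr_le0 Es scalerA deriveZv; last by apply: dh; exact: wU.
apply/negP; rewrite -ltNge; apply: mulr_gt0 => //.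
have st0 : 0 < c * t by rewrite mulr_gt0.
have st : `|c * t| < d.
  rewrite gtr0_norm//; apply: lt_trans td; by rewrite gtr_pMl.
have := Hd (c * t); rewrite -ball_normE /ball_ /= sub0r normrN => /(_ st).
rewrite gt_eqF// => /(_ isT).
rewrite k0 subr0 addr0.
have -> : (c * t) *: (1 : R^o) = c * t :> R by exact: mulr1.
by rewrite pmulr_rgt0 ?invr_gt0.
Qed.

Lemma chain2 (F : P -> R^o) f g w (v : P) : differentiable F (f w, g w) ->
  differentiable f w -> differentiable g w ->
  'D_v ((fun y => F (f y, g y)) : P -> R^o) w =
  px F (f w, g w) * 'D_v f w + py F (f w, g w) * 'D_v g w.
Proof.
move=> dF df dg.
have dp : differentiable (fun y => (f y, g y)) w by exact: differentiable_pair.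
rewrite (derive_comp v dp dF) (derive_pair v df dg) (derive_xy _ dF) pxEd pyEd.
exact: (congr2 (fun a b : R => a + b) (mulrC _ _) (mulrC _ _)).
Qed.

End Derivations.

Section Frame.
Context {R : realType}.
Notation P := (R * R)%type.
Definition jacobian2 (x y : P -> R^o) (w : P) : R := px x w * py y w - py x w * px y w.
(** [frame1] and [frame2] are the coordinate vector fields of the local coordinates (x, y). *)
Definition frame1 (x y : P -> R^o) (w : P) : P := (py y w / jacobian2 x y w, - px y w / jacobian2 x y w).
Definition frame2 (x y : P -> R^o) (w : P) : P := (- py x w / jacobian2 x y w, px x w / jacobian2 x y w).
End Frame.

(** Derivatives with respect to the coordinates x and y: for the third coordinate of an immersed
    surface they are the slopes of the surface as a graph over the (x, y)-plane. *)
HB.lock Definition d1 (R : realType) (x y f : R * R -> R^o) (w : R * R) : R^o :=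
  'D_(frame1 x y w) f w.
HB.lock Definition d2 (R : realType) (x y f : R * R -> R^o) (w : R * R) : R^o :=
  'D_(frame2 x y w) f w.

Section Graph.
Context {R : realType}.
Notation P := (R * R)%type.
Variables (U : set P) (x y : P -> R^o).
Hypotheses (oU : open U) (sx : smooth_on U x) (sy : smooth_on U y).

Notation jac := (jacobian2 x y).
Notation frame1 := (frame1 x y).
Notation frame2 := (frame2 x y).
Notation D1 := (d1 x y).
Notation D2 := (d2 x y).
Hypothesis J0 : forall w, U w -> jac w != 0.

Lemma D1Ed f w : D1 f w = 'D_(frame1 w) f w. Proof. by rewrite d1.unlock. Qed.
Lemma D2Ed f w : D2 f w = 'D_(frame2 w) f w. Proof. by rewrite d2.unlock. Qed.

Lemma D1E f w : differentiable f w -> D1 f w = (px f w * py y w - py f w * px y w) / jac w.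
Proof. by move=> df; rewrite D1Ed derive_xy// -pxEd -pyEd /GRing.scale /=; ring. Qed.

Lemma D2E f w : differentiable f w -> D2 f w = (py f w * px x w - px f w * py x w) / jac w.
Proof. by move=> df; rewrite D2Ed derive_xy// -pxEd -pyEd /GRing.scale /=; ring. Qed.

Lemma pxE f w : U w -> differentiable f w -> px f w = D1 f w * px x w + D2 f w * px y w.
Proof.
by move=> Uw df; rewrite D1E// D2E//; have := J0 Uw; rewrite /jacobian2 => ?; field.
Qed.

Lemma pyE f w : U w -> differentiable f w -> py f w = D1 f w * py x w + D2 f w * py y w.
Proof.
by move=> Uw df; rewrite D1E// D2E//; have := J0 Uw; rewrite /jacobian2 => ?; field.
Qed.

Lemma D1x w : U w -> D1 x w = 1.
Proof.
move=> Uw; rewrite D1E; last exact: smooth_differentiable Uw.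
by rewrite -/(jac w) divff// J0.
Qed.

Lemma D2x w : U w -> D2 x w = 0.
Proof.
move=> Uw; rewrite D2E; last exact: smooth_differentiable Uw.
by rewrite [_ * px x w]mulrC subrr mul0r.
Qed.

Lemma D1y w : U w -> D1 y w = 0.
Proof.
move=> Uw; rewrite D1E; last exact: smooth_differentiable Uw.
by rewrite [px y w * _]mulrC subrr mul0r.
Qed.

Lemma D2y w : U w -> D2 y w = 1.
Proof.
move=> Uw; rewrite D2E; last exact: smooth_differentiable Uw.
by rewrite [_ * px x w]mulrC [px y w * _]mulrC -/(jac w) divff// J0.
Qed.

Lemma smooth_jac : smooth_on U (jac : P -> R^o).
Proof.
exact: (smoothB oU (smoothM oU (smooth_px sx) (smooth_py sy))
                   (smoothM oU (smooth_py sx) (smooth_px sy))).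
Qed.

Lemma smooth_frame1 : smooth_on U frame1.
Proof.
have iJ := smoothV oU J0 smooth_jac.
exact: (smooth_pair oU (smoothM oU (smooth_py sy) iJ)
                       (smoothM oU (smoothN oU (smooth_px sy)) iJ)).
Qed.

Lemma smooth_frame2 : smooth_on U frame2.
Proof.
have iJ := smoothV oU J0 smooth_jac.
exact: (smooth_pair oU (smoothM oU (smoothN oU (smooth_py sx)) iJ)
                       (smoothM oU (smooth_px sx) iJ)).
Qed.

Lemma smooth_D1 (U' : set P) f : open U' -> U' `<=` U -> smooth_on U' f -> smooth_on U' (D1 f).
Proof. by move=> oU' sU sf; rewrite d1.unlock; apply: smooth_field => //; exact: smooth_sub smooth_frame1. Qed.

Lemma smooth_D2 (U' : set P) f : open U' -> U' `<=` U -> smooth_on U' f -> smooth_on U' (D2 f).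
Proof. by move=> oU' sU sf; rewrite d2.unlock; apply: smooth_field => //; exact: smooth_sub smooth_frame2. Qed.

(** Differentiating f_u = (D1 f) x_u + (D2 f) y_u in v and f_v = (D1 f) x_v + (D2 f) y_v in u and
    subtracting leaves the jacobian times the difference of the two sides. *)
Lemma D12C (U' : set P) f w : open U' -> U' `<=` U -> smooth_on U' f -> U' w ->
  D1 (D2 f) w = D2 (D1 f) w.
Proof.
move=> oU' sU sf Uw; have Uw' := sU _ Uw.
have s1 := smooth_D1 oU' sU sf; have s2 := smooth_D2 oU' sU sf.
have sxx := smooth_sub sU sx; have syy := smooth_sub sU sy.
have Ef : py (px f) w = px (py f) w by exact: (pyx oU').
have Ex : py (px x) w = px (py x) w by exact: (pyx oU).
have Ey : py (px y) w = px (py y) w by exact: (pyx oU).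
have EL : py (px f) w = py (D1 f) w * px x w + D1 f w * py (px x) w
     + (py (D2 f) w * px y w + D2 f w * py (px y) w).
  have -> : py (px f) w = py (fun z => D1 f z * px x z + D2 f z * px y z : R^o) w.
    rewrite [LHS]pyEd [RHS]pyEd; apply: (derive_eq_open _ oU' Uw) => z Uz.
    by apply: pxE; [exact: sU|exact: smooth_differentiable Uz].
  have H3 := smooth_px sxx; have H4 := smooth_px syy.
  have H1 := smoothM oU' s1 H3; have H2 := smoothM oU' s2 H4.
  rewrite [LHS]pyEd (derive_add _ (smooth_differentiable H1 Uw) (smooth_differentiable H2 Uw)).
  rewrite (derive_mul _ (smooth_differentiable s1 Uw) (smooth_differentiable H3 Uw)) (derive_mul _ (smooth_differentiable s2 Uw) (smooth_differentiable H4 Uw)).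
  rewrite -(pyEd (D1 f)) -(pyEd (D2 f)) -(pyEd (px x)) -(pyEd (px y)).
  ring.
have ER : px (py f) w = px (D1 f) w * py x w + D1 f w * px (py x) w
     + (px (D2 f) w * py y w + D2 f w * px (py y) w).
  have -> : px (py f) w = px (fun z => D1 f z * py x z + D2 f z * py y z : R^o) w.
    rewrite [LHS]pxEd [RHS]pxEd; apply: (derive_eq_open _ oU' Uw) => z Uz.
    by apply: pyE; [exact: sU|exact: smooth_differentiable Uz].
  have H3 := smooth_py sxx; have H4 := smooth_py syy.
  have H1 := smoothM oU' s1 H3; have H2 := smoothM oU' s2 H4.
  rewrite [LHS]pxEd (derive_add _ (smooth_differentiable H1 Uw) (smooth_differentiable H2 Uw)).
  rewrite (derive_mul _ (smooth_differentiable s1 Uw) (smooth_differentiable H3 Uw)) (derive_mul _ (smooth_differentiable s2 Uw) (smooth_differentiable H4 Uw)).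
  rewrite -(pxEd (D1 f)) -(pxEd (D2 f)) -(pxEd (py x)) -(pxEd (py y)).
  ring.
rewrite D1E ?D2E; try exact: smooth_differentiable Uw.
congr (_ / _); move: Ef; rewrite EL ER Ex Ey => Ef.
lra.
Qed.

End Graph.

(** * Second-order operators in graph coordinates *)
Section SecondDerivative.
Context {R : realType} {V : normedModType R}.

Lemma derive2_comb (U : set V) (h : V -> R^o) w (k l : R) (u v : V) :
  open U -> smooth_on U h -> U w ->
  'D_(k *: u + l *: v) (fun z => 'D_(k *: u + l *: v) h z) w =
  k ^+ 2 * 'D_u (fun z => 'D_u h z) w + k * l * ('D_u (fun z => 'D_v h z) w +
  'D_v (fun z => 'D_u h z) w) + l ^+ 2 * 'D_v (fun z => 'D_v h z) w :> R.
Proof.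
move=> oU sh Uw.
have dD p : differentiable (fun z => 'D_p h z) w.
  by apply: (smooth_differentiable _ Uw); exact: smooth_derive.
have dd p q : derivable (fun z => 'D_p h z) w q by exact: (diff_derivable (dD p)).
have -> : 'D_(k *: u + l *: v) (fun z => 'D_(k *: u + l *: v) h z) w =
   'D_(k *: u + l *: v) (k *: (fun z => 'D_u h z) + l *: (fun z => 'D_v h z) : V -> R^o) w.
  apply: near_eq_derive; apply: open_near_eq oU Uw _ => z Uz.
  have dh := smooth_differentiable sh Uz.
  by rewrite (deriveDv _ _ dh) (deriveZv _ _ dh) (deriveZv _ _ dh).
rewrite (deriveD (derivableZ (k := k) (dd u _)) (derivableZ (k := l) (dd v _))).
rewrite (deriveZ _ (dd u _)) (deriveZ _ (dd v _)).
rewrite (deriveDv _ _ (dD u)) (deriveDv _ _ (dD v)).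
rewrite !(deriveZv _ _ (dD u)) !(deriveZv _ _ (dD v)).
set A := 'D_u _ w; set B := 'D_v _ w; set C := 'D_u _ w; set D := 'D_v _ w.
by clearbody A B C D; rewrite /GRing.scale /=; ring.
Qed.

End SecondDerivative.

(** Multiplied by a, the left-hand side is the value of the form (A, B, C) at (a, b) plus the
    nonnegative multiple a c - b^2 of C. *)
Lemma trace_le0 (R : realFieldType) (a b c A B C : R) : 0 < a -> 0 <= a * c - b ^+ 2 ->
  a ^+ 2 * A + a * b * (B + B) + b ^+ 2 * C <= 0 -> C <= 0 ->
  a * A + 2 * b * B + c * C <= 0.
Proof.
move=> a0 d0 H1 H2; rewrite -(pmulr_rle0 _ a0).
have : (a * c - b ^+ 2) * C <= 0 by rewrite mulr_ge0_le0.
lra.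
Qed.

Section Operator.
Context {R : realType}.
Notation P := (R * R)%type.
Implicit Types (f g h : P -> R^o) (w : P).
Variables (U : set P) (x y a b c : P -> R^o).
Hypotheses (oU : open U) (sx : smooth_on U x) (sy : smooth_on U y).
Hypothesis J0 : forall w, U w -> jacobian2 x y w != 0.
Notation D1 := (d1 x y).
Notation D2 := (d2 x y).

(** [Lop] is the second-order operator with coefficients a, b, c and [Qf] its gradient form; they are
    linked by L (phi o g) = phi' L g + phi'' Q g, see [Lop_chain]. *)
Definition Lop h w : R :=
  a w * D1 (D1 h) w + 2 * b w * D1 (D2 h) w + c w * D2 (D2 h) w.
Definition Qf h w : R :=
  a w * D1 h w ^+ 2 + 2 * b w * (D1 h w * D2 h w) + c w * D2 h w ^+ 2.

Section At.
Variables (U' : set P) (w : P).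
Hypotheses (oU' : open U') (sU : U' `<=` U) (Uw : U' w).

Let s1 f : smooth_on U' f -> smooth_on U' (D1 f) := smooth_D1 oU sx sy J0 oU' sU.
Let s2 f : smooth_on U' f -> smooth_on U' (D2 f) := smooth_D2 oU sx sy J0 oU' sU.
Let df f : smooth_on U' f -> differentiable f w := fun sf => smooth_differentiable sf Uw.

Lemma D1_eq f g z : U' z -> (forall v, U' v -> f v = g v) -> D1 f z = D1 g z.
Proof. by move=> Uz fg; rewrite !D1Ed; exact: derive_eq_open _ oU' Uz fg. Qed.

Lemma D2_eq f g z : U' z -> (forall v, U' v -> f v = g v) -> D2 f z = D2 g z.
Proof. by move=> Uz fg; rewrite !D2Ed; exact: derive_eq_open _ oU' Uz fg. Qed.

Lemma D1_add f g z : U' z -> smooth_on U' f -> smooth_on U' g ->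
  D1 (fun v => f v + g v) z = D1 f z + D1 g z.
Proof.
move=> Uz sf sg; rewrite !D1Ed.
exact: derive_add _ (smooth_differentiable sf Uz) (smooth_differentiable sg Uz).
Qed.

Lemma D2_add f g z : U' z -> smooth_on U' f -> smooth_on U' g ->
  D2 (fun v => f v + g v) z = D2 f z + D2 g z.
Proof.
move=> Uz sf sg; rewrite !D2Ed.
exact: derive_add _ (smooth_differentiable sf Uz) (smooth_differentiable sg Uz).
Qed.

Lemma D1_mul f g z : U' z -> smooth_on U' f -> smooth_on U' g ->
  D1 (fun v => f v * g v) z = f z * D1 g z + g z * D1 f z.
Proof.
move=> Uz sf sg; rewrite !D1Ed.
exact: derive_mul _ (smooth_differentiable sf Uz) (smooth_differentiable sg Uz).
Qed.

Lemma D2_mul f g z : U' z -> smooth_on U' f -> smooth_on U' g ->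
  D2 (fun v => f v * g v) z = f z * D2 g z + g z * D2 f z.
Proof.
move=> Uz sf sg; rewrite !D2Ed.
exact: derive_mul _ (smooth_differentiable sf Uz) (smooth_differentiable sg Uz).
Qed.

Lemma D1_opp f z : U' z -> smooth_on U' f -> D1 (fun v => - f v) z = - D1 f z.
Proof. by move=> Uz sf; rewrite !D1Ed; exact: derive_opp _ (smooth_differentiable sf Uz). Qed.

Lemma D2_opp f z : U' z -> smooth_on U' f -> D2 (fun v => - f v) z = - D2 f z.
Proof. by move=> Uz sf; rewrite !D2Ed; exact: derive_opp _ (smooth_differentiable sf Uz). Qed.

Lemma D1_cst (k : R) z : D1 (fun _ => k) z = 0.
Proof. by rewrite D1Ed; exact: derive_cst. Qed.

Lemma D2_cst (k : R) z : D2 (fun _ => k) z = 0.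
Proof. by rewrite D2Ed; exact: derive_cst. Qed.

Lemma D1_chain1 (phi : R^o -> R^o) (phi' : R) g z : U' z -> smooth_on U' g ->
  is_derive (g z) (1 : R^o) phi phi' ->
  D1 (fun v => phi (g v)) z = phi' * D1 g z.
Proof.
move=> Uz sg dphi; rewrite !D1Ed.
exact: (chain1 _ dphi (smooth_differentiable sg Uz)).
Qed.

Lemma D2_chain1 (phi : R^o -> R^o) (phi' : R) g z : U' z -> smooth_on U' g ->
  is_derive (g z) (1 : R^o) phi phi' ->
  D2 (fun v => phi (g v)) z = phi' * D2 g z.
Proof.
move=> Uz sg dphi; rewrite !D2Ed.
exact: (chain1 _ dphi (smooth_differentiable sg Uz)).
Qed.

Lemma Lop_eq f g : (forall v, U' v -> f v = g v) -> Lop f w = Lop g w.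
Proof.
move=> fg; rewrite /Lop; congr (_ * _ + _ * _ + _ * _).
- by apply: D1_eq => // v Uv; exact: D1_eq.
- by apply: D1_eq => // v Uv; exact: D2_eq.
- by apply: D2_eq => // v Uv; exact: D2_eq.
Qed.

Lemma Lop_add f g : smooth_on U' f -> smooth_on U' g ->
  Lop (fun v => f v + g v) w = Lop f w + Lop g w.
Proof.
move=> sf sg; rewrite /Lop.
have E1 v : U' v -> D1 (fun v => f v + g v) v = D1 f v + D1 g v by move=> Uv; exact: D1_add.
have E2 v : U' v -> D2 (fun v => f v + g v) v = D2 f v + D2 g v by move=> Uv; exact: D2_add.
rewrite (D1_eq Uw E1) (D1_eq Uw E2) (D2_eq Uw E2).
rewrite (D1_add Uw (s1 sf) (s1 sg)) (D1_add Uw (s2 sf) (s2 sg)) (D2_add Uw (s2 sf) (s2 sg)).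
ring.
Qed.

Lemma Lop_opp f : smooth_on U' f -> Lop (fun v => - f v) w = - Lop f w.
Proof.
move=> sf; rewrite /Lop.
have E1 v : U' v -> D1 (fun v => - f v) v = - D1 f v by move=> Uv; exact: D1_opp.
have E2 v : U' v -> D2 (fun v => - f v) v = - D2 f v by move=> Uv; exact: D2_opp.
rewrite (D1_eq Uw E1) (D1_eq Uw E2) (D2_eq Uw E2).
rewrite (D1_opp Uw (s1 sf)) (D1_opp Uw (s2 sf)) (D2_opp Uw (s2 sf)).
ring.
Qed.

Lemma Lop_chain (phi phi1 : R^o -> R^o) (phi2 : R) g : smooth_on U' g ->
  smooth_on U' (fun v => phi1 (g v)) ->
  (forall v, U' v -> is_derive (g v) (1 : R^o) phi (phi1 (g v))) ->
  is_derive (g w) (1 : R^o) phi1 phi2 ->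
  Lop (fun v => phi (g v)) w = phi1 (g w) * Lop g w + phi2 * Qf g w.
Proof.
move=> sg sp dphi dphi1; rewrite /Lop /Qf.
have E1 v : U' v -> D1 (fun v => phi (g v)) v = phi1 (g v) * D1 g v.
  by move=> Uv; exact: D1_chain1 Uv sg (dphi v Uv).
have E2 v : U' v -> D2 (fun v => phi (g v)) v = phi1 (g v) * D2 g v.
  by move=> Uv; exact: D2_chain1 Uv sg (dphi v Uv).
rewrite (D1_eq Uw E1) (D1_eq Uw E2) (D2_eq Uw E2).
rewrite (D1_mul Uw sp (s1 sg)) (D1_mul Uw sp (s2 sg)) (D2_mul Uw sp (s2 sg)).
rewrite (D1_chain1 Uw sg dphi1) (D2_chain1 Uw sg dphi1).
ring.
Qed.

(** At a critical point of [h] the variation of the field [e] contributes nothing. *)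
Lemma derive_crit h (u : P) (e : P -> P) : smooth_on U' h -> smooth_on U' e ->
  px h w = 0 -> py h w = 0 ->
  'D_u (fun v => 'D_(e v) h v : R^o) w = 'D_u (fun v => 'D_(e w) h v : R^o) w.
Proof.
move=> sh se px0 py0.
have t1 : smooth_on U' ((fun w => (e w).1) : P -> R^o).
  by apply: (@smooth_lin _ _ _ _ _ e (fst : {linear (R^o * R^o)%type -> R^o})) => // z; exact: cvg_fst.
have t2 : smooth_on U' ((fun w => (e w).2) : P -> R^o).
  by apply: (@smooth_lin _ _ _ _ _ e (snd : {linear (R^o * R^o)%type -> R^o})) => // z; exact: cvg_snd.
have sp1 := smooth_px sh; have sp2 := smooth_py sh.
have c1 := smooth_cst U' ((e w).1 : R^o); have c2 := smooth_cst U' ((e w).2 : R^o).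
have E v (z : P) : U' v -> 'D_z h v = z.1 * px h v + z.2 * py h v :> R.
  by move=> Uv; rewrite (derive_xy _ (smooth_differentiable sh Uv)) pxEd pyEd.
have L : 'D_u (fun v => 'D_(e v) h v : R^o) w =
   'D_u (fun v => (e v).1 * px h v + (e v).2 * py h v : R^o) w.
  by apply: (derive_eq_open _ oU' Uw) => v Uv; exact: E.
have L' : 'D_u (fun v => 'D_(e w) h v : R^o) w =
   'D_u (fun v => (e w).1 * px h v + (e w).2 * py h v : R^o) w.
  by apply: (derive_eq_open _ oU' Uw) => v Uv; exact: E.
rewrite L L'.
rewrite (derive_add _ (df (smoothM oU' t1 sp1)) (df (smoothM oU' t2 sp2))).
rewrite (derive_add _ (df (smoothM oU' c1 sp1)) (df (smoothM oU' c2 sp2))).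
rewrite (derive_mul _ (df t1) (df sp1)) (derive_mul _ (df t2) (df sp2)).
rewrite (derive_mul _ (df c1) (df sp1)) (derive_mul _ (df c2) (df sp2)).
by rewrite px0 py0 !mul0r !addr0.
Qed.

(** The principal part is a nonnegative combination of second derivatives along lines. *)
Lemma Lop_max h : smooth_on U' h -> (forall v, U' v -> h v <= h w) ->
  0 < a w -> 0 <= a w * c w - b w ^+ 2 -> Lop h w <= 0.
Proof.
move=> sh hmax a0 d0.
have cr v := (max_second_order v oU' sh Uw hmax).1.
have so v := (max_second_order v oU' sh Uw hmax).2.
have px0 : px h w = 0 by rewrite pxEd; exact: cr.
have py0 : py h w = 0 by rewrite pyEd; exact: cr.
pose u := frame1 x y w; pose v := frame2 x y w.
have se1 := smooth_sub sU (smooth_frame1 oU sx sy J0).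
have se2 := smooth_sub sU (smooth_frame2 oU sx sy J0).
have dD (p q r : P) : smooth_on U' (fun z => 'D_q h z : R^o) by exact: smooth_derive.
have EA : D1 (D1 h) w = 'D_u (fun z => 'D_u h z) w.
  by rewrite D1Ed d1.unlock; exact: derive_crit.
have EB : D1 (D2 h) w = 'D_u (fun z => 'D_v h z) w.
  by rewrite D1Ed d2.unlock; exact: derive_crit.
have EC : D2 (D2 h) w = 'D_v (fun z => 'D_v h z) w.
  by rewrite D2Ed d2.unlock; exact: derive_crit.
have sD p : smooth_on U' (fun z => 'D_p h z) by exact: smooth_derive.
have EB' : 'D_v (fun z => 'D_u h z) w = 'D_u (fun z => 'D_v h z) w.
  exact: schwarz oU' sh Uw.
clearbody u v.
have H1 := so (a w *: u + b w *: v); have H2 := so v.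
rewrite (derive2_comb _ _ _ _ oU' sh Uw) EB' -EA -EB -EC in H1; rewrite -EC in H2.
move: H1 H2; rewrite /Lop.
move: (D1 (D1 h) w) (D1 (D2 h) w) (D2 (D2 h) w) => A B C.
exact: trace_le0.
Qed.

End At.
End Operator.

(** * A maximum principle with logarithmic poles *)
Section LocalMetric.
Context {R : realType}.
Notation P := (R * R)%type.
Implicit Types (f g h : P -> R^o) (w z : P).
Variables (U : set P) (x y a b c : P -> R^o).
Hypotheses (oU : open U) (sx : smooth_on U x) (sy : smooth_on U y).
Hypothesis J0 : forall w, U w -> jacobian2 x y w != 0.
Hypotheses (sa : smooth_on U a) (sb : smooth_on U b) (sc : smooth_on U c).
Hypothesis a0 : forall w, U w -> 0 < a w.
Hypothesis d0 : forall w, U w -> 0 < a w * c w - b w ^+ 2.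
Notation D1 := (d1 x y).
Notation D2 := (d2 x y).
Notation L := (Lop x y a b c).
Notation Q := (Qf x y a b c).

(** The form given by the adjugate of the coefficient matrix at z. Its square root is the distance for
    which the operator with coefficients frozen at z is, up to a factor, the Laplacian. *)
Definition qdist z w : R :=
  c z * ((x w - x z) * (x w - x z)) + (- (2 * b z)) * ((x w - x z) * (y w - y z)) +
  a z * ((y w - y z) * (y w - y z)).

Local Notation dx z w := (x w - x z).
Local Notation dy z w := (y w - y z).

Lemma smooth_dx z : smooth_on U (fun w => x w - x z : R^o).
Proof. exact: (smoothB oU sx (smooth_cst U (x z))). Qed.

Lemma smooth_dy z : smooth_on U (fun w => y w - y z : R^o).
Proof. exact: (smoothB oU sy (smooth_cst U (y z))). Qed.

Lemma smooth_qdist z : smooth_on U (qdist z : P -> R^o).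
Proof.
have H1 := smooth_dx z; have H2 := smooth_dy z.
have cs (k : R) := smooth_cst U (k : R^o).
exact: (smoothD oU (smoothD oU (smoothM oU (cs (c z)) (smoothM oU H1 H1))
  (smoothM oU (cs (- (2 * b z))) (smoothM oU H1 H2))) (smoothM oU (cs (a z)) (smoothM oU H2 H2))).
Qed.

Section Coordinates.
Variables (z : P).
Let H1 := smooth_dx z.
Let H2 := smooth_dy z.
Let cs (k : R) := smooth_cst U (k : R^o).

Lemma D1_dx w : U w -> D1 (fun w => x w - x z : R^o) w = 1.
Proof.
move=> Uw; rewrite (D1_add x y Uw sx (smoothN oU (cs (x z)))) (D1x sx J0 Uw).
by rewrite (D1_opp x y Uw (cs (x z))) D1_cst oppr0 addr0.
Qed.

Lemma D2_dx w : U w -> D2 (fun w => x w - x z : R^o) w = 0.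
Proof.
move=> Uw; rewrite (D2_add x y Uw sx (smoothN oU (cs (x z)))) (D2x _ sx Uw).
by rewrite (D2_opp x y Uw (cs (x z))) D2_cst oppr0 addr0.
Qed.

Lemma D1_dy w : U w -> D1 (fun w => y w - y z : R^o) w = 0.
Proof.
move=> Uw; rewrite (D1_add x y Uw sy (smoothN oU (cs (y z)))) (D1y _ sy Uw).
by rewrite (D1_opp x y Uw (cs (y z))) D1_cst oppr0 addr0.
Qed.

Lemma D2_dy w : U w -> D2 (fun w => y w - y z : R^o) w = 1.
Proof.
move=> Uw; rewrite (D2_add x y Uw sy (smoothN oU (cs (y z)))) (D2y sy J0 Uw).
by rewrite (D2_opp x y Uw (cs (y z))) D2_cst oppr0 addr0.
Qed.

Lemma D1_qdist w : U w -> D1 (qdist z) w = 2 * c z * dx z w + (- (2 * b z)) * dy z w.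
Proof.
move=> Uw; rewrite /qdist.
have T1 := smoothM oU H1 H1; have T2 := smoothM oU H1 H2; have T3 := smoothM oU H2 H2.
have S1 := smoothM oU (cs (c z)) T1; have S2 := smoothM oU (cs (- (2 * b z))) T2.
have S3 := smoothM oU (cs (a z)) T3.
rewrite (D1_add x y Uw (smoothD oU S1 S2) S3) (D1_add x y Uw S1 S2).
rewrite (D1_mul x y Uw (cs (c z)) T1) (D1_mul x y Uw (cs (- (2 * b z))) T2) (D1_mul x y Uw (cs (a z)) T3).
rewrite (D1_mul x y Uw H1 H1) (D1_mul x y Uw H1 H2) (D1_mul x y Uw H2 H2).
rewrite !D1_cst (D1_dx Uw) (D1_dy Uw).
ring.
Qed.

Lemma D2_qdist w : U w -> D2 (qdist z) w = 2 * a z * dy z w + (- (2 * b z)) * dx z w.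
Proof.
move=> Uw; rewrite /qdist.
have T1 := smoothM oU H1 H1; have T2 := smoothM oU H1 H2; have T3 := smoothM oU H2 H2.
have S1 := smoothM oU (cs (c z)) T1; have S2 := smoothM oU (cs (- (2 * b z))) T2.
have S3 := smoothM oU (cs (a z)) T3.
rewrite (D2_add x y Uw (smoothD oU S1 S2) S3) (D2_add x y Uw S1 S2).
rewrite (D2_mul x y Uw (cs (c z)) T1) (D2_mul x y Uw (cs (- (2 * b z))) T2) (D2_mul x y Uw (cs (a z)) T3).
rewrite (D2_mul x y Uw H1 H1) (D2_mul x y Uw H1 H2) (D2_mul x y Uw H2 H2).
rewrite !D2_cst (D2_dx Uw) (D2_dy Uw).
ring.
Qed.

Lemma Qf_qdist w : U w -> Q (qdist z) w =
  4 * (a w * (c z * dx z w - b z * dy z w) ^+ 2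
   + 2 * b w * ((c z * dx z w - b z * dy z w) * (a z * dy z w - b z * dx z w))
   + c w * (a z * dy z w - b z * dx z w) ^+ 2).
Proof. by move=> Uw; rewrite /Qf (D1_qdist Uw) (D2_qdist Uw); ring. Qed.

Lemma Lop_qdist w : U w -> L (qdist z) w = 2 * (a w * c z - 2 * b w * b z + c w * a z).
Proof.
move=> Uw; rewrite /Lop.
have sl (k l : R) : smooth_on U (fun w => k * (x w - x z) + l * (y w - y z) : R^o).
  exact: (smoothD oU (smoothM oU (cs k) H1) (smoothM oU (cs l) H2)).
have E1 (k l : R) : D1 (fun w => k * (x w - x z) + l * (y w - y z) : R^o) w = k.
  have S1 := smoothM oU (cs k) H1; have S2 := smoothM oU (cs l) H2.
  rewrite (D1_add x y Uw S1 S2) (D1_mul x y Uw (cs k) H1) (D1_mul x y Uw (cs l) H2).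
  by rewrite !D1_cst (D1_dx Uw) (D1_dy Uw); ring.
have E2 (k l : R) : D2 (fun w => k * (x w - x z) + l * (y w - y z) : R^o) w = l.
  have S1 := smoothM oU (cs k) H1; have S2 := smoothM oU (cs l) H2.
  rewrite (D2_add x y Uw S1 S2) (D2_mul x y Uw (cs k) H1) (D2_mul x y Uw (cs l) H2).
  by rewrite !D2_cst (D2_dx Uw) (D2_dy Uw); ring.
have F1 v : U v -> D1 (qdist z) v = 2 * c z * (x v - x z) + (- (2 * b z)) * (y v - y z).
  exact: D1_qdist.
have F2 v : U v -> D2 (qdist z) v = (- (2 * b z)) * (x v - x z) + 2 * a z * (y v - y z).
  by move=> Uv; rewrite (D2_qdist Uv) addrC.
rewrite (D1_eq x y oU Uw F1) (D1_eq x y oU Uw F2) (D2_eq x y oU Uw F2) !E1 !E2.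
ring.
Qed.

End Coordinates.

Lemma qdist_ge z w :
  (a z * c z - b z ^+ 2) * (dx z w ^+ 2 + dy z w ^+ 2) <= (a z + c z) * qdist z w.
Proof.
rewrite -subr_ge0 (_ : _ - _ =
   (c z * dx z w - b z * dy z w) ^+ 2 + (a z * dy z w - b z * dx z w) ^+ 2).
  by rewrite addr_ge0// sqr_ge0.
by rewrite /qdist; ring.
Qed.

Lemma near_bound g p : {for p, continuous g} -> \forall w \near p, `|g w| <= `|g p| + 1.
Proof.
move=> cg; have /cvgrPdist_le/(_ 1 ltr01) : g w @[w --> p] --> g p by exact: cg.
apply: filterS => w H; rewrite -[g w](subKr (g p)) .
by apply: le_trans (ler_normB _ _) _; rewrite lerD2l.
Qed.

Lemma near_pos g p : {for p, continuous g} -> 0 < g p -> \forall w \near p, g p / 2 <= g w.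
Proof.
move=> cg gp; have /cvgrPdist_le/(_ (g p / 2)) : g w @[w --> p] --> g p by exact: cg.
have gp2 : 0 < g p / 2 by rewrite divr_gt0.
move=> /(_ gp2); apply: filterS => w.
by rewrite ler_distlC => /andP[+ _]; lra.
Qed.

Lemma near_fst (p : P) (A : P -> Prop) : (\forall w \near p, A w) -> \forall u \near (p, p), A u.1.
Proof. by move=> H; exact: (@cvg_fst _ _ (nbhs p) (nbhs p) _ A H). Qed.

Lemma near_snd (p : P) (A : P -> Prop) : (\forall w \near p, A w) -> \forall u \near (p, p), A u.2.
Proof. by move=> H; exact: (@cvg_snd _ _ (nbhs p) (nbhs p) _ A H). Qed.

Lemma normP1 (v : P) : `|v.1| <= `|v|.
Proof. by rewrite prod_normE le_max lexx. Qed.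

Lemma normP2 (v : P) : `|v.2| <= `|v|.
Proof. by rewrite prod_normE le_max lexx orbT. Qed.

(** The mean value theorem with the two points free in a neighbourhood of [p]. *)
Lemma near_mvt g p (A : P -> Prop) : smooth_on U g -> U p -> (\forall w \near p, A w) ->
  \forall u \near (p, p), exists2 y, A y & g u.1 - g u.2 =
     (u.1 - u.2).1 * px g y + (u.1 - u.2).2 * py g y.
Proof.
move=> sg Up nA.
have : nbhs p (U `&` A) by apply: filterI => //; exact: open_nbhs_nbhs.
move=> /nbhs_ballP[e /= e0 He]; apply/nbhs_ballP; exists e => //= -[w z] [Bw Bz].
have [y' By E] := @mvt_ball _ _ g p e z w (fun v Bv => smooth_differentiable sg (He v Bv).1) Bz Bw.
exists y'; first exact: (He _ By).2.
by rewrite /= E (derive_xy _ (smooth_differentiable sg (He _ By).1)) pxEd pyEd.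
Qed.

Lemma lipschitz_near g p : smooth_on U g -> U p ->
  exists2 k, 0 < k & \forall u \near (p, p), `|g u.1 - g u.2| <= k * `|u.1 - u.2|.
Proof.
move=> sg Up.
pose M1 := `|px g p| + 1; pose M2 := `|py g p| + 1.
have n1 := near_bound (smooth_continuous (smooth_px sg) Up).
have n2 := near_bound (smooth_continuous (smooth_py sg) Up).
exists (M1 + M2); first by rewrite addr_gt0// /M1 /M2 ltr_wpDl.
apply: filterS (near_mvt sg Up (filterI n1 n2)) => u [v [H1 H2] ->].
apply: le_trans (ler_normD _ _) _; rewrite !normrM mulrDl.
rewrite [M1 * _]mulrC [M2 * _]mulrC.
apply: lerD; apply: ler_pM => //; [exact: normP1|exact: normP2].
Qed.

(** The coordinates (x, y) are bi-Lipschitz near [p]. The mean value theorem evaluates the two rows of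
    the Jacobian matrix at different points, whence the mixed determinant [m] in the proof. *)
Lemma expansion_near p : U p ->
  exists2 k, 0 < k & \forall u \near (p, p), `|u.1 - u.2| <= k * (`|dx u.2 u.1| + `|dy u.2 u.1|).
Proof.
move=> Up.
pose j : R := jacobian2 x y p; have j0 : 0 < `|j| by rewrite normr_gt0; exact: J0.
have cx1 := smooth_continuous (smooth_px sx) Up; have cx2 := smooth_continuous (smooth_py sx) Up.
have cy1 := smooth_continuous (smooth_px sy) Up; have cy2 := smooth_continuous (smooth_py sy) Up.
pose M : R := `|px x p| + `|py x p| + `|px y p| + `|py y p| + 1.
have M0 : 0 < M by rewrite /M ltr_wpDl// !addr_ge0.
pose m (u : P * P) : R := px x u.1 * py y u.2 - py x u.1 * px y u.2.
have nm : \forall u \near (p, p), `|j| / 2 <= `|m u|.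
  have cm : m u @[u --> (p, p)] --> m (p, p).
    have f1 g : {for p, continuous g} -> g u.1 @[u --> (p, p)] --> g p.
      by move=> cg A /cg nA; exact: (near_fst nA).
    have f2 g : {for p, continuous g} -> g u.2 @[u --> (p, p)] --> g p.
      by move=> cg A /cg nA; exact: (near_snd nA).
    by apply: cvgB; apply: cvgM; [exact: f1|exact: f2|exact: f1|exact: f2].
  have j2 : 0 < `|j| / 2 by rewrite divr_gt0.
  move/cvgrPdist_le : cm => /(_ _ j2); apply: filterS => u H.
  have := ler_distD (m u) (m (p, p)) 0; rewrite !subr0 => H'.
  by have := le_trans H' (lerD H (lexx _)); rewrite -/(jacobian2 x y p) -/j; lra.
move: nm => /nbhs_ballP[e /= e0 He].
pose A w := ball p e w /\ [/\ `|px x w| <= M, `|py x w| <= M, `|px y w| <= M & `|py y w| <= M].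
have nA : \forall w \near p, A w.
  near=> w; split; first by near: w; exact: nbhsx_ballx.
  have B1 : `|px x w| <= `|px x p| + 1 by near: w; exact: near_bound.
  have B2 : `|py x w| <= `|py x p| + 1 by near: w; exact: near_bound.
  have B3 : `|px y w| <= `|px y p| + 1 by near: w; exact: near_bound.
  have B4 : `|py y w| <= `|py y p| + 1 by near: w; exact: near_bound.
  have q1 := normr_ge0 (px x p); have q2 := normr_ge0 (py x p).
  have q3 := normr_ge0 (px y p); have q4 := normr_ge0 (py y p).
  by rewrite /M; split; lra.
have nx := near_mvt sx Up nA; have ny := near_mvt sy Up nA.
exists (2 * M / `|j|); first by rewrite divr_gt0// mulr_gt0.
apply: filterS (filterI nx ny) => u [[xi [Bxi [X1 X2 _ _]] Ex] [eta [Beta [_ _ Y1 Y2]] Ey]].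
have mb : `|j| / 2 <= `|m (xi, eta)| by exact: He.
rewrite Ex Ey.
set v := u.1 - u.2.
pose X : R := v.1 * px x xi + v.2 * py x xi; pose Y : R := v.1 * px y eta + v.2 * py y eta.
rewrite -/X -/Y.
have E1 : v.1 * m (xi, eta) = X * py y eta - Y * py x xi by rewrite /m /X /Y /=; ring.
have E2 : v.2 * m (xi, eta) = Y * px x xi - X * px y eta by rewrite /m /X /Y /=; ring.
have bd t : `|t * m (xi, eta)| <= M * (`|X| + `|Y|) -> `|t| <= 2 * M / `|j| * (`|X| + `|Y|).
  rewrite normrM => H; rewrite mulrAC -(mulrA 2) ler_pdivlMr//.
  have : `|t| * (`|j| / 2) <= M * (`|X| + `|Y|).
    by apply: le_trans H; rewrite ler_wpM2l.
  lra.
have tri (s1 s2 t1 t2 : R) : `|t1| <= M -> `|t2| <= M ->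
    `|s1 * t1 - s2 * t2| <= M * (`|s1| + `|s2|).
  move=> T1 T2; apply: le_trans (ler_normB _ _) _; rewrite !normrM mulrDr ![M * _]mulrC.
  by apply: lerD; rewrite ler_wpM2l.
rewrite prod_normE ge_max; apply/andP; split; apply: bd.
  by rewrite E1; exact: tri.
by rewrite E2 [`|X| + _]addrC; exact: tri.
Unshelve. all: by end_near. Qed.

End LocalMetric.

Section Metric.
Context {R : realType}.
Notation P := (R * R)%type.
Implicit Types (f g h : P -> R^o) (w z : P).
Variables (U : set P) (x y a b c : P -> R^o).
Hypotheses (oU : open U) (sx : smooth_on U x) (sy : smooth_on U y).
Hypothesis J0 : forall w, U w -> jacobian2 x y w != 0.
Hypotheses (sa : smooth_on U a) (sb : smooth_on U b) (sc : smooth_on U c).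
Hypothesis a0 : forall w, U w -> 0 < a w.
Hypothesis d0 : forall w, U w -> 0 < a w * c w - b w ^+ 2.
Notation L := (Lop x y a b c).
Notation Q := (Qf x y a b c).
Notation q := (qdist x y a b c).

Lemma normM_le (s t S T : R) : `|s| <= S -> `|t| <= T -> `|s * t| <= S * T.
Proof. by move=> sS tT; rewrite normrM ler_pM. Qed.

Lemma normD_le (s t S T : R) : `|s| <= S -> `|t| <= T -> `|s + t| <= S + T.
Proof. by move=> sS tT; apply: le_trans (ler_normD _ _) _; rewrite lerD. Qed.

Lemma norm_nat (n : nat) : `|n%:R : R| <= n%:R.
Proof. by rewrite ger0_norm. Qed.

(** With coefficients frozen at z, and d = a c - b^2, the squared distance q satisfies L q = 4 d and
    Q q = 4 d q exactly; all errors come from the variation of the coefficients between z and w. *)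
Lemma metric_alg (M K e k t aw bw cw az bz cz X Y : R) :
  0 <= M -> 0 <= K -> 0 < e -> 0 < k -> 0 <= t ->
  `|aw - az| <= K * t -> `|bw - bz| <= K * t -> `|cw - cz| <= K * t ->
  `|az| <= M -> `|bz| <= M -> `|cz| <= M ->
  `|X| <= K * t -> `|Y| <= K * t ->
  let qq := cz * (X * X) + (- (2 * bz)) * (X * Y) + az * (Y * Y) in
  let dd := az * cz - bz ^+ 2 in
  [/\ `|qq| <= 4 * M * K ^+ 2 * t ^+ 2,
   `|2 * (aw * cz - 2 * bw * bz + cw * az) - 4 * dd| <= 8 * M * K * t &
   `|4 * (aw * (cz * X - bz * Y) ^+ 2 + 2 * bw * ((cz * X - bz * Y) * (az * Y - bz * X))
     + cw * (az * Y - bz * X) ^+ 2) - 4 * dd * qq| <= 64 * M ^+ 2 * K ^+ 3 * t ^+ 3].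
Proof.
move=> M0 K0 e0 k0 t0 A B C Az Bz Cz HX HY qq dd; split.
- have -> : 4 * M * K ^+ 2 * t ^+ 2 = M * (K * t * (K * t)) + 2 * M * (K * t * (K * t)) + M * (K * t * (K * t)) by ring.
  apply: normD_le; [apply: normD_le|].
  + by apply: normM_le => //; exact: normM_le.
  + apply: normM_le; last exact: normM_le.
    by rewrite normrN; apply: normM_le => //; exact: norm_nat.
  + by apply: normM_le => //; exact: normM_le.
- have -> : 2 * (aw * cz - 2 * bw * bz + cw * az) - 4 * dd =
    2 * ((aw - az) * cz + (- 2) * ((bw - bz) * bz) + (cw - cz) * az) by rewrite /dd; ring.
  have -> : 8 * M * K * t = 2 * (K * t * M + 2 * (K * t * M) + K * t * M) by ring.
  apply: normM_le; first exact: norm_nat.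
  apply: normD_le; [apply: normD_le|exact: normM_le]; first exact: normM_le.
  by apply: normM_le; [rewrite normrN; exact: norm_nat|exact: normM_le].
- set m := cz * X - bz * Y; set n := az * Y - bz * X.
  have Hm : `|m| <= 2 * M * K * t.
    have -> : 2 * M * K * t = M * (K * t) + M * (K * t) by ring.
    by apply: normD_le; rewrite ?normrN; exact: normM_le.
  have Hn : `|n| <= 2 * M * K * t.
    have -> : 2 * M * K * t = M * (K * t) + M * (K * t) by ring.
    by apply: normD_le; rewrite ?normrN; exact: normM_le.
  have -> : 4 * (aw * m ^+ 2 + 2 * bw * (m * n) + cw * n ^+ 2) - 4 * dd * qq =
    4 * ((aw - az) * (m * m) + 2 * ((bw - bz) * (m * n)) + (cw - cz) * (n * n)).
    by rewrite /dd /qq /m /n; ring.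
  set B' := 2 * M * K * t in Hm Hn.
  have -> : 64 * M ^+ 2 * K ^+ 3 * t ^+ 3 = 4 * (K * t * (B' * B') + 2 * (K * t * (B' * B')) + K * t * (B' * B')).
    by rewrite /B'; ring.
  apply: normM_le; first exact: norm_nat.
  have Hmm : `|m * m| <= B' * B' by exact: normM_le.
  have Hmn : `|m * n| <= B' * B' by exact: normM_le.
  have Hnn : `|n * n| <= B' * B' by exact: normM_le.
  apply: normD_le; [apply: normD_le|exact: normM_le]; first exact: normM_le.
  by apply: normM_le; [exact: norm_nat|exact: normM_le].
Qed.

Lemma metric_lower (M e k t az bz cz X Y qq : R) :
  0 < M -> 0 < e -> 0 < k -> 0 <= t -> `|az| <= M -> `|cz| <= M -> e <= az * cz - bz ^+ 2 ->
  0 < az -> (az * cz - bz ^+ 2) * (X ^+ 2 + Y ^+ 2) <= (az + cz) * qq ->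
  t <= k * (`|X| + `|Y|) -> e / (4 * M * k ^+ 2) * t ^+ 2 <= qq.
Proof.
move=> M0 e0 k0 t0 A C ed az0 ge tle.
have S0 : 0 <= X ^+ 2 + Y ^+ 2 by rewrite addr_ge0// sqr_ge0.
have c0 : 0 < cz.
  rewrite -(pmulr_rgt0 _ az0); have := sqr_ge0 bz; lra.
have qq0 : 0 <= qq.
  rewrite -(pmulr_rge0 _ (addr_gt0 az0 c0)); apply: le_trans ge.
  by rewrite mulr_ge0//; lra.
have H1 : e * (X ^+ 2 + Y ^+ 2) <= 2 * M * qq.
  apply: le_trans (_ : (az * cz - bz ^+ 2) * (X ^+ 2 + Y ^+ 2) <= _).
    by rewrite ler_wpM2r.
  apply: le_trans ge _; rewrite ler_wpM2r//.
  move: A C; rewrite !gtr0_norm//; lra.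
have H2 : t ^+ 2 <= 2 * k ^+ 2 * (X ^+ 2 + Y ^+ 2).
  have T : t ^+ 2 <= (k * (`|X| + `|Y|)) ^+ 2 by rewrite lerXn2r ?nnegrE// mulr_ge0 ?addr_ge0//; exact: ltW.
  apply: le_trans T _; rewrite exprMn -(real_normK (num_real X)) -(real_normK (num_real Y)).
  have := sqr_ge0 (`|X| - `|Y|); move: (`|X|) (`|Y|) => u v H.
  have H' : (u + v) ^+ 2 <= 2 * (u ^+ 2 + v ^+ 2) by lra.
  have := ler_wpM2l (sqr_ge0 k) H'; lra.
rewrite mulrAC ler_pdivrMr ?mulr_gt0 ?exprn_gt0//.
apply: le_trans (_ : e * (2 * k ^+ 2 * (X ^+ 2 + Y ^+ 2)) <= _); first by rewrite ler_wpM2l// ltW.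
have := ler_wpM2l (mulr_ge0 (ler0n R 2) (sqr_ge0 k)) H1; lra.
Qed.

(** Uniformly for pairs of points near [p], the squared distance is comparable to the Euclidean one
    and satisfies the equations of the flat squared distance up to one order more. *)
Lemma metric_near p : U p -> exists (k1 k2 C1 e : R),
  [/\ 0 < k1, 0 < k2, 0 < C1, 0 < e &
  \forall u \near (p, p), let w := u.1 in let z := u.2 in let t := `|w - z| in
    [/\ U w /\ U z, k1 * t ^+ 2 <= q z w <= k2 * t ^+ 2, e <= a z * c z - b z ^+ 2,
        `|L (q z) w - 4 * (a z * c z - b z ^+ 2)| <= C1 * t &
        `|Q (q z) w - 4 * (a z * c z - b z ^+ 2) * q z w| <= C1 * t ^+ 3]].
Proof.
move=> Up.
have [kx kx0 Lx] := lipschitz_near oU sx Up.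
have [ky ky0 Ly] := lipschitz_near oU sy Up.
have [ka ka0 La] := lipschitz_near oU sa Up.
have [kb kb0 Lb] := lipschitz_near oU sb Up.
have [kc kc0 Lc] := lipschitz_near oU sc Up.
have [k k0 Ek] := expansion_near oU sx sy J0 Up.
pose K : R := kx + ky + ka + kb + kc.
have na := near_bound (smooth_continuous sa Up).
have nb := near_bound (smooth_continuous sb Up).
have nc := near_bound (smooth_continuous sc Up).
pose M : R := `|a p| + `|b p| + `|c p| + 1.
have sd : smooth_on U (fun w => a w * c w - b w ^+ 2 : R^o).
  exact: (smoothB oU (smoothM oU sa sc) (smoothM oU sb sb)).
have nd := near_pos (smooth_continuous sd Up) (d0 Up).
pose e : R := (a p * c p - b p ^+ 2) / 2.
have e0 : 0 < e by rewrite divr_gt0// d0.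
have M0 : 0 < M by rewrite /M ltr_wpDl// !addr_ge0.
have K0 : 0 < K by rewrite /K !addr_gt0.
exists (e / (4 * M * k ^+ 2)), (4 * M * K ^+ 2), (8 * M * K + 64 * M ^+ 2 * K ^+ 3), e; split => //.
- by rewrite divr_gt0// !mulr_gt0// exprn_gt0.
- by rewrite !mulr_gt0// exprn_gt0.
- by rewrite addr_gt0// !mulr_gt0// exprn_gt0.
near=> u.
have Uw : U u.1 by near: u; apply: near_fst; exact: open_nbhs_nbhs.
have Uz : U u.2 by near: u; apply: near_snd; exact: open_nbhs_nbhs.
have Lw k' g : k' <= K -> `|g u.1 - g u.2| <= k' * `|u.1 - u.2| -> `|g u.1 - g u.2| <= K * `|u.1 - u.2|.
  by move=> kK /le_trans; apply; rewrite ler_wpM2r.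
have dX : `|x u.1 - x u.2| <= K * `|u.1 - u.2|.
  by apply: (Lw kx); [rewrite /K; lra|near: u; exact: Lx].
have dY : `|y u.1 - y u.2| <= K * `|u.1 - u.2|.
  by apply: (Lw ky); [rewrite /K; lra|near: u; exact: Ly].
have dA : `|a u.1 - a u.2| <= K * `|u.1 - u.2|.
  by apply: (Lw ka); [rewrite /K; lra|near: u; exact: La].
have dB : `|b u.1 - b u.2| <= K * `|u.1 - u.2|.
  by apply: (Lw kb); [rewrite /K; lra|near: u; exact: Lb].
have dC : `|c u.1 - c u.2| <= K * `|u.1 - u.2|.
  by apply: (Lw kc); [rewrite /K; lra|near: u; exact: Lc].
have q1 := normr_ge0 (a p); have q2 := normr_ge0 (b p); have q3 := normr_ge0 (c p).
have bA : `|a u.2| <= M.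
  have : `|a u.2| <= `|a p| + 1 by near: u; apply: (near_snd na).
  by rewrite /M; lra.
have bB : `|b u.2| <= M.
  have : `|b u.2| <= `|b p| + 1 by near: u; apply: (near_snd nb).
  by rewrite /M; lra.
have bC : `|c u.2| <= M.
  have : `|c u.2| <= `|c p| + 1 by near: u; apply: (near_snd nc).
  by rewrite /M; lra.
have ed : e <= a u.2 * c u.2 - b u.2 ^+ 2 by near: u; apply: (near_snd nd).
have ex : `|u.1 - u.2| <= k * (`|x u.1 - x u.2| + `|y u.1 - y u.2|) by near: u; exact: Ek.
have ge := qdist_ge x y a b c u.2 u.1.
have t0 : 0 <= `|u.1 - u.2| by exact: normr_ge0.
have lowb := metric_lower M0 e0 k0 t0 bA bC ed (a0 Uz) ge ex.
have [R1 R2 R3] := metric_alg (ltW M0) (ltW K0) e0 k0 t0 dA dB dC bA bB bC dX dY.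
have C0 : 0 <= 8 * M * K by rewrite !mulr_ge0// ltW.
have C0' : 0 <= 64 * M ^+ 2 * K ^+ 3 by rewrite !mulr_ge0// ?exprn_ge0// ltW.
split=> //.
- apply/andP; split; last exact: le_trans (ler_norm _) R1.
  exact: lowb.
- rewrite (Lop_qdist a b c oU sx sy J0 _ Uw).
  by apply: le_trans R2 _; apply: ler_wpM2r => //; rewrite lerDl.
- rewrite (Qf_qdist a b c oU sx sy J0 _ Uw).
  by apply: le_trans R3 _; apply: ler_wpM2r; rewrite ?exprn_ge0// lerDr.
Unshelve. all: by end_near. Qed.

End Metric.

Section Barrier.
Context {R : realType}.
Implicit Types (K t : R).

(** As a function of r = sqrt t this is ln r - K r. The logarithm of the distance is harmonic for
    constant coefficients; for variable ones it has an error of order 1/r, which the concave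
    correction - K r absorbs. [log_pole1] and [log_pole2] are the derivatives in t. *)
Definition log_pole K : R^o -> R^o := fun t => ln (Num.sqrt t) - K * Num.sqrt t.
Definition log_pole1 K : R^o -> R^o := fun t => ((Num.sqrt t)^-1 - K) * (2 * Num.sqrt t)^-1.
Definition log_pole2 K t : R := - (2 * Num.sqrt t ^+ 4)^-1 + K * (4 * Num.sqrt t ^+ 3)^-1.

Lemma is_derive_log_pole K (t : R^o) : 0 < t -> is_derive t (1 : R^o) (log_pole K) (log_pole1 K t).
Proof.
move=> t0; have s0 : 0 < Num.sqrt t by rewrite sqrtr_gt0.
have d1 : is_derive (Num.sqrt t : R^o) (1 : R^o) (fun s : R => ln s - K * s) ((Num.sqrt t)^-1 - K).
  apply: is_deriveB; first exact: is_derive1_ln.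
  have := @is_deriveZ R R^o R^o id K (Num.sqrt t) 1 1 (is_derive_id _ _).
  by rewrite /GRing.scale /= mulr1.
have d2 : is_derive (t : R^o) (1 : R^o) (@Num.sqrt R) (2 * Num.sqrt t)^-1 by exact: is_derive1_sqrt.
exact: (is_derive1_comp d1 d2).
Qed.

Lemma is_derive_log_pole1 K (t : R^o) : 0 < t -> is_derive t (1 : R^o) (log_pole1 K) (log_pole2 K t).
Proof.
move=> t0; have s0 : 0 < Num.sqrt t by rewrite sqrtr_gt0.
have sn : Num.sqrt t != 0 by rewrite gt_eqF.
have d1 : is_derive (Num.sqrt t : R^o) (1 : R^o) (fun s : R => (s^-1 - K) * (2 * s)^-1)
  (- (Num.sqrt t)^-1 ^+ 3 + K / 2 * (Num.sqrt t)^-1 ^+ 2).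
  have -> : (fun s : R => (s^-1 - K) * (2 * s)^-1) =
    (fun s : R => 2^-1 * (s^-1 * s^-1) + (- (K / 2)) * s^-1).
    by apply/funext => s; rewrite invfM; ring.
  have dv : is_derive (Num.sqrt t : R^o) (1 : R^o) (fun s : R => s^-1) (- (Num.sqrt t)^-1 ^+ 2).
    have := @is_deriveV R id (Num.sqrt t) 1 1 sn (is_derive_id _ _).
    by rewrite /GRing.scale /= mulr1 exprVn.
  have := is_deriveD (is_deriveZ 2^-1 (is_deriveM dv dv)) (is_deriveZ (- (K / 2)) dv).
  move=> H; apply: (is_derive_eq H).
  by rewrite /GRing.scale /=; field.
have d2 : is_derive (t : R^o) (1 : R^o) (@Num.sqrt R) (2 * Num.sqrt t)^-1 by exact: is_derive1_sqrt.
have dp : is_derive (t : R^o) (1 : R^o) (log_pole1 K)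
    ((- (Num.sqrt t)^-1 ^+ 3 + K / 2 * (Num.sqrt t)^-1 ^+ 2) * (2 * Num.sqrt t)^-1).
  exact: (is_derive1_comp d1 d2).
apply: (is_derive_eq dp).
by rewrite /log_pole2; move: sn; move: (Num.sqrt t) => s sn; field.
Qed.

(** The terms of order r^-2 cancel. Those of order r^-1 are bounded by C / r in absolute value, against
    a contribution of the correction close to - K d / r. *)
Lemma barrier_ineq K C d e r l q : 0 < r -> 0 < e -> e <= d -> 0 < C ->
  `|l - 4 * d| <= C * r -> `|q - 4 * d * r ^+ 2| <= C * r ^+ 3 ->
  C * r <= e / 2 -> K = 2 * C / e ->
  ((r^-1 - K) * (2 * r)^-1) * l + (- (2 * r ^+ 4)^-1 + K * (4 * r ^+ 3)^-1) * q <= 0.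
Proof.
move=> r0 e0 ed C0 H1 H2 Cr KE.
pose e1 := (l - 4 * d) / r; pose e2 := (q - 4 * d * r ^+ 2) / r ^+ 3.
have E1 : `|e1| <= C by rewrite normrM normfV (gtr0_norm r0) ler_pdivrMr.
have E2 : `|e2| <= C by rewrite normrM normfV (gtr0_norm (exprn_gt0 3 r0)) ler_pdivrMr// exprn_gt0.
have El : l = 4 * d + e1 * r by rewrite divfK ?gt_eqF// addrC subrK.
have Eq : q = 4 * d * r ^+ 2 + e2 * r ^+ 3 by rewrite divfK ?gt_eqF ?exprn_gt0// addrC subrK.
rewrite -(pmulr_rle0 _ r0).
have -> : r * (((r^-1 - K) * (2 * r)^-1) * l + (- (2 * r ^+ 4)^-1 + K * (4 * r ^+ 3)^-1) * q) =
  (e1 - e2) / 2 + K * (- d - r * e1 / 2 + r * e2 / 4).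
  by rewrite El Eq; field; rewrite gt_eqF.
have K0 : 0 < K by rewrite KE divr_gt0// mulr_gt0.
have KeC : K * e = 2 * C by rewrite KE divfK// gt_eqF.
move: E1 E2; rewrite !ler_norml => /andP[a1 a2] /andP[b1 b2].
have B : - d - r * e1 / 2 + r * e2 / 4 <= - e + 3 / 4 * (C * r).
  have := ler_wpM2l (ltW r0) a1; have := ler_wpM2l (ltW r0) b2; lra.
have := ler_wpM2l (ltW K0) B; have := ler_wpM2l (ltW K0) Cr.
lra.
Qed.

End Barrier.

Section BarrierNear.
Context {R : realType}.
Notation P := (R * R)%type.
Implicit Types (f g h : P -> R^o) (w z : P).
Variables (U : set P) (x y a b c : P -> R^o).
Hypotheses (oU : open U) (sx : smooth_on U x) (sy : smooth_on U y).
Hypothesis J0 : forall w, U w -> jacobian2 x y w != 0.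
Hypotheses (sa : smooth_on U a) (sb : smooth_on U b) (sc : smooth_on U c).
Hypothesis a0 : forall w, U w -> 0 < a w.
Hypothesis d0 : forall w, U w -> 0 < a w * c w - b w ^+ 2.
Notation L := (Lop x y a b c).
Notation Q := (Qf x y a b c).
Notation q := (qdist x y a b c).

Lemma open_gt0 f : smooth_on U f -> open [set w | U w /\ 0 < f w].
Proof.
move=> sf; rewrite openE => w [Uw fw]; rewrite /interior.
have cf : f v @[v --> w] --> f w by exact: (smooth_continuous sf Uw).
near=> v; split; near: v; first exact: open_nbhs_nbhs.
by apply: (cvgr_gt _ cf).
Unshelve. all: by end_near. Qed.

Lemma smooth_log_pole1 K U' g : open U' -> smooth_on U' g -> (forall w, U' w -> 0 < g w) ->
  smooth_on U' (fun w => log_pole1 K (g w)).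
Proof.
move=> oU' sg g0; have ss := smooth_sqrt oU' g0 sg.
have s0 w : U' w -> Num.sqrt (g w) != 0 by move=> Uw; rewrite gt_eqF// sqrtr_gt0 g0.
have s20 w : U' w -> 2 * Num.sqrt (g w) != 0 by move=> Uw; rewrite mulf_neq0// s0.
exact: (smoothM oU' (smoothB oU' (smoothV oU' s0 ss) (smooth_cst U' (K : R^o)))
   (smoothV oU' s20 (smoothM oU' (smooth_cst U' (2 : R^o)) ss))).
Qed.

Lemma smooth_lnR : smooth_on (pos (R := R)) (fun t : R^o => ln t : R^o).
Proof.
elim=> [|k _].
  by move=> t t0; exact: continuous_ln.
apply: (@Ck_on_derive1 _ _ _ _ (fun t : R^o => t^-1 : R^o)).
- exact: open_pos.
- have sub : pos (R := R) `<=` nz (R := R) by move=> t; rewrite /pos /nz /= => /gt_eqF ->.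
  exact: (smooth_sub sub smooth_invR).
Qed.

Lemma smooth_ln U' g : open U' -> smooth_on U' g -> (forall w, U' w -> 0 < g w) ->
  smooth_on U' (fun w => ln (g w) : R^o).
Proof.
move=> oU' sg g0.
exact: (smooth_comp findim_R findim_R oU' open_pos g0 sg smooth_lnR).
Qed.

Lemma smooth_log_pole K U' g : open U' -> smooth_on U' g -> (forall w, U' w -> 0 < g w) ->
  smooth_on U' (fun w => log_pole K (g w)).
Proof.
move=> oU' sg g0; have ss := smooth_sqrt oU' g0 sg.
have s0 w : U' w -> 0 < Num.sqrt (g w) by move=> Uw; rewrite sqrtr_gt0 g0.
exact: (smoothB oU' (smooth_ln oU' ss s0) (smoothM oU' (smooth_cst U' (K : R^o)) ss)).
Qed.

Lemma Lop_log_pole K z w : U w -> 0 < q z w ->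
  L (fun v => log_pole K (q z v)) w = log_pole1 K (q z w) * L (q z) w + log_pole2 K (q z w) * Q (q z) w.
Proof.
move=> Uw q0; pose U' := [set v | U v /\ 0 < q z v].
have sq := smooth_qdist a b c oU sx sy z.
have oU' : open U' by exact: open_gt0.
have sU : U' `<=` U by move=> v [].
have sq' := smooth_sub sU sq.
have q0' v : U' v -> 0 < q z v by case.
apply: (Lop_chain a b c oU sx sy J0 oU' sU) => //.
- exact: smooth_log_pole1.
- by move=> v /q0'; exact: is_derive_log_pole.
- exact: is_derive_log_pole1.
Qed.

(** Near [p] the corrected logarithmic pole is a supersolution, away from its pole and uniformly in
    the position of the pole. *)
Lemma barrier_near p : U p -> exists (k1 k2 K : R),
  [/\ 0 < k1, 0 < k2, 0 < K &
  \forall u \near (p, p), let w := u.1 in let z := u.2 in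
    [/\ U w, k1 * `|w - z| ^+ 2 <= q z w <= k2 * `|w - z| ^+ 2 &
       0 < q z w -> L (fun v => log_pole K (q z v)) w <= 0]].
Proof.
move=> Up; have [k1 [k2 [C1 [e [k10 k20 C10 e0 H]]]]] := metric_near oU sx sy J0 sa sb sc a0 d0 Up.
pose sk := Num.sqrt k1; have sk0 : 0 < sk by rewrite sqrtr_gt0.
pose C := C1 / sk + C1 / sk ^+ 3.
have C0 : 0 < C by rewrite addr_gt0// divr_gt0// exprn_gt0.
exists k1, k2, (2 * C / e); split => //; first by rewrite divr_gt0// mulr_gt0.
have nt : \forall u \near (p, p), `|u.1 - u.2| <= e / 2 / (C * Num.sqrt k2).
  have e2 : 0 < e / 2 / (C * Num.sqrt k2) by rewrite !divr_gt0// mulr_gt0// sqrtr_gt0.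
  have : (u.1 - u.2) @[u --> (p, p)] --> (0 : P).
    rewrite -(subrr p); apply: cvgB; first exact: (@cvg_fst _ _ (nbhs p) (nbhs p) _).
    exact: (@cvg_snd _ _ (nbhs p) (nbhs p) _).
  by move/cvgrPdist_le/(_ _ e2); apply: filterS => u; rewrite sub0r normrN.
near=> u.
have [[U1 U2] /andP[q1 q2] ed H1 H2] : [/\ U u.1 /\ U u.2, k1 * `|u.1 - u.2| ^+ 2 <= q u.2 u.1 <= k2 * `|u.1 - u.2| ^+ 2, e <= a u.2 * c u.2 - b u.2 ^+ 2,
        `|L (q u.2) u.1 - 4 * (a u.2 * c u.2 - b u.2 ^+ 2)| <= C1 * `|u.1 - u.2| &
        `|Q (q u.2) u.1 - 4 * (a u.2 * c u.2 - b u.2 ^+ 2) * q u.2 u.1| <= C1 * `|u.1 - u.2| ^+ 3].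
  by near: u.
have tle : `|u.1 - u.2| <= e / 2 / (C * Num.sqrt k2) by near: u.
split=> //; first by rewrite q1 q2.
move=> q0; rewrite (Lop_log_pole _ U1 q0) /log_pole1 /log_pole2.
have r0 : 0 < Num.sqrt (q u.2 u.1) by rewrite sqrtr_gt0.
have rE := sqr_sqrtr (ltW q0).
set r := Num.sqrt (q u.2 u.1) in r0 rE *.
have tr : sk * `|u.1 - u.2| <= r.
  rewrite -[leLHS]ger0_norm ?mulr_ge0// ?(ltW sk0)// -sqrtr_sqr /r ler_wsqrtr//.
  by rewrite exprMn sqr_sqrtr// ltW.
have tr' : `|u.1 - u.2| <= r / sk by rewrite ler_pdivlMr// mulrC.
have rt : r <= Num.sqrt k2 * `|u.1 - u.2|.
  rewrite -[leRHS]ger0_norm ?mulr_ge0 ?sqrtr_ge0// -sqrtr_sqr /r ler_wsqrtr//.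
  by rewrite exprMn sqr_sqrtr// ltW.
apply: (@barrier_ineq _ _ C (a u.2 * c u.2 - b u.2 ^+ 2) e) => //.
- apply: le_trans H1 _; apply: le_trans (ler_wpM2l (ltW C10) tr') _.
  rewrite /C mulrDl mulrCA mulrC lerDl; by rewrite mulr_ge0// ?(ltW r0)// divr_ge0 ?exprn_ge0 ?ltW.
- rewrite rE; apply: le_trans H2 _.
  have t3 : `|u.1 - u.2| ^+ 3 <= (r / sk) ^+ 3 by rewrite lerXn2r ?nnegrE// divr_ge0 ?ltW.
  apply: le_trans (ler_wpM2l (ltW C10) t3) _.
  have -> : C1 * (r / sk) ^+ 3 = C1 / sk ^+ 3 * r ^+ 3 by field; rewrite gt_eqF.
  rewrite /C mulrDl lerDr; by rewrite mulr_ge0// ?exprn_ge0 ?(ltW r0)// divr_ge0 ?ltW.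
- apply: le_trans (ler_wpM2l (ltW C0) rt) _; rewrite mulrA -ler_pdivlMl ?mulr_gt0 ?sqrtr_gt0//.
  by rewrite mulrC.
Unshelve. all: by end_near. Qed.

End BarrierNear.

Section Jensen.
Context {R : realType}.
Notation P := (R * R)%type.
Implicit Types (f g h : P -> R^o) (w z : P).
Variables (U : set P) (x y a b c : P -> R^o).
Hypotheses (oU : open U) (sx : smooth_on U x) (sy : smooth_on U y).
Hypothesis J0 : forall w, U w -> jacobian2 x y w != 0.
Hypotheses (sa : smooth_on U a) (sb : smooth_on U b) (sc : smooth_on U c).
Hypothesis a0 : forall w, U w -> 0 < a w.
Hypothesis d0 : forall w, U w -> 0 < a w * c w - b w ^+ 2.
Notation L := (Lop x y a b c).
Notation Q := (Qf x y a b c).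
Notation q := (qdist x y a b c).

Variables (p : P) (r k1 k2 K : R).
Hypotheses (r0 : 0 < r) (k10 : 0 < k1) (k20 : 0 < k2) (K0 : 0 < K).
Hypothesis HB : forall w z, ball p r w -> ball p r z ->
  [/\ U w, k1 * `|w - z| ^+ 2 <= q z w <= k2 * `|w - z| ^+ 2 &
      0 < q z w -> L (fun v => log_pole K (q z v)) w <= 0].

(** The exponential of the opposite of the corrected logarithm, singular like the inverse of the
    distance. *)
Definition pole z w : R := expR (K * Num.sqrt (q z w)) / Num.sqrt (q z w).
Definition poles (s : seq P) : P -> R^o := fun w => \sum_(z <- s) log_pole K (q z w).

Lemma ball_U w : ball p r w -> U w.
Proof. by move=> Bw; have [] := HB Bw Bw. Qed.

Lemma qdistxx z : q z z = 0.
Proof. by rewrite /qdist !subrr !mulr0 !addr0. Qed.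

Lemma qdist_gt0 w z : ball p r w -> ball p r z -> w != z -> 0 < q z w.
Proof.
move=> Bw Bz wz; have [_ /andP[+ _] _] := HB Bw Bz; apply: lt_le_trans.
by rewrite mulr_gt0// exprn_gt0// normr_gt0 subr_eq0.
Qed.

Lemma poleE z w : 0 < q z w -> pole z w = expR (- log_pole K (q z w)).
Proof.
move=> q0; have s0 : 0 < Num.sqrt (q z w) by rewrite sqrtr_gt0.
by rewrite /log_pole opprB expRB lnK.
Qed.

Lemma pole_ge0 z w : 0 <= pole z w.
Proof. by rewrite divr_ge0 ?expR_ge0 ?sqrtr_ge0. Qed.

Lemma smooth_q z : smooth_on U (q z : P -> R^o).
Proof. exact: smooth_qdist a b c oU sx sy z. Qed.

Lemma pole_cont w z : ball p r w -> ball p r z -> w != z -> {for w, continuous (pole z)}.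
Proof.
move=> Bw Bz wz; have q0 := qdist_gt0 Bw Bz wz.
have cq : q z v @[v --> w] --> q z w by exact: (smooth_continuous (smooth_q z) (ball_U Bw)).
have cs : Num.sqrt (q z v) @[v --> w] --> Num.sqrt (q z w).
  exact: (continuous_cvg _ (@sqrt_continuous R (q z w)) cq).
apply: cvgM; last by apply: cvgV cs; rewrite gt_eqF// sqrtr_gt0.
apply: (continuous_cvg _ (@continuous_expR R (K * Num.sqrt (q z w)))).
by apply: cvgM cs; exact: cvg_cst.
Qed.

Lemma poles_super s w : ball p r w -> (forall z, z \in s -> ball p r z /\ 0 < q z w) ->
  exists U' : set P, [/\ open U', U' `<=` U, U' w, smooth_on U' (poles s) &
    (forall v z, U' v -> z \in s -> 0 < q z v) /\ L (poles s) w <= 0].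
Proof.
move=> Bw; have Uw := ball_U Bw; elim: s => [|z s IH] Hs.
  exists U; split=> //.
    by rewrite /poles; under eq_fun do rewrite big_nil; exact: smooth_cst.
  split=> //.
  have -> : L (poles [::]) w = L (fun _ => 0) w.
    by apply: (Lop_eq x y a b c oU Uw) => v _; rewrite /poles big_nil.
  rewrite /Lop.
  have E1 v : U v -> d1 x y (fun _ => 0 : R^o) v = (fun _ => 0 : R^o) v by move=> _; exact: D1_cst.
  have E2 v : U v -> d2 x y (fun _ => 0 : R^o) v = (fun _ => 0 : R^o) v by move=> _; exact: D2_cst.
  rewrite (D1_eq x y oU Uw E1) (D1_eq x y oU Uw E2) (D2_eq x y oU Uw E2) D1_cst D2_cst.
  by rewrite !mulr0 !addr0.
have [|V [oV VU Vw sV [HV LV]]] := IH.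
  by move=> z' z's; apply: Hs; rewrite inE z's orbT.
have [Bz q0] := Hs z (mem_head _ _).
pose W := V `&` [set v | U v /\ 0 < q z v].
have oW : open W by apply: openI => //; exact: open_gt0 (smooth_q z).
have WU : W `<=` U by move=> v [_ []].
have s1 : smooth_on W (poles s) by apply: smooth_sub sV => v [].
have s2 : smooth_on W (fun v => log_pole K (q z v)).
  apply: smooth_log_pole => //; last by move=> v [_ []].
  exact: smooth_sub (smooth_q z).
have Ww : W w by [].
have E v : W v -> poles (z :: s) v = log_pole K (q z v) + poles s v.
  by move=> _; rewrite /poles big_cons.
exists W; split => //.
  by apply: (smooth_eq oW _ (smoothD oW s2 s1)) => v Wv; rewrite E.
split.
  move=> v z' [Vv [_ qv]]; rewrite inE => /orP[/eqP->//|z's]; exact: HV.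
rewrite (Lop_eq x y a b c oW Ww E) (Lop_add a b c oU sx sy J0 oW WU Ww s2 s1).
have [_ _ /(_ q0) H] := HB Bw Bz.
by rewrite -[0]addr0 lerD.
Qed.

Variable (f : P -> R^o).
Hypotheses (sf : smooth_on U f) (f0 : forall w, U w -> 0 <= f w).

(** Since [f] is nonnegative its zeros are critical points, so that [f] vanishes there faster than the
    distance. This beats the singularity of a pole placed at the zero. *)
Lemma f_small w e : ball p r w -> f w = 0 -> 0 < e ->
  \forall v \near w, `|f v| <= e * `|v - w|.
Proof.
move=> Bw fw e0; have Uw := ball_U Bw.
have crit v : 'D_v f w = 0.
  have nsf : smooth_on U (fun z => - f z) by exact: smoothN.
  have fmax z : U z -> - f z <= - f w by move=> Uz; rewrite fw lerN2; exact: f0.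
  have [D _] := max_second_order v oU nsf Uw fmax.
  have : - 'D_v f w = 0 by rewrite -(derive_opp _ (smooth_differentiable sf Uw)).
  by move/eqP; rewrite oppr_eq0 => /eqP.
have px0 : px f w = 0 by rewrite pxEd.
have py0 : py f w = 0 by rewrite pyEd.
have e2 : 0 < e / 2 by rewrite divr_gt0.
have n1 : \forall v \near w, `|px f v| <= e / 2.
  have cx : px f v @[v --> w] --> px f w by exact: (smooth_continuous (smooth_px sf) Uw).
  by rewrite px0 in cx; move/cvgrPdist_le: cx => /(_ _ e2); apply: filterS => v; rewrite sub0r normrN.
have n2 : \forall v \near w, `|py f v| <= e / 2.
  have cx : py f v @[v --> w] --> py f w by exact: (smooth_continuous (smooth_py sf) Uw).
  by rewrite py0 in cx; move/cvgrPdist_le: cx => /(_ _ e2); apply: filterS => v; rewrite sub0r normrN.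
have n12 : \forall v \near w, `|px f v| <= e / 2 /\ `|py f v| <= e / 2.
  by near=> v; split; near: v.
have nm := near_mvt oU sf Uw n12.
have [[A1 A2] /= [nA1 nA2] HA] := nm.
near=> v.
have [|y' [H1 H2]] := HA (v, w); first by split=> /=; [near: v|exact: nbhs_singleton nA2].
rewrite /= fw subr0 => ->.
apply: le_trans (ler_normD _ _) _; rewrite !normrM.
have := normP1 (v - w); have := normP2 (v - w); move: (`|v - w|) => t T2 T1.
have -> : e * t = t * (e / 2) + t * (e / 2) by field.
by apply: lerD; rewrite ler_pM.
Unshelve. all: by end_near. Qed.

Lemma f_pole_cont w : ball p r w -> f w = 0 -> f v * pole w v @[v --> w] --> (0 : R).
Proof.
move=> Bw fw; have Uw := ball_U Bw.
pose M : R := expR (K * (Num.sqrt k2 * (r + r))) / Num.sqrt k1.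
have M0 : 0 < M by rewrite divr_gt0 ?expR_gt0 ?sqrtr_gt0.
apply/cvgrPdist_le => e e0.
have eM : 0 < e / M by rewrite divr_gt0.
have Br : nbhs w (ball p r) by apply: open_nbhs_nbhs; split => //; exact: ball_open.
near=> v; rewrite sub0r normrN.
have Bv : ball p r v by near: v.
have [->|vw] := eqVneq v w; first by rewrite fw mul0r normr0 ltW.
have [_ /andP[q1 q2] _] := HB Bv Bw.
have t0 : 0 < `|v - w| by rewrite normr_gt0 subr_eq0.
have fs : `|f v| <= e / M * `|v - w| by near: v; exact: f_small.
have tr : `|v - w| <= r + r.
  have Bw' := Bw; have := ler_distD p v w; move: Bv Bw'; rewrite -ball_normE /ball_ /= => B1 B2.
  rewrite [`|v - p|]distrC => H; lra.
have P1 : pole w v <= M / `|v - w|.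
  rewrite /pole /M -mulrA -invfM; apply: ler_pM; rewrite ?expR_ge0 ?invr_ge0 ?sqrtr_ge0//.
    rewrite ler_expR ler_wpM2l ?(ltW K0)//.
    apply: (@le_trans _ _ (Num.sqrt (k2 * `|v - w| ^+ 2))); first exact: ler_wsqrtr.
    by rewrite sqrtrM ?(ltW k20)// sqrtr_sqr normr_id ler_wpM2l ?sqrtr_ge0.
  rewrite lef_pV2 ?posrE ?sqrtr_gt0 ?mulr_gt0 ?sqrtr_gt0//; last exact: qdist_gt0.
  apply: (@le_trans _ _ (Num.sqrt (k1 * `|v - w| ^+ 2))); last exact: ler_wsqrtr.
  by rewrite sqrtrM ?(ltW k10)// sqrtr_sqr normr_id.
rewrite normrM (ger0_norm (pole_ge0 _ _)).
apply: le_trans (ler_pM _ _ fs P1) _; rewrite ?pole_ge0//.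
rewrite [e / M * _]mulrC mulrACA mulrC.
by rewrite -!mulrA; rewrite (_ : _ * _ = e) //; field; rewrite gt_eqF//= gt_eqF.
Unshelve. all: by end_near. Qed.

Lemma prod_pole_cont s w : ball p r w -> (forall z, z \in s -> ball p r z) -> w \notin s ->
  \prod_(z <- s) pole z v @[v --> w] --> \prod_(z <- s) pole z w.
Proof.
move=> Bw; elim: s => [|z s IH] Bs.
  move=> _; rewrite big_nil; under eq_fun do rewrite big_nil; exact: cvg_cst.
rewrite inE negb_or => /andP[wz ws]; rewrite big_cons; under eq_fun do rewrite big_cons.
apply: cvgM; last by apply: IH => // z' z's; apply: Bs; rewrite inE z's orbT.
by apply: pole_cont => //; apply: Bs; exact: mem_head.
Qed.

(** The poles may be placed at zeros of [f]: the product extends continuously by zero, which is also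
    the value given by the convention that the inverse of 0 is 0. *)
Lemma f_prod_cont s w : ball p r w -> uniq s -> (forall z, z \in s -> ball p r z /\ f z = 0) ->
  f v * \prod_(z <- s) pole z v @[v --> w] --> f w * \prod_(z <- s) pole z w.
Proof.
move=> Bw us Hs; have [ws|ws] := boolP (w \in s); last first.
  apply: cvgM; first exact: (smooth_continuous sf (ball_U Bw)).
  by apply: prod_pole_cont => // z /Hs[].
have fw : f w = 0 by have [] := Hs _ ws.
rewrite fw mul0r; under eq_fun do rewrite (big_rem w) //= mulrA.
have H : f v * pole w v * \prod_(z <- rem w s) pole z v @[v --> w] -->
    0 * \prod_(z <- rem w s) pole z w.
  apply: cvgM; first exact: f_pole_cont.
  apply: prod_pole_cont => //; first by move=> z /mem_rem/Hs[].
  by rewrite mem_rem_uniqF.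
by rewrite mul0r in H.
Qed.

Variable C : R.
Hypothesis HC : forall w, U w -> - C * f w ^+ 2 <= f w * L f w - Q f w.

Lemma Lop_sqx T w : U w ->
  L (fun v => T * ((x v - x p) * (x v - x p)) : R^o) w = 2 * T * a w.
Proof.
move=> Uw; pose g : P -> R^o := fun v => x v - x p.
have sg : smooth_on U g by exact: smooth_dx.
have dphi (t : R^o) : is_derive t (1 : R^o) ((fun t => T * (t * t)) : R^o -> R^o) (2 * T * t).
  have H := is_deriveZ T (is_deriveM (is_derive_id t (1 : R^o)) (is_derive_id t (1 : R^o))).
  by apply: (is_derive_eq H); rewrite /GRing.scale /=; ring.
have dphi1 (t : R^o) : is_derive t (1 : R^o) ((fun t => 2 * T * t) : R^o -> R^o) (2 * T).
  have H := is_deriveZ (2 * T) (is_derive_id t (1 : R^o)).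
  by apply: (is_derive_eq H); rewrite /GRing.scale /=; ring.
have s1 : smooth_on U (fun v => 2 * T * g v : R^o).
  exact: (smoothM oU (smooth_cst U (2 * T : R^o)) sg).
rewrite (Lop_chain a b c oU sx sy J0 oU (@subset_refl _ U) Uw sg s1 (fun v _ => dphi (g v)) (dphi1 (g w))).
have g1 v : U v -> d1 x y g v = (fun _ => 1 : R^o) v by move=> Uv; exact: (D1_dx oU sx J0).
have g2 v : U v -> d2 x y g v = (fun _ => 0 : R^o) v by move=> Uv; exact: (D2_dx y oU sx).
rewrite /Lop /Qf (D1_eq x y oU Uw g1) (D1_eq x y oU Uw g2) (D2_eq x y oU Uw g2).
rewrite (g1 _ Uw) (g2 _ Uw) !D1_cst D2_cst; ring.
Qed.

(** The hypothesis on [f] says exactly that the operator is at least - C on the logarithm of [f],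
    because f L f - Q f = f^2 L (ln f). *)
Lemma Lop_lnf w : U w -> 0 < f w -> - C <= L (fun v => ln (f v) : R^o) w.
Proof.
move=> Uw fw; pose V := [set v | U v /\ 0 < f v].
have oV : open V by exact: open_gt0.
have VU : V `<=` U by move=> v [].
have sfV := smooth_sub VU sf.
have fn v : V v -> f v != 0 by case=> _ /gt_eqF ->.
have dl v : V v -> is_derive (f v) (1 : R^o) ((fun t => ln t) : R^o -> R^o) ((fun t : R^o => t^-1 : R^o) (f v)).
  by move=> [_ fv]; exact: is_derive1_ln.
have dv : is_derive (f w) (1 : R^o) (fun t : R^o => t^-1 : R^o) (- (f w)^-1 ^+ 2).
  have fw0 : f w != 0 by rewrite gt_eqF.
  have := @is_deriveV R id (f w) 1 1 fw0 (is_derive_id _ _).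
  by rewrite /GRing.scale /= mulr1 exprVn.
have Vw : V w by [].
rewrite (Lop_chain a b c oU sx sy J0 oV VU Vw sfV (smoothV oV fn sfV) dl dv).
have -> : (f w)^-1 * L f w + - (f w)^-1 ^+ 2 * Q f w = (f w * L f w - Q f w) / f w ^+ 2.
  by field; rewrite gt_eqF.
by rewrite ler_pdivlMr ?exprn_gt0//; exact: HC.
Qed.

(** Where positive, the function is the exponential of ln f + T (x - x p)^2 minus the logarithmic poles.
    The operator is at least - C on the first term, exceeds C on the second one and is nonpositive on
    each pole; this contradicts the second derivative test at a maximum. *)
Lemma no_interior_max s T w (V : set P) : open V -> V w -> V `<=` ball p r ->
  (forall z, z \in s -> ball p r z) ->
  C < 2 * T * a w ->
  0 < f w * expR (T * ((x w - x p) * (x w - x p))) * \prod_(z <- s) pole z w ->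
  (forall v, V v ->
     f v * expR (T * ((x v - x p) * (x v - x p))) * \prod_(z <- s) pole z v <=
     f w * expR (T * ((x w - x p) * (x w - x p))) * \prod_(z <- s) pole z w) -> False.
Proof.
move=> oV Vw Vr Bs CT u0 umax.
have Bw := Vr _ Vw; have Uw := ball_U Bw.
have fw : 0 < f w.
  rewrite lt_neqAle f0// andbT eq_sym; apply/eqP => fw0.
  by move: u0; rewrite fw0 !mul0r ltxx.
have qs z : z \in s -> ball p r z /\ 0 < q z w.
  move=> zs; split; first exact: Bs.
  apply: qdist_gt0 => //; first exact: Bs.
  apply/eqP => wz; move: u0; rewrite (big_rem z) //= /pole wz qdistxx sqrtr0 invr0 mulr0 mul0r mulr0.
  by rewrite ltxx.
have [V1 [oV1 V1U V1w sV1 [q1 L1]]] := poles_super Bw qs.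
pose W := V `&` (V1 `&` [set v | U v /\ 0 < f v]).
have oW : open W by apply: openI => //; apply: openI => //; exact: open_gt0.
have WU : W `<=` U by move=> v [_ [/V1U]].
have Ww : W w by [].
pose psi : P -> R^o := fun v => T * ((x v - x p) * (x v - x p)).
have spsi : smooth_on U psi.
  exact: (smoothM oU (smooth_cst U (T : R^o)) (smoothM oU (smooth_dx oU sx p) (smooth_dx oU sx p))).
have s1 : smooth_on W (fun v => ln (f v) : R^o).
  by apply: smooth_ln => //; [exact: smooth_sub sf|move=> v [_ [_ []]]].
have s2 := smooth_sub WU spsi.
have s3 : smooth_on W (poles s) by apply: smooth_sub sV1 => v [_ []].
pose h : P -> R^o := fun v => ln (f v) + psi v - poles s v.
have sh : smooth_on W h by exact: (smoothB oW (smoothD oW s1 s2) s3).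
have Eh v : W v -> expR (h v) = f v * expR (psi v) * \prod_(z <- s) pole z v.
  move=> [_ [V1v [_ fv]]]; rewrite /h expRB expRD lnK ?posrE//; congr (_ * _).
  rewrite -expRN /poles -sumrN expR_sum; apply: eq_big_seq => z zs.
  by rewrite poleE//; exact: q1.
have hmax v : W v -> h v <= h w.
  by move=> Wv; rewrite -ler_expR !Eh//; apply: umax; case: Wv.
have aw := a0 Uw; have dw := ltW (d0 Uw).
have := Lop_max oU sx sy J0 oW WU Ww sh hmax aw dw.
rewrite /h (Lop_add a b c oU sx sy J0 oW WU Ww (smoothD oW s1 s2) (smoothN oW s3)).
rewrite (Lop_add a b c oU sx sy J0 oW WU Ww s1 s2) (Lop_opp a b c oU sx sy J0 oW WU Ww s3).
rewrite (Lop_sqx T Uw); have := Lop_lnf Uw fw; lra.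
Qed.

End Jensen.

Section InfinitelyManyZeros.
Context {R : realType}.
Notation P := (R * R)%type.
Variables (U : set P) (x y a b c f : P -> R^o).
Hypotheses (oU : open U) (sx : smooth_on U x) (sy : smooth_on U y).
Hypothesis J0 : forall w, U w -> jacobian2 x y w != 0.
Hypotheses (sa : smooth_on U a) (sb : smooth_on U b) (sc : smooth_on U c).
Hypothesis a0 : forall w, U w -> 0 < a w.
Hypothesis d0 : forall w, U w -> 0 < a w * c w - b w ^+ 2.
Hypotheses (sf : smooth_on U f) (f0 : forall w, U w -> 0 <= f w).
Variable C : R.
Hypothesis HC : forall w, U w ->
  - C * f w ^+ 2 <= f w * Lop x y a b c f w - Qf x y a b c f w.

Definition box (p : P) (e : R) : set P := [set v | `|p - v| <= e].

Lemma compact_box p e : compact (box p e).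
Proof.
have -> : box p e = `[p.1 - e, p.1 + e]%classic `*` `[p.2 - e, p.2 + e]%classic.
  apply/seteqP; split=> v; rewrite /box /= prod_normE ge_max /= !in_itv /= !ler_distlC.
    by move=> /andP[-> ->].
  by move=> [-> ->].
by apply: compact_setX; exact: segment_compact.
Qed.

Lemma boxP (p v : P) (e : R) : ball p e v <-> `|p - v| < e.
Proof. by rewrite -ball_normE. Qed.

(** A Jensen-type estimate. Put poles at N zeros of [f] close to [p]. The product of [f], the poles and
    a fixed exponential attains its maximum over a box on the boundary, where each pole is at most m,
    whereas at points w sufficiently close to [p] each pole is at least 2 m. Hence f w (2 m)^N is at
    most F m^N, with F independent of N, and f w = 0 since N is arbitrary. *)
Lemma zero_near_of_infinitely_many_zeros (p : P) : U p ->
  (forall e : R, 0 < e -> forall N, exists s : seq P,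
     [/\ uniq s, size s = N & forall z, z \in s -> ball p e z /\ f z = 0]) ->
  \forall w \near p, f w = 0.
Proof.
move=> Up Hz.
have [k1 [k2 [K [k10 k20 K0 nB]]]] := barrier_near oU sx sy J0 sa sb sc a0 d0 Up.
have na := near_fst (near_pos (smooth_continuous sa Up) (a0 Up)).
have [r r0 Hr] : exists2 r : R, 0 < r & forall w z, ball p r w -> ball p r z ->
   [/\ U w, k1 * `|w - z| ^+ 2 <= qdist x y a b c z w <= k2 * `|w - z| ^+ 2 &
    0 < qdist x y a b c z w -> Lop x y a b c (fun v => log_pole K (qdist x y a b c z v)) w <= 0]
   /\ a p / 2 <= a w.
  have [[A1 A2] /= [/nbhs_ballP[e1 /= e10 H1] /nbhs_ballP[e2 /= e20 H2]] H12] := filterI nB na.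
  have [t t0 /andP[t1 t2]] := exists_small e10 e20.
  exists t => // w z Bw Bz; apply: (H12 (w, z)); split => /=.
    by apply: H1; apply: le_ball Bw; exact: ltW.
  by apply: H2; apply: le_ball Bz; exact: ltW.
have HB w z (Bw : ball p r w) (Bz : ball p r z) := (Hr w z Bw Bz).1.
have Ha w (Bw : ball p r w) := (Hr w w Bw Bw).2.
pose T := (`|C| + 1) / a p.
have ap := a0 Up.
have T0 : 0 < T by rewrite divr_gt0// ltr_wpDl.
have HT w : ball p r w -> C < 2 * T * a w.
  move=> Bw; apply: lt_le_trans (_ : `|C| + 1 <= _).
    by apply: le_lt_trans (ler_norm _) _; rewrite ltrDl.
  have -> : `|C| + 1 = 2 * T * (a p / 2) by rewrite /T; field; rewrite gt_eqF.
  by rewrite ler_wpM2l ?Ha// mulr_ge0// ltW.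
pose psi w : R := T * ((x w - x p) * (x w - x p)).
have psi0 w : 0 <= psi w by rewrite mulr_ge0 ?(ltW T0)// -expr2 sqr_ge0.
pose B := box p (r / 2).
have r20 : 0 < r / 2 by rewrite divr_gt0.
have r2r : r / 2 < r by rewrite ltr_pdivrMr// ltr_pMr// ltr1n.
have BB w : B w -> ball p r w by move=> Bw; apply/boxP; exact: le_lt_trans r2r.
have Bp : B p by rewrite /B /box /= subrr normr0 ltW.
pose u s w : R := f w * expR (psi w) * \prod_(z <- s) pole x y a b c K z w.
have ucont s w : ball p r w -> uniq s -> (forall z, z \in s -> ball p r z /\ f z = 0) ->
    u s v @[v --> w] --> u s w.
  move=> Bw us Hs; have Uw := ball_U HB Bw.
  have spsi : smooth_on U (psi : P -> R^o).
    exact: (smoothM oU (smooth_cst U (T : R^o)) (smoothM oU (smooth_dx oU sx p) (smooth_dx oU sx p))).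
  have ce : expR (psi v) @[v --> w] --> expR (psi w).
    by apply: (continuous_cvg _ (@continuous_expR R (psi w))); exact: (smooth_continuous spsi Uw).
  have cp := f_prod_cont oU sx sy k10 k20 K0 HB sf f0 Bw us Hs.
  rewrite (_ : u s w = f w * \prod_(z <- s) pole x y a b c K z w * expR (psi w)); last by rewrite /u mulrAC.
  apply: cvg_trans (cvgM cp ce); apply: near_eq_cvg; apply: nearW => v.
  by rewrite /u /= -[LHS]mulrA [X in _ * X]mulrC mulrA.
have umax s : uniq s -> (forall z, z \in s -> ball p r z /\ f z = 0) ->
    exists2 w, B w & forall v, B v -> u s v <= u s w.
  move=> us Hs; have [||w Bw Hw] := @compact_EVT_max P R (u s) B _ (@compact_box p (r / 2)).
  - by exists p.
  - apply: continuous_in_subspaceT => w; rewrite inE => Bw; apply: ucont => //; exact: BB.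
  - by exists w; [exact: set_mem|move=> v Bv; apply: Hw; rewrite inE].
have [w0 _ HF] := umax [::] isT (fun z H => ltac:(by [])).
pose F := u [::] w0.
have s10 : 0 < Num.sqrt k1 by rewrite sqrtr_gt0.
have s20 : 0 < Num.sqrt k2 by rewrite sqrtr_gt0.
pose m : R := expR (K * (Num.sqrt k2 * r)) / (Num.sqrt k1 * (r / 4)).
have m0 : 0 < m by rewrite divr_gt0 ?expR_gt0// mulr_gt0// divr_gt0.
(* the radius below which every pole dominates twice its size on the boundary of the box *)
have [e e0 /andP[er em]] : exists2 e : R, 0 < e & (e < r / 4) && (e < (4 * m * Num.sqrt k2)^-1).
  have h1 : 0 < r / 4 by rewrite divr_gt0.
  have m40 : 0 < 4 * m by rewrite pmulr_rgt0.
  have h2 : 0 < (4 * m * Num.sqrt k2)^-1 by rewrite invr_gt0 pmulr_rgt0.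
  exact: exists_small h1 h2.
apply/nbhs_ballP; exists e => //= w Bw; apply/eqP/negPn/negP => fw.
have ebr z : ball p e z -> ball p r z by apply: le_ball; lra.
have fge v : ball p r v -> 0 <= f v by move=> Bv; exact: (f0 (ball_U HB Bv)).
have fw0 : 0 < f w by rewrite lt_neqAle eq_sym fw fge//; exact: ebr.
pose N := Num.bound (F / f w).
have [s [us sN Hs]] := Hz e e0 N.
have Hs' z : z \in s -> ball p r z /\ f z = 0 by move=> /Hs[/ebr].
have wB : B w by apply: ltW; move/boxP: Bw => H; apply: lt_trans H _; lra.
have low z : z \in s -> 2 * m <= pole x y a b c K z w.
  move=> zs; have [Bz fz] := Hs z zs.
  have wz : w != z by apply/eqP => wz; move: fw; rewrite wz fz eqxx.
  have q0 := qdist_gt0 k10 HB (ebr _ Bw) (ebr _ Bz) wz.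
  have [_ /andP[_ q2] _] := HB _ _ (ebr _ Bw) (ebr _ Bz).
  have t2e : `|w - z| <= 2 * e.
    have := ler_distD p w z; move/boxP: Bw; move/boxP: Bz; rewrite [`|w - p|]distrC; lra.
  have sq : Num.sqrt (qdist x y a b c z w) <= (2 * m)^-1.
    apply: (@le_trans _ _ (Num.sqrt (k2 * `|w - z| ^+ 2))); first exact: ler_wsqrtr.
    rewrite sqrtrM ?(ltW k20)// sqrtr_sqr normr_id.
    apply: (@le_trans _ _ (Num.sqrt k2 * (2 * (4 * m * Num.sqrt k2)^-1))).
      by rewrite ler_wpM2l ?(ltW s20)//; apply: le_trans t2e _; rewrite ler_wpM2l// ltW.
    have E (A D : R) : 0 < A -> 0 < D -> D * (2 * (4 * A * D)^-1) = (2 * A)^-1.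
      by move=> A0 D0; field; rewrite !gt_eqF.
    by rewrite (E m _ m0 s20).
  rewrite /pole -[leLHS]mul1r; apply: ler_pM => //; first by rewrite mulr_ge0// ltW.
    by rewrite -expR0 ler_expR mulr_ge0 ?(ltW K0) ?sqrtr_ge0.
  rewrite -[leLHS]invrK lef_pV2 ?posrE ?sqrtr_gt0// invr_gt0 mulr_gt0//.
have lowu : f w * (2 * m) ^+ N <= u s w.
  rewrite /u -mulrA ler_wpM2l ?(ltW fw0)//.
  apply: (@le_trans _ _ (\prod_(z <- s) pole x y a b c K z w)).
    rewrite -sN; elim: s low {us sN Hs Hs'} => [|z s IH] low; first by rewrite big_nil.
    rewrite /= exprS big_cons; apply: ler_pM.
    - by rewrite mulr_ge0// ltW.
    - by rewrite exprn_ge0// mulr_ge0// ltW.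
    - by apply: low; exact: mem_head.
    - by apply: IH => z' z's; apply: low; rewrite inE z's orbT.
  rewrite ler_peMl ?prodr_ge0//; first by move=> z _; exact: pole_ge0.
  by rewrite -expR0 ler_expR psi0.
have [v Bv Hv] := umax s us Hs'.
have uw0 : 0 < u s w by apply: lt_le_trans lowu; rewrite mulr_gt0// exprn_gt0// mulr_gt0.
have uv0 : 0 < u s v by exact: lt_le_trans (Hv w wB).
have bdry : `|p - v| = r / 2.
  apply/eqP; rewrite eq_le Bv /= leNgt; apply/negP => vin.
  have oI : open (ball p (r / 2)) by exact: ball_open.
  apply: (no_interior_max oU sx sy J0 a0 d0 k10 HB sf f0 HC oI (w := v) (s := s) (T := T)).
  - exact/boxP.
  - by move=> z; apply: le_ball; exact: ltW.
  - by move=> z /Hs'[].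
  - by apply: HT; exact: BB.
  - exact: uv0.
  - by move=> z /boxP zr; apply: Hv; exact: ltW.
have high z : z \in s -> pole x y a b c K z v <= m.
  move=> zs; have [Bz fz] := Hs z zs.
  have [_ /andP[q1 q2] _] := HB _ _ (BB _ Bv) (ebr _ Bz).
  have [t1 t2] : r / 4 <= `|v - z| /\ `|v - z| <= r.
    have := ler_distD z p v; have := ler_distD p v z; move/boxP: Bz.
    rewrite [`|v - p|]distrC [`|z - v|]distrC bdry; lra.
  have sq1 : Num.sqrt k1 * (r / 4) <= Num.sqrt (qdist x y a b c z v).
    apply: (@le_trans _ _ (Num.sqrt (k1 * `|v - z| ^+ 2))); last exact: ler_wsqrtr.
    by rewrite sqrtrM ?(ltW k10)// sqrtr_sqr normr_id ler_wpM2l ?(ltW s10).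
  have sq2 : Num.sqrt (qdist x y a b c z v) <= Num.sqrt k2 * r.
    apply: (@le_trans _ _ (Num.sqrt (k2 * `|v - z| ^+ 2))); first exact: ler_wsqrtr.
    by rewrite sqrtrM ?(ltW k20)// sqrtr_sqr normr_id ler_wpM2l ?(ltW s20).
  have pr : 0 < Num.sqrt k1 * (r / 4) by rewrite mulr_gt0// divr_gt0.
  rewrite /pole /m; apply: ler_pM; rewrite ?expR_ge0 ?invr_ge0 ?sqrtr_ge0//.
    by rewrite ler_expR ler_wpM2l// ltW.
  by rewrite lef_pV2// posrE; exact: lt_le_trans sq1.
have highu : u s v <= F * m ^+ N.
  have Fv : f v * expR (psi v) <= F by have := HF v Bv; rewrite /u big_nil mulr1.
  have fe0 : 0 <= f v * expR (psi v).
    by rewrite mulr_ge0 ?expR_ge0// fge//; exact: BB.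
  rewrite /u; apply: ler_pM => //; first by rewrite prodr_ge0// => z _; exact: pole_ge0.
  rewrite -sN; elim: s high {us sN Hs Hs' low lowu Hv uw0 uv0} => [|z s IH] high; first by rewrite big_nil.
  rewrite /= exprS big_cons; apply: ler_pM; rewrite ?pole_ge0//.
  - by rewrite prodr_ge0// => z' _; exact: pole_ge0.
  - by apply: high; exact: mem_head.
  - by apply: IH => z' z's; apply: high; rewrite inE z's orbT.
have : f w * (2 * m) ^+ N <= F * m ^+ N.
  by apply: le_trans lowu _; apply: le_trans (Hv w wB) _.
rewrite exprMn mulrA ler_pM2r ?exprn_gt0//.
apply/negP; rewrite -ltNge mulrC -ltr_pdivrMr//.
have F0 : 0 <= F / f w.
  rewrite divr_ge0 ?(ltW fw0)//; apply: le_trans (HF p Bp).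
  by rewrite /u big_nil mulr1 mulr_ge0 ?expR_ge0// f0.
apply: lt_trans (archi_boundP F0) _.
by rewrite -natrX ltr_nat ltn_expl.
Qed.

End InfinitelyManyZeros.

(** * The Bochner inequality for the Hessian determinant *)
(** In dimension two the Hessian terms of the Bochner formula cancel identically; what is left is
    controlled by the defects d2, d3 of the differentiated equation. *)
Lemma bochner_alg (R : fieldType) (a b c r s k0 k1 d2 d3 : R) : c != 0 ->
 let t := - (a * r + 2 * b * s) / c in
 let l2 := - (a * k0 + 2 * b * k1) / c in
 let l3 := - (a * k1 + 2 * b * l2) / c in
 let k2 := l2 + d2 in let k3 := l3 + d3 in
 let f := s * s - r * t in
 let f1 := 2 * s * k1 - r * k2 - t * k0 in
 let f2 := 2 * s * k2 - r * k3 - t * k1 in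
 let h1 := 2 * s * k1 - r * l2 - t * k0 in
 let h2 := 2 * s * l2 - r * l3 - t * k1 in
 let n1 := - (r * d2) in let n2 := 2 * s * d2 - r * d3 in
 f * (2 * (a * (k1 * k1) + 2 * b * (k1 * k2) + c * (k2 * k2))
    - 2 * (a * (k0 * k2) + b * (k0 * k3 + k1 * k2) + c * (k1 * k3)))
  - (a * f1 ^+ 2 + 2 * b * (f1 * f2) + c * f2 ^+ 2) =
 f * (d2 * (2 * b * k1 + 4 * c * l2 + 2 * c * d2 - 2 * a * k0) + d3 * (- (2 * b * k0) - 2 * c * k1))
  - (2 * (a * (h1 * n1) + b * (h1 * n2 + h2 * n1) + c * (h2 * n2))
     + (a * (n1 * n1) + 2 * b * (n1 * n2) + c * (n2 * n2))).
Proof. by move=> c0 /=; field. Qed.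

Section Bochner.
Context {R : realType}.
Notation P := (R * R)%type.
Implicit Types (g h : P -> R^o) (w : P).
Variables (U : set P) (x y z : P -> R^o) (G : P -> R^o).
Hypotheses (oU : open U) (sx : smooth_on U x) (sy : smooth_on U y) (sz : smooth_on U z).
Hypothesis J0 : forall w, U w -> jacobian2 x y w != 0.
Hypothesis sG : smooth_on setT G.
Notation D1 := (d1 x y).
Notation D2 := (d2 x y).

Definition slope1 : P -> R^o := D1 z.
Definition slope2 : P -> R^o := D2 z.
Definition hess11 : P -> R^o := D1 slope1.
Definition hess12 : P -> R^o := D1 slope2.
Definition hess22 : P -> R^o := D2 slope2.
Definition coef (H : P -> R^o) : P -> R^o := fun w => H (slope1 w, slope2 w).
(** The opposite of the determinant of the Hessian of z as a function of x and y. *)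
Definition hdet : P -> R^o := fun w => hess12 w * hess12 w - hess11 w * hess22 w.

Notation p := slope1.
Notation q := slope2.
Notation r := hess11.
Notation s := hess12.
Notation t := hess22.
Notation a := (coef (px (px G))).
Notation b := (coef (px (py G))).
Notation c := (coef (py (py G))).
Notation f := hdet.
Notation L := (Lop x y a b c).
Notation Q := (Qf x y a b c).

Hypothesis a0 : forall w, U w -> 0 < a w.
Hypothesis d0 : forall w, U w -> 0 < a w * c w - b w ^+ 2.
Hypothesis EL : forall w, U w -> a w * r w + 2 * b w * s w + c w * t w = 0.

Lemma smooth_d1 g : smooth_on U g -> smooth_on U (D1 g).
Proof. exact: (smooth_D1 oU sx sy J0 oU (@subset_refl _ U)). Qed.
Lemma smooth_d2 g : smooth_on U g -> smooth_on U (D2 g).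
Proof. exact: (smooth_D2 oU sx sy J0 oU (@subset_refl _ U)). Qed.
Lemma d12_comm g w : smooth_on U g -> U w -> D1 (D2 g) w = D2 (D1 g) w.
Proof. exact: (D12C oU sx sy J0 oU (@subset_refl _ U)). Qed.

Lemma smooth_slope1 : smooth_on U p. Proof. exact: smooth_d1. Qed.
Lemma smooth_slope2 : smooth_on U q. Proof. exact: smooth_d2. Qed.
Lemma smooth_hess11 : smooth_on U r. Proof. exact: smooth_d1 smooth_slope1. Qed.
Lemma smooth_hess12 : smooth_on U s. Proof. exact: smooth_d1 smooth_slope2. Qed.
Lemma smooth_hess22 : smooth_on U t. Proof. exact: smooth_d2 smooth_slope2. Qed.

Lemma smooth_coef H : smooth_on setT H -> smooth_on U (coef H).
Proof.
move=> sH; apply: (@smooth_comp _ _ _ _ U setT (fun w => (p w, q w)) H) => //.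
- exact: (findim_pair findim_R findim_R).
- exact: findim_R.
- exact: openT.
- exact: (smooth_pair oU smooth_slope1 smooth_slope2).
Qed.

Lemma smooth_coef11 : smooth_on U a. Proof. by apply: smooth_coef; do 2 apply: smooth_px. Qed.
Lemma smooth_coef12 : smooth_on U b. Proof. by apply: smooth_coef; apply: smooth_px; apply: smooth_py. Qed.
Lemma smooth_coef22 : smooth_on U c. Proof. by apply: smooth_coef; do 2 apply: smooth_py. Qed.
Lemma smooth_hdet : smooth_on U f.
Proof. exact: (smoothB oU (smoothM oU smooth_hess12 smooth_hess12) (smoothM oU smooth_hess11 smooth_hess22)). Qed.

Lemma coef22_gt0 w : U w -> 0 < c w.
Proof.
move=> Uw; rewrite -(pmulr_rgt0 _ (a0 Uw)); have := d0 Uw; have := sqr_ge0 (b w); lra.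
Qed.

Lemma d2_slope1 w : U w -> D2 p w = s w.
Proof. by move=> Uw; rewrite -(d12_comm sz Uw). Qed.
Lemma d2_hess11 w : U w -> D2 r w = D1 s w.
Proof.
move=> Uw; rewrite -(d12_comm smooth_slope1 Uw); exact: (D1_eq x y oU Uw d2_slope1).
Qed.
Lemma d2_hess12 w : U w -> D2 s w = D1 t w.
Proof. by move=> Uw; rewrite -(d12_comm smooth_slope2 Uw). Qed.

(** By the equation, c f is the value at (r, s) of the positive definite form (a, b, c). So f is
    nonnegative and controls the whole Hessian. *)
Lemma hdet_ge w : U w ->
  (a w * c w - b w ^+ 2) * (r w ^+ 2 + s w ^+ 2) <= (a w + c w) * (c w * f w).
Proof.
move=> Uw; have E := EL Uw.
have -> : c w * f w = a w * r w ^+ 2 + 2 * b w * (r w * s w) + c w * s w ^+ 2.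
  have Et : c w * t w = - (a w * r w + 2 * b w * s w) by rewrite -[RHS]add0r -E; ring.
  have -> : c w * f w = c w * s w ^+ 2 - r w * (c w * t w) by rewrite /hdet; ring.
  by rewrite Et; ring.
rewrite -subr_ge0 (_ : _ - _ = (a w * r w + b w * s w) ^+ 2 + (b w * r w + c w * s w) ^+ 2).
  by rewrite addr_ge0// sqr_ge0.
ring.
Qed.

Lemma hdet_ge0 w : U w -> 0 <= f w.
Proof.
move=> Uw; have := hdet_ge Uw; have a1 := a0 Uw; have c1 := coef22_gt0 Uw.
move=> H; rewrite -(pmulr_rge0 _ c1) -(pmulr_rge0 _ (addr_gt0 a1 c1)).
apply: le_trans H; apply: mulr_ge0; first exact: (ltW (d0 Uw)).
by rewrite addr_ge0 ?sqr_ge0.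
Qed.

Lemma hdet_eq0 w : U w -> f w = 0 -> [/\ r w = 0, s w = 0 & t w = 0].
Proof.
move=> Uw fw; have := hdet_ge Uw; rewrite fw !mulr0 => H.
have S0 : r w ^+ 2 + s w ^+ 2 = 0.
  apply/eqP; rewrite eq_le addr_ge0 ?sqr_ge0// andbT.
  by move: H; rewrite pmulr_rle0// d0.
have r0 : r w = 0.
  by apply/eqP; rewrite -sqrf_eq0 eq_le sqr_ge0 andbT; have := sqr_ge0 (s w); lra.
have s0 : s w = 0.
  by apply/eqP; rewrite -sqrf_eq0 eq_le sqr_ge0 andbT; have := sqr_ge0 (r w); lra.
split=> //; apply/eqP; have := EL Uw; rewrite r0 s0 !mulr0 !add0r => /eqP.
by rewrite mulf_eq0 gt_eqF ?coef22_gt0.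
Qed.

Section Leibniz2.
Variables (X Y : (P -> R^o) -> P -> R^o).
Hypothesis Xeq : forall g h w, U w -> (forall v, U v -> g v = h v) -> X g w = X h w.
Hypothesis Yeq : forall g h w, U w -> (forall v, U v -> g v = h v) -> Y g w = Y h w.
Hypothesis Xadd : forall g h w, U w -> smooth_on U g -> smooth_on U h ->
  X (fun v => g v + h v) w = X g w + X h w.
Hypothesis Yadd : forall g h w, U w -> smooth_on U g -> smooth_on U h ->
  Y (fun v => g v + h v) w = Y g w + Y h w.
Hypothesis Xmul : forall g h w, U w -> smooth_on U g -> smooth_on U h ->
  X (fun v => g v * h v) w = g w * X h w + h w * X g w.
Hypothesis Ymul : forall g h w, U w -> smooth_on U g -> smooth_on U h ->
  Y (fun v => g v * h v) w = g w * Y h w + h w * Y g w.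
Hypothesis X0 : forall k w, X (fun _ => k) w = 0.
Hypothesis Y0 : forall k w, Y (fun _ => k) w = 0.
Hypothesis sY : forall g, smooth_on U g -> smooth_on U (Y g).

Let s2 := smooth_cst U (2 : R^o).

Lemma deriv_EL w : U w -> a w * Y r w + 2 * b w * Y s w + c w * Y t w =
  - (r w * Y a w + 2 * s w * Y b w + t w * Y c w).
Proof.
move=> Uw.
have E : Y (fun v => a v * r v + 2 * (b v * s v) + c v * t v) w = 0.
  by rewrite -(Y0 0 w); apply: Yeq => // v Uv; rewrite mulrA EL.
have m1 := smoothM oU smooth_coef11 smooth_hess11; have m2 := smoothM oU smooth_coef12 smooth_hess12; have m3 := smoothM oU smooth_coef22 smooth_hess22.
have m4 := smoothM oU s2 m2.
move: E; rewrite (Yadd Uw (smoothD oU m1 m4) m3) (Yadd Uw m1 m4) (Ymul Uw s2 m2).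
rewrite (Ymul Uw smooth_coef11 smooth_hess11) (Ymul Uw smooth_coef12 smooth_hess12) (Ymul Uw smooth_coef22 smooth_hess22) Y0 => E.
apply/eqP; rewrite -subr_eq0; apply/eqP; rewrite -E; ring.
Qed.

Lemma deriv2_EL w : U w -> a w * X (Y r) w + 2 * b w * X (Y s) w + c w * X (Y t) w =
  - (r w * X (Y a) w + 2 * s w * X (Y b) w + t w * X (Y c) w)
  - (X r w * Y a w + 2 * X s w * Y b w + X t w * Y c w)
  - (X a w * Y r w + 2 * X b w * Y s w + X c w * Y t w).
Proof.
move=> Uw.
pose F : P -> R^o := fun w => a w * Y r w + 2 * (b w * Y s w) + c w * Y t w
  + (r w * Y a w + 2 * (s w * Y b w) + t w * Y c w).
have E : X F w = 0.
  rewrite -(X0 0 w); apply: Xeq => // v Uv; have := deriv_EL Uv => H; rewrite /F.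
  by rewrite !mulrA H addNr.
have m1 := smoothM oU smooth_coef11 (sY smooth_hess11); have m2 := smoothM oU smooth_coef12 (sY smooth_hess12); have m3 := smoothM oU smooth_coef22 (sY smooth_hess22).
have n1 := smoothM oU smooth_hess11 (sY smooth_coef11); have n2 := smoothM oU smooth_hess12 (sY smooth_coef12); have n3 := smoothM oU smooth_hess22 (sY smooth_coef22).
have m4 := smoothM oU s2 m2; have n4 := smoothM oU s2 n2.
move: E; rewrite /F.
rewrite (Xadd Uw (smoothD oU (smoothD oU m1 m4) m3) (smoothD oU (smoothD oU n1 n4) n3)).
rewrite (Xadd Uw (smoothD oU m1 m4) m3) (Xadd Uw m1 m4) (Xmul Uw s2 m2).
rewrite (Xadd Uw (smoothD oU n1 n4) n3) (Xadd Uw n1 n4) (Xmul Uw s2 n2).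
rewrite (Xmul Uw smooth_coef11 (sY smooth_hess11)) (Xmul Uw smooth_coef12 (sY smooth_hess12)) (Xmul Uw smooth_coef22 (sY smooth_hess22)).
rewrite (Xmul Uw smooth_hess11 (sY smooth_coef11)) (Xmul Uw smooth_hess12 (sY smooth_coef12)) (Xmul Uw smooth_hess22 (sY smooth_coef22)) X0 => E.
apply/eqP; rewrite -subr_eq0; apply/eqP; rewrite -E; ring.
Qed.
End Leibniz2.

Let D1eq g h w (Uw : U w) := @D1_eq R x y U oU g h w Uw.
Let D2eq g h w (Uw : U w) := @D2_eq R x y U oU g h w Uw.
Let D1add g h w (Uw : U w) := @D1_add R x y U g h w Uw.
Let D2add g h w (Uw : U w) := @D2_add R x y U g h w Uw.
Let D1mul g h w (Uw : U w) := @D1_mul R x y U g h w Uw.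
Let D2mul g h w (Uw : U w) := @D2_mul R x y U g h w Uw.

(** What two differentiations of the Euler-Lagrange equation leave beside the principal part. Every
    summand contains an undifferentiated Hessian entry or a first derivative of a coefficient, and the
    latter is linear in the Hessian by the chain rule; so the whole is small where the Hessian is. *)
Definition rest (X Y : (P -> R^o) -> P -> R^o) w : R :=
  - (r w * X (Y a) w + 2 * s w * X (Y b) w + t w * X (Y c) w)
  - (X r w * Y a w + 2 * X s w * Y b w + X t w * Y c w)
  - (X a w * Y r w + 2 * X b w * Y s w + X c w * Y t w).

Lemma Lop_hess11 w : U w -> L r w = rest D1 D1 w.
Proof.
move=> Uw; rewrite /rest -(deriv2_EL D1eq D1eq D1add D1add D1mul D1mul (D1_cst x y) (D1_cst x y) smooth_d1 Uw) /Lop.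
congr (_ + _ * _ + _ * _); first exact: (D1eq Uw d2_hess11).
rewrite (D2eq Uw d2_hess11) -(d12_comm smooth_hess12 Uw); exact: (D1eq Uw d2_hess12).
Qed.

Lemma Lop_hess12 w : U w -> L s w = rest D1 D2 w.
Proof.
move=> Uw; rewrite /rest -(deriv2_EL D1eq D2eq D1add D2add D1mul D2mul (D1_cst x y) (D2_cst x y) smooth_d2 Uw) /Lop.
congr (_ * _ + _ + _ * _); first by rewrite (D1eq Uw d2_hess11).
rewrite (D2eq Uw d2_hess12) -(d12_comm smooth_hess22 Uw) //.
Qed.

Lemma Lop_hess22 w : U w -> L t w = rest D2 D2 w.
Proof.
move=> Uw; rewrite /rest -(deriv2_EL D2eq D2eq D2add D2add D2mul D2mul (D2_cst x y) (D2_cst x y) smooth_d2 Uw) /Lop.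
congr (_ * _ + _ * _ + _).
  rewrite (D2eq Uw d2_hess11) -(d12_comm smooth_hess12 Uw); apply: (D1eq Uw) => v Uv; by rewrite d2_hess12.
rewrite (D2eq Uw d2_hess12) (d12_comm smooth_hess22 Uw) //.
Qed.

Lemma Lop_mul g h w : U w -> smooth_on U g -> smooth_on U h ->
  L (fun v => g v * h v) w = g w * L h w + h w * L g w
   + 2 * (a w * (D1 g w * D1 h w) + b w * (D1 g w * D2 h w + D2 g w * D1 h w)
     + c w * (D2 g w * D2 h w)).
Proof.
move=> Uw sg sh; rewrite /Lop.
have E1 v : U v -> D1 (fun v => g v * h v) v = g v * D1 h v + h v * D1 g v by move=> Uv; exact: D1mul.
have E2 v : U v -> D2 (fun v => g v * h v) v = g v * D2 h v + h v * D2 g v by move=> Uv; exact: D2mul.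
rewrite (D1eq Uw E1) (D1eq Uw E2) (D2eq Uw E2).
have sg1 := smooth_d1 sg; have sg2 := smooth_d2 sg; have sh1 := smooth_d1 sh; have sh2 := smooth_d2 sh.
rewrite (D1add Uw (smoothM oU sg sh1) (smoothM oU sh sg1)).
rewrite (D1add Uw (smoothM oU sg sh2) (smoothM oU sh sg2)).
rewrite (D2add Uw (smoothM oU sg sh2) (smoothM oU sh sg2)).
rewrite (D1mul Uw sg sh1) (D1mul Uw sh sg1) (D1mul Uw sg sh2) (D1mul Uw sh sg2).
rewrite (D2mul Uw sg sh2) (D2mul Uw sh sg2).
ring.
Qed.

Section Graded.
Variable p0 : P.
Hypothesis Up0 : U p0.

(** The square root of [f] measures the size of the Hessian, see [hessO_hess11_12]; [hessO k g] is the
    estimate g = O(|Hessian|^k) near [p0]. *)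
Definition hessO (k : nat) g : Prop :=
  exists2 C : R, 0 <= C & \forall w \near p0, `|g w| <= C * Num.sqrt (f w) ^+ k.

Lemma hessO_smooth g : smooth_on U g -> hessO 0 g.
Proof.
move=> sg; exists (`|g p0| + 1); first by rewrite addr_ge0.
have := near_bound (smooth_continuous sg Up0).
by apply: filterS => w; rewrite expr0 mulr1.
Qed.

Lemma hessO_add k g h : hessO k g -> hessO k h -> hessO k (fun w => g w + h w).
Proof.
move=> [C C0 H] [D D0 K]; exists (C + D); first exact: addr_ge0.
near=> w; apply: le_trans (ler_normD _ _) _; rewrite mulrDl.
by apply: lerD; near: w.
Unshelve. all: by end_near. Qed.

Lemma hessO_opp k g : hessO k g -> hessO k (fun w => - g w).
Proof. by move=> [C C0 H]; exists C => //; apply: filterS H => w; rewrite normrN. Qed.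

Lemma hessO_sub k g h : hessO k g -> hessO k h -> hessO k (fun w => g w - h w).
Proof. by move=> gg gh; apply: hessO_add => //; exact: hessO_opp. Qed.

Lemma hessO_mul k l g h : hessO k g -> hessO l h -> hessO (k + l) (fun w => g w * h w).
Proof.
move=> [C C0 H] [D D0 K]; exists (C * D); first exact: mulr_ge0.
near=> w; rewrite normrM exprD mulrACA; apply: ler_pM => //; by near: w.
Unshelve. all: by end_near. Qed.

Lemma hessO_eq k g h : (forall w, U w -> g w = h w) -> hessO k g -> hessO k h.
Proof.
move=> gh [C C0 H]; exists C => //; near=> w.
have Uw : U w by near: w; exact: open_nbhs_nbhs.
by rewrite -gh//; near: w.
Unshelve. all: by end_near. Qed.

Let hessO_cst (k : R) : hessO 0 (fun _ => k : R^o) := hessO_smooth (smooth_cst U (k : R^o)).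
Let hessO_smooth0 g : smooth_on U g -> hessO 0 g := @hessO_smooth g.

Lemma smooth_invc : smooth_on U (fun w => (c w)^-1 : R^o).
Proof. by apply: (smoothV oU _ smooth_coef22) => w Uw; rewrite gt_eqF// coef22_gt0. Qed.

Lemma hessO_hess11_12 : hessO 1 r /\ hessO 1 s.
Proof.
have sd : smooth_on U (fun w => (a w * c w - b w * b w)^-1 : R^o).
  apply: (smoothV oU _ (smoothB oU (smoothM oU smooth_coef11 smooth_coef22) (smoothM oU smooth_coef12 smooth_coef12))) => w Uw.
  by rewrite gt_eqF// -expr2 d0.
have [M M0 HM] := hessO_smooth (smoothM oU (smoothM oU (smoothD oU smooth_coef11 smooth_coef22) smooth_coef22) sd).
have key w : U w -> `|(a w + c w) * c w * (a w * c w - b w * b w)^-1| <= M * Num.sqrt (f w) ^+ 0 ->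
    r w ^+ 2 + s w ^+ 2 <= M * f w.
  move=> Uw; rewrite expr0 mulr1 => Hw; have dw := d0 Uw; have f0 := hdet_ge0 Uw.
  apply: le_trans (_ : _ <= (a w + c w) * c w * (a w * c w - b w * b w)^-1 * f w) _.
    rewrite mulrAC ler_pdivlMr -?expr2// mulrC -mulrA; exact: hdet_ge.
  by rewrite ler_wpM2r//; apply: le_trans Hw; exact: ler_norm.
have sm (u v F : R) : 0 <= F -> u ^+ 2 + v ^+ 2 <= M * F -> `|u| <= Num.sqrt M * Num.sqrt F ^+ 1.
  move=> F0 H; rewrite expr1 -sqrtrM// -sqrtr_sqr ler_wsqrtr//.
  by apply: le_trans H; rewrite lerDl sqr_ge0.
split; exists (Num.sqrt M); rewrite ?sqrtr_ge0//; near=> w.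
  have Uw : U w by near: w; exact: open_nbhs_nbhs.
  by apply: (sm _ (s w)); [exact: hdet_ge0|apply: key => //; near: w].
have Uw : U w by near: w; exact: open_nbhs_nbhs.
by apply: (sm _ (r w)); [exact: hdet_ge0|rewrite addrC; apply: key => //; near: w].
Unshelve. all: by end_near. Qed.

Lemma hessO_hess11 : hessO 1 r. Proof. by case: hessO_hess11_12. Qed.
Lemma hessO_hess12 : hessO 1 s. Proof. by case: hessO_hess11_12. Qed.

Lemma hessO_hess22 : hessO 1 t.
Proof.
have H : hessO (0 + 1) (fun w => - (c w)^-1 * (a w * r w + 2 * b w * s w)).
  apply: hessO_mul; first exact: hessO_opp (hessO_smooth0 smooth_invc).
  apply: hessO_add; first exact: (hessO_mul (hessO_smooth0 smooth_coef11) hessO_hess11).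
  exact: (hessO_mul (hessO_mul (hessO_cst 2) (hessO_smooth0 smooth_coef12)) hessO_hess12).
apply: hessO_eq H => w Uw; have E := EL Uw; have cw := coef22_gt0 Uw.
have -> : a w * r w + 2 * b w * s w = - (c w * t w) by rewrite -[RHS]add0r -E; ring.
by field; rewrite gt_eqF.
Qed.

Lemma hessO_coef H : smooth_on setT H -> hessO 1 (D1 (coef H)) /\ hessO 1 (D2 (coef H)).
Proof.
move=> sH.
have sF F : smooth_on setT F -> smooth_on U (fun w => F (p w, q w) : R^o) by exact: smooth_coef.
have dH v : differentiable H v by exact: (smooth_differentiable sH).
have g1 := hessO_smooth0 (sF _ (smooth_px sH)); have g2 := hessO_smooth0 (sF _ (smooth_py sH)).
split.
  apply: hessO_eq (hessO_add (hessO_mul g1 hessO_hess11) (hessO_mul g2 hessO_hess12)) => w Uw.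
  rewrite [RHS]D1Ed (chain2 _ (dH _) (smooth_differentiable smooth_slope1 Uw) (smooth_differentiable smooth_slope2 Uw)).
  by rewrite -!D1Ed.
apply: hessO_eq (hessO_add (hessO_mul g1 hessO_hess12) (hessO_mul g2 hessO_hess22)) => w Uw.
rewrite [RHS]D2Ed (chain2 _ (dH _) (smooth_differentiable smooth_slope1 Uw) (smooth_differentiable smooth_slope2 Uw)).
by rewrite -!D2Ed d2_slope1.
Qed.

Let gD (X : (P -> R^o) -> P -> R^o) := forall H, smooth_on setT H -> hessO 1 (X (coef H)).

Lemma hessO_rest X Y : (forall g, smooth_on U g -> smooth_on U (X g)) ->
  (forall g, smooth_on U g -> smooth_on U (Y g)) -> gD X -> gD Y -> hessO 1 (rest X Y).
Proof.
move=> sX sY gX gY.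
have spp : smooth_on setT (px (px G)) by do 2 apply: smooth_px.
have spy : smooth_on setT (px (py G)) by apply: smooth_px; apply: smooth_py.
have syy : smooth_on setT (py (py G)) by do 2 apply: smooth_py.
have tri (g1 g2 g3 h1 h2 h3 : P -> R^o) k l : hessO k g1 -> hessO k g2 -> hessO k g3 ->
    hessO l h1 -> hessO l h2 -> hessO l h3 -> hessO (k + l) (fun w => g1 w * h1 w + 2 * g2 w * h2 w + g3 w * h3 w).
  move=> a1 a2 a3 b1 b2 b3; apply: hessO_add; [apply: hessO_add|]; try exact: hessO_mul.
  by apply: hessO_mul => //; exact: (hessO_mul (hessO_cst 2) a2).
have zs g : smooth_on U g -> hessO 0 (X (Y g)) by move=> sg; apply: hessO_smooth0; apply: sX; exact: sY.
apply: hessO_sub; [apply: hessO_sub; [apply: hessO_opp|]|].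
- by apply: (tri _ _ _ _ _ _ 1 0); rewrite ?hessO_hess11 ?hessO_hess12 ?hessO_hess22 //; [exact: hessO_hess11|exact: hessO_hess12|exact: hessO_hess22|exact: zs smooth_coef11|exact: zs smooth_coef12|exact: zs smooth_coef22].
- by apply: (tri _ _ _ _ _ _ 0 1); [exact: hessO_smooth0 (sX _ smooth_hess11)|exact: hessO_smooth0 (sX _ smooth_hess12)|exact: hessO_smooth0 (sX _ smooth_hess22)|exact: gY|exact: gY|exact: gY].
- by apply: (tri _ _ _ _ _ _ 1 0); [exact: gX|exact: gX|exact: gX|exact: hessO_smooth0 (sY _ smooth_hess11)|exact: hessO_smooth0 (sY _ smooth_hess12)|exact: hessO_smooth0 (sY _ smooth_hess22)].
Qed.

Lemma hessO_Lop_hess : [/\ hessO 1 (L r), hessO 1 (L s) & hessO 1 (L t)].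
Proof.
have g1 : gD D1 by move=> H /hessO_coef[].
have g2 : gD D2 by move=> H /hessO_coef[].
split.
- by apply: (hessO_eq (g := rest D1 D1)) => [w Uw|]; [rewrite Lop_hess11|exact: (hessO_rest smooth_d1 smooth_d1)].
- by apply: (hessO_eq (g := rest D1 D2)) => [w Uw|]; [rewrite Lop_hess12|exact: (hessO_rest smooth_d1 smooth_d2)].
- by apply: (hessO_eq (g := rest D2 D2)) => [w Uw|]; [rewrite Lop_hess22|exact: (hessO_rest smooth_d2 smooth_d2)].
Qed.

(** The terms of second order in the Hessian, whose coefficients are third derivatives, cancel by
    [bochner_alg]. *)
Lemma hessO_bochner : hessO 4 (fun w => f w * L f w - Q f w : R^o).
Proof.
pose k0 := D1 r; pose k1 := D1 s.
have s0 : smooth_on U k0 := smooth_d1 smooth_hess11; have s1 : smooth_on U k1 := smooth_d1 smooth_hess12.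
have s2 : smooth_on U (D1 t) := smooth_d1 smooth_hess22; have s3 : smooth_on U (D2 t) := smooth_d2 smooth_hess22.
have C (k : R) : smooth_on U (fun _ => k : R^o) := smooth_cst U (k : R^o).
pose ic w : R := (c w)^-1; have sic : smooth_on U (ic : P -> R^o) := smooth_invc.
pose l2 w : R := - (a w * k0 w + 2 * b w * k1 w) / c w.
pose l3 w : R := - (a w * k1 w + 2 * b w * l2 w) / c w.
have s2b : smooth_on U (fun w => 2 * b w : R^o) := smoothM oU (C 2) smooth_coef12.
have sl2 : smooth_on U (l2 : P -> R^o).
  exact: (smoothM oU (smoothN oU (smoothD oU (smoothM oU smooth_coef11 s0) (smoothM oU s2b s1))) sic).
have sl3 : smooth_on U (l3 : P -> R^o).
  exact: (smoothM oU (smoothN oU (smoothD oU (smoothM oU smooth_coef11 s1) (smoothM oU s2b sl2))) sic).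
pose d2 w : R := D1 t w - l2 w; pose d3 w : R := D2 t w - l3 w.
have sd2 : smooth_on U (d2 : P -> R^o) := smoothB oU s2 sl2.
have sd3 : smooth_on U (d3 : P -> R^o) := smoothB oU s3 sl3.
have spp : smooth_on setT (px (px G)) by do 2 apply: smooth_px.
have spy : smooth_on setT (px (py G)) by apply: smooth_px; apply: smooth_py.
have syy : smooth_on setT (py (py G)) by do 2 apply: smooth_py.
have tri (g1 g2 g3 : P -> R^o) : hessO 1 g1 -> hessO 1 g2 -> hessO 1 g3 ->
    hessO 2 (fun w => r w * g1 w + 2 * s w * g2 w + t w * g3 w).
  move=> b1 b2 b3; apply: hessO_add; [apply: hessO_add|].
  - exact: (hessO_mul hessO_hess11 b1).
  - exact: (hessO_mul (hessO_mul (hessO_cst 2) hessO_hess12) b2).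
  - exact: (hessO_mul hessO_hess22 b3).
have [a1 a2] := hessO_coef spp; have [b1 b2] := hessO_coef spy; have [c1 c2] := hessO_coef syy.
have gd2 : hessO 2 (d2 : P -> R^o).
  have H : hessO (2 + 0) (fun w => - (r w * D1 a w + 2 * s w * D1 b w + t w * D1 c w) * ic w).
    by apply: hessO_mul; [apply: hessO_opp; exact: tri|exact: hessO_smooth0].
  apply: hessO_eq H => w Uw; have E := deriv_EL D1eq D1add D1mul (D1_cst x y) Uw.
  rewrite -E /d2 /l2 /ic /k0 /k1; have cw := coef22_gt0 Uw.
  by field; rewrite gt_eqF.
have gd3 : hessO 2 (d3 : P -> R^o).
  have H : hessO (2 + 0) (fun w => (- (r w * D2 a w + 2 * s w * D2 b w + t w * D2 c w) - 2 * b w * d2 w) * ic w).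
    apply: hessO_mul; last exact: hessO_smooth0.
    apply: hessO_sub; first by apply: hessO_opp; exact: tri.
    exact: (hessO_mul (hessO_smooth0 s2b) gd2).
  apply: hessO_eq H => w Uw; have E := deriv_EL D2eq D2add D2mul (D2_cst x y) Uw.
  rewrite -E /d3 /l3 /d2 /ic /k1 (d2_hess11 Uw) (d2_hess12 Uw); have cw := coef22_gt0 Uw.
  by field; rewrite gt_eqF.
have gf : hessO 2 f by apply: hessO_sub; [exact: (hessO_mul hessO_hess12 hessO_hess12)|exact: (hessO_mul hessO_hess11 hessO_hess22)].
have [gLr gLs gLt] := hessO_Lop_hess.
pose h1 w : R := 2 * s w * k1 w - r w * l2 w - t w * k0 w.
pose h2 w : R := 2 * s w * l2 w - r w * l3 w - t w * k1 w.
pose n1 w : R := - (r w * d2 w); pose n2 w : R := 2 * s w * d2 w - r w * d3 w.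
have g2s : hessO 1 (fun w => 2 * s w : R^o) := hessO_mul (hessO_cst 2) hessO_hess12.
have gh1 : hessO 1 (h1 : P -> R^o).
  apply: hessO_sub; [apply: hessO_sub|].
  - exact: (hessO_mul g2s (hessO_smooth0 s1)).
  - exact: (hessO_mul hessO_hess11 (hessO_smooth0 sl2)).
  - exact: (hessO_mul hessO_hess22 (hessO_smooth0 s0)).
have gh2 : hessO 1 (h2 : P -> R^o).
  apply: hessO_sub; [apply: hessO_sub|].
  - exact: (hessO_mul g2s (hessO_smooth0 sl2)).
  - exact: (hessO_mul hessO_hess11 (hessO_smooth0 sl3)).
  - exact: (hessO_mul hessO_hess22 (hessO_smooth0 s1)).
have gn1 : hessO 3 (n1 : P -> R^o) by apply: hessO_opp; exact: (hessO_mul hessO_hess11 gd2).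
have gn2 : hessO 3 (n2 : P -> R^o).
  by apply: hessO_sub; [exact: (hessO_mul g2s gd2)|exact: (hessO_mul hessO_hess11 gd3)].
have gn1' : hessO 1 (n1 : P -> R^o) by apply: hessO_opp; exact: (hessO_mul hessO_hess11 (hessO_smooth0 sd2)).
have gn2' : hessO 1 (n2 : P -> R^o).
  by apply: hessO_sub; [exact: (hessO_mul g2s (hessO_smooth0 sd2))|exact: (hessO_mul hessO_hess11 (hessO_smooth0 sd3))].
pose A w : R := f w * (2 * s w * L s w - r w * L t w - t w * L r w).
pose B' w : R := f w * (d2 w * (2 * b w * k1 w + 4 * c w * l2 w + 2 * c w * d2 w - 2 * a w * k0 w)
   + d3 w * (- (2 * b w * k0 w) - 2 * c w * k1 w)).
pose E1 w : R := 2 * (a w * (h1 w * n1 w) + b w * (h1 w * n2 w + h2 w * n1 w) + c w * (h2 w * n2 w)).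
pose E2 w : R := a w * (n1 w * n1 w) + 2 * b w * (n1 w * n2 w) + c w * (n2 w * n2 w).
have gA : hessO 4 (A : P -> R^o).
  apply: (hessO_mul (k := 2) (l := 2)) => //; apply: hessO_sub; [apply: hessO_sub|].
  - exact: (hessO_mul g2s gLs).
  - exact: (hessO_mul hessO_hess11 gLt).
  - exact: (hessO_mul hessO_hess22 gLr).
have gB : hessO 4 (B' : P -> R^o).
  apply: (hessO_mul (k := 2) (l := 2)) => //; apply: hessO_add.
    apply: (hessO_mul (k := 2) (l := 0)) => //; apply: hessO_smooth0.
    exact: (smoothB oU (smoothD oU (smoothD oU (smoothM oU s2b s1) (smoothM oU (smoothM oU (C 4) smooth_coef22) sl2))
      (smoothM oU (smoothM oU (C 2) smooth_coef22) sd2)) (smoothM oU (smoothM oU (C 2) smooth_coef11) s0)).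
  apply: (hessO_mul (k := 2) (l := 0)) => //; apply: hessO_smooth0.
  exact: (smoothB oU (smoothN oU (smoothM oU s2b s0)) (smoothM oU (smoothM oU (C 2) smooth_coef22) s1)).
have gE1 : hessO 4 (E1 : P -> R^o).
  apply: (hessO_mul (k := 0) (l := 4)); first exact: hessO_cst.
  apply: hessO_add; [apply: hessO_add|].
  - exact: (hessO_mul (hessO_smooth0 smooth_coef11) (hessO_mul gh1 gn1)).
  - exact: (hessO_mul (hessO_smooth0 smooth_coef12) (hessO_add (hessO_mul gh1 gn2) (hessO_mul gh2 gn1))).
  - exact: (hessO_mul (hessO_smooth0 smooth_coef22) (hessO_mul gh2 gn2)).
have gE2 : hessO 4 (E2 : P -> R^o).
  apply: hessO_add; [apply: hessO_add|].
  - exact: (hessO_mul (hessO_smooth0 smooth_coef11) (hessO_mul gn1 gn1')).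
  - exact: (hessO_mul (hessO_smooth0 s2b) (hessO_mul gn1 gn2')).
  - exact: (hessO_mul (hessO_smooth0 smooth_coef22) (hessO_mul gn2 gn2')).
apply: (hessO_eq (g := fun w => A w + (B' w - (E1 w + E2 w)) : R^o)); last first.
  by apply: hessO_add => //; apply: hessO_sub => //; exact: hessO_add.
move=> w Uw; have cw := coef22_gt0 Uw; have cn : c w != 0 by rewrite gt_eqF.
have m1 := smoothM oU smooth_hess12 smooth_hess12; have m2 := smoothM oU smooth_hess11 smooth_hess22.
have D1f : D1 f w = 2 * s w * k1 w - r w * (l2 w + d2 w) - t w * k0 w.
  rewrite (D1add Uw m1 (smoothN oU m2)) (D1_opp x y Uw m2) (D1mul Uw smooth_hess12 smooth_hess12) (D1mul Uw smooth_hess11 smooth_hess22).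
  by rewrite /d2 /k1 /k0; ring.
have D2f : D2 f w = 2 * s w * (l2 w + d2 w) - r w * (l3 w + d3 w) - t w * k1 w.
  rewrite (D2add Uw m1 (smoothN oU m2)) (D2_opp x y Uw m2) (D2mul Uw smooth_hess12 smooth_hess12) (D2mul Uw smooth_hess11 smooth_hess22).
  by rewrite (d2_hess12 Uw) (d2_hess11 Uw) /d2 /d3 /k1; ring.
have Lf : L f w = 2 * s w * L s w - r w * L t w - t w * L r w
   + (2 * (a w * (k1 w * k1 w) + 2 * b w * (k1 w * (l2 w + d2 w)) + c w * ((l2 w + d2 w) * (l2 w + d2 w)))
    - 2 * (a w * (k0 w * (l2 w + d2 w)) + b w * (k0 w * (l3 w + d3 w) + k1 w * (l2 w + d2 w)) + c w * (k1 w * (l3 w + d3 w)))).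
  rewrite (Lop_add a b c oU sx sy J0 oU (@subset_refl _ U) Uw m1 (smoothN oU m2)).
  rewrite (Lop_opp a b c oU sx sy J0 oU (@subset_refl _ U) Uw m2) (Lop_mul Uw smooth_hess12 smooth_hess12) (Lop_mul Uw smooth_hess11 smooth_hess22).
  by rewrite (d2_hess12 Uw) (d2_hess11 Uw) /d2 /d3 /k1 /k0; ring.
have Et : t w = - (a w * r w + 2 * b w * s w) / c w.
  have -> : a w * r w + 2 * b w * s w = - (c w * t w) by rewrite -[RHS]add0r -(EL Uw); ring.
  by field.
have := @bochner_alg R (a w) (b w) (c w) (r w) (s w) (k0 w) (k1 w) (d2 w) (d3 w) cn.
rewrite /= -Et -/(l2 w) -/(l3 w) => alg.
rewrite /A /B' /E1 /E2 /h1 /h2 /n1 /n2 -alg Lf /Qf D1f D2f.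
rewrite /hdet; ring.
Qed.

Lemma bochner_near : exists C : R, \forall w \near p0, - C * f w ^+ 2 <= f w * L f w - Q f w.
Proof.
have [C C0 H] := hessO_bochner; exists C; near=> w.
have Uw : U w by near: w; exact: open_nbhs_nbhs.
have : `|f w * L f w - Q f w| <= C * Num.sqrt (f w) ^+ 4 by near: w.
rewrite (exprM _ 2 2) sqr_sqrtr ?hdet_ge0// => /ler_normlP[+ _]; lra.
Unshelve. all: by end_near. Qed.

End Graded.
End Bochner.

(** * Clustering zeros of the Hessian determinant *)
Section ClusteringZeros.
Context {R : realType}.
Notation P := (R * R)%type.
Variables (U : set P) (x y z : P -> R^o) (G : P -> R^o).
Hypotheses (oU : open U) (sx : smooth_on U x) (sy : smooth_on U y) (sz : smooth_on U z).
Hypothesis J0 : forall w, U w -> jacobian2 x y w != 0.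
Hypothesis sG : smooth_on setT G.
Notation a := (coef x y z (px (px G))).
Notation b := (coef x y z (px (py G))).
Notation c := (coef x y z (py (py G))).
Hypothesis a0 : forall w, U w -> 0 < a w.
Hypothesis d0 : forall w, U w -> 0 < a w * c w - b w ^+ 2.
Hypothesis EL : forall w, U w ->
  a w * hess11 x y z w + 2 * b w * hess12 x y z w + c w * hess22 x y z w = 0.

(** The Bochner inequality is the hypothesis of the Jensen-type estimate. *)
Lemma hdet_zero_near p0 : U p0 ->
  (forall e : R, 0 < e -> forall N, exists s : seq P,
     [/\ uniq s, size s = N & forall w, w \in s -> ball p0 e w /\ hdet x y z w = 0]) ->
  \forall w \near p0, hdet x y z w = 0.
Proof.
move=> Up0 acc.
have [C HC] := bochner_near oU sx sy sz J0 sG a0 d0 EL Up0.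
have [e e0 He] : exists2 e : R, 0 < e & ball p0 e `<=` U `&`
   [set w | - C * hdet x y z w ^+ 2 <= hdet x y z w * Lop x y a b c (hdet x y z) w
      - Qf x y a b c (hdet x y z) w].
  have H : nbhs p0 (U `&` [set w | - C * hdet x y z w ^+ 2 <= hdet x y z w * Lop x y a b c (hdet x y z) w
      - Qf x y a b c (hdet x y z) w]).
    apply: filterI => //; exact: open_nbhs_nbhs.
  by move/nbhs_ballP: H => [e e0 He]; exists e.
have oB : open (ball p0 e) by exact: ball_open.
have BU : ball p0 e `<=` U by move=> w /He[].
have sub f : smooth_on U f -> smooth_on (ball p0 e) f by exact: smooth_sub.
apply: (@zero_near_of_infinitely_many_zeros _ (ball p0 e) x y a b c (hdet x y z) oB _ _ _ _ _ _ _ _ _ _ C) => //.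
- exact: sub.
- exact: sub.
- by move=> w /BU; exact: J0.
- apply: sub; exact: (smooth_coef11 oU sx sy sz J0 sG).
- apply: sub; exact: (smooth_coef12 oU sx sy sz J0 sG).
- apply: sub; exact: (smooth_coef22 oU sx sy sz J0 sG).
- by move=> w /BU; exact: a0.
- by move=> w /BU; exact: d0.
- apply: sub; exact: (smooth_hdet oU sx sy sz J0).
- by move=> w /BU Uw; apply: (hdet_ge0 a0 d0 EL Uw).
- by move=> w /He[].
- exact: ballxx.
Qed.

End ClusteringZeros.

(** * Bump functions *)
Section Bump.
Context {R : realType}.
Notation P := (R * R)%type.

(** These functions are closed under differentiation, see [is_derive_flat]; the case [m = 0] is the
    classical smooth function that is flat at the origin. *)
Definition flat (m : nat) (x : R^o) : R^o := if 0 < x then x ^- m * expR (- x^-1) else 0.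

Lemma flat_near0 m (x : R) : 0 < x -> x ^- m * expR (- x^-1) <= m.+2`!%:R * x ^+ 2.
Proof.
move=> x0; have ix : 0 < x^-1 by rewrite invr_gt0.
have F0 : 0 < (m.+2`!%:R : R) by rewrite ltr0n fact_gt0.
have H := expR_ge1Dxn m.+1 (ltW ix).
have H2 : x^-1 ^+ m.+2 / m.+2`!%:R <= expR x^-1 by apply: le_trans H; rewrite lerDr.
rewrite expRN ler_pdivrMr ?expR_gt0// mulrAC.
apply: le_trans (_ : _ <= (m.+2`!%:R * (x^-1 ^+ m.+2 / m.+2`!%:R)) * x ^+ 2) _; last first.
  by rewrite ler_wpM2r ?exprn_ge0 ?(ltW x0)// ler_pM2l.
rewrite [_%:R * _]mulrC divfK ?gt_eqF// -exprVn -addn2 exprD -mulrA -exprMn mulVf ?gt_eqF// expr1n mulr1//.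
Qed.

Lemma is_derive_flat_gt0 m (x : R^o) : 0 < x ->
  is_derive x (1 : R^o) (flat m) (- m%:R * flat m.+1 x + flat m.+2 x).
Proof.
move=> x0.
have di : is_derive x (1 : R^o) (fun x : R^o => x^-1 : R^o) (- (x^-1 * x^-1)).
  have dx : derivable (id : R^o -> R^o) x 1 by exact: derivable_id.
  have n0 : x != 0 by rewrite gt_eqF.
  apply: DeriveDef; first exact: derivableV.
  by rewrite deriveV// derive_id /GRing.scale /= mulr1 expr2 invfM.
have dP : is_derive (x^-1 : R^o) (1 : R^o) (fun y : R^o => y ^+ m * expR (- y) : R^o)
    (m%:R * x^-1 ^+ m.-1 * expR (- x^-1) - x^-1 ^+ m * expR (- x^-1)).
  have dN : is_derive (x^-1 : R^o) (1 : R^o) (fun y : R^o => expR (- y) : R^o) (- expR (- x^-1)).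
    have dn : is_derive (x^-1 : R^o) (1 : R^o) (fun y : R^o => - y : R^o) (- 1).
      exact: (is_deriveN (is_derive_id _ _)).
    apply: (is_derive_eq (is_derive1_comp (is_derive_expR (- x^-1)) dn)).
    by rewrite mulrN1.
  have dX := is_deriveX m (is_derive_id (x^-1 : R^o) (1 : R^o)).
  have := is_deriveM dX dN; rewrite exprfctE => H; apply: (is_derive_eq H).
  rewrite /GRing.scale /= mulr1; ring.
have := @is_derive1_comp R (fun y : R^o => y ^+ m * expR (- y) : R^o) (fun x : R^o => x^-1 : R^o) x _ _ dP di.
move=> [H1 H2].
have E : \forall v \near x, ((fun y : R^o => y ^+ m * expR (- y) : R^o) \o (fun x : R^o => x^-1 : R^o)) v = flat m v.
  apply: (@open_near_eq _ _ _ (@pos R) _ _ x open_pos) => //.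
  by move=> v v0; rewrite /= /flat ifT// exprVn.
apply: DeriveDef; first exact: (near_eq_derivable E H1).
rewrite -(near_eq_derive _ E) H2 /flat x0 -!exprVn.
case: m {dP H1 H2 E} => [|m]; first by rewrite /= !mul0r !expr0; ring.
rewrite /= !exprS; ring.
Qed.

Lemma is_derive_flat_lt0 m (x : R^o) : x < 0 ->
  is_derive x (1 : R^o) (flat m) (- m%:R * flat m.+1 x + flat m.+2 x).
Proof.
move=> x0.
have E : \forall v \near x, (fun=> 0 : R^o) v = flat m v.
  apply: (@open_near_eq _ _ _ [set y : R^o | y < 0] _ _ x (@open_lt R 0)) => //.
  by move=> v v0; rewrite /flat ltNge ltW.
apply: DeriveDef; first exact: (near_eq_derivable E (@derivable_cst _ _ _ _ _ _)).
rewrite -(near_eq_derive _ E) derive_cst /flat ltNge (ltW x0) /=.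
by rewrite mulr0 addr0.
Qed.

Lemma is_derive_flat0 m : is_derive (0 : R^o) (1 : R^o) (flat m) 0.
Proof.
have H : (fun h : R => h^-1 *: (flat m (h *: (1 : R^o) + 0) - flat m 0)) @ (0 : R)^' --> (0 : R^o).
  apply/cvgr0Pnorm_lt => e e0.
  have F0 : 0 < (m.+2`!%:R : R) by rewrite ltr0n fact_gt0.
  near=> h.
  rewrite addr0 /GRing.scale /= mulr1 {2}/flat ltxx subr0 /flat.
  case: (ltP 0 h) => h0; last by rewrite mulr0 normr0.
  rewrite ger0_norm; last first.
    by rewrite !mulr_ge0 ?expR_ge0// invr_ge0 ?exprn_ge0// ltW.
  rewrite mulrC ltr_pdivrMr//; apply: le_lt_trans (flat_near0 m h0) _.
  rewrite expr2 mulrA ltr_pM2r// -ltr_pdivlMl//.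
  rewrite -[h]ger0_norm ?(ltW h0)//; near: h; apply: dnbhs0_lt.
  by rewrite mulr_gt0// invr_gt0.
apply: DeriveDef; first by apply/cvg_ex; exists 0.
by rewrite /derive; apply: cvg_lim.
Unshelve. all: by end_near. Qed.

Lemma is_derive_flat m (x : R^o) :
  is_derive x (1 : R^o) (flat m) (- m%:R * flat m.+1 x + flat m.+2 x).
Proof.
have [x0|x0|->] := ltgtP x 0; first exact: is_derive_flat_lt0.
  exact: is_derive_flat_gt0.
by apply: (is_derive_eq (is_derive_flat0 m)); rewrite /flat ltxx mulr0 addr0.
Qed.

Lemma smooth_flat m : smooth_on setT (flat m).
Proof.
move=> k; elim: k m => [|k IH] m.
  move=> x _; have [dx _] := is_derive_flat m x.
  by apply: differentiable_continuous; exact/derivable1_diffP.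
apply: (@Ck_on_derive1 _ _ _ _ (fun x => - m%:R * flat m.+1 x + flat m.+2 x)).
- exact: openT.
- by move=> x _; exact: is_derive_flat.
- apply: Ck_onD => //; first exact: openT.
  by apply: Ck_onM => //; [exact: openT|exact: Ck_on_cst].
Qed.

Lemma flat_gt0 (x : R) : 0 < x -> 0 < flat 0 x.
Proof. by move=> x0; rewrite /flat x0 expr0 invr1 mul1r expR_gt0. Qed.
Lemma flat_le0 (x : R) : x <= 0 -> flat 0 x = 0.
Proof. by move=> x0; rewrite /flat ltNge x0. Qed.

Definition bump (w0 : P) (e : R) (w : P) : R^o :=
  flat 0 (e ^+ 2 - (w.1 - w0.1) ^+ 2) * flat 0 (e ^+ 2 - (w.2 - w0.2) ^+ 2).

Lemma smooth_bump w0 e : smooth_on setT (bump w0 e).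
Proof.
have sfl (g : P -> R^o) : smooth_on setT g -> smooth_on setT (fun w => flat 0 (g w) : R^o).
  move=> sg; apply: (@smooth_comp _ _ _ _ setT setT g (flat 0)) => //.
  - exact: findim_R.
  - exact: findim_R.
  - exact: openT.
  - exact: openT.
  - exact: smooth_flat.
have sq (g : P -> R^o) (k : R) : smooth_on setT g -> smooth_on setT (fun w => e ^+ 2 - (g w - k) ^+ 2 : R^o).
  move=> sg; apply: smoothB; [exact: openT|exact: smooth_cst|].
  have d : smooth_on setT (fun w => g w - k : R^o) by apply: smoothB; [exact: openT| |exact: smooth_cst].
  exact: (smoothM openT d d).
apply: smoothM; first exact: openT.
  by apply: sfl; apply: (sq fst); exact: smooth_fst.
by apply: sfl; apply: (sq snd); exact: smooth_snd.
Qed.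

Lemma bump_ge0 w0 e w : 0 <= bump w0 e w.
Proof.
have H m x : 0 <= flat m x.
  by rewrite /flat; case: ifP => // x0; rewrite mulr_ge0 ?expR_ge0// invr_ge0 exprn_ge0// ltW.
by apply: mulr_ge0; exact: H.
Qed.

Lemma bump_gt0 w0 e : 0 < e -> 0 < bump w0 e w0.
Proof.
by move=> e0; rewrite /bump !subrr expr0n subr0 mulr_gt0// flat_gt0// exprn_gt0.
Qed.

Lemma bump_out w0 e w : 0 < e -> ~ ball w0 e w -> bump w0 e w = 0.
Proof.
move=> e0 /boxP; rewrite prod_normE /= => H.
have K (s t : R) : e <= `|s - t| -> e ^+ 2 - (t - s) ^+ 2 <= 0.
  by move=> h; rewrite subr_le0 -[(t - s) ^+ 2]real_normK ?num_real// distrC lerXn2r// nnegrE ltW.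
move/negP: H; rewrite -leNgt le_max => /orP[h|h]; rewrite /bump.
  by rewrite [flat 0 _]flat_le0 ?mul0r// K.
by rewrite [X in _ * X]flat_le0 ?mulr0// K.
Qed.

End Bump.

(** * Convexity of the homogeneous extension of the integrand *)
Section Homogeneous.
Context {R : realType}.
Notation V3 := 'rV[R]_3.
Implicit Types (u w y : V3).

Lemma dotC n (u v : 'rV[R]_n) : dot u v = dot v u.
Proof. by apply: eq_bigr => i _; rewrite mulrC. Qed.

Lemma dotDl n (u v w : 'rV[R]_n) : dot (u + v) w = dot u w + dot v w.
Proof. by rewrite /dot -big_split; apply: eq_bigr => i _; rewrite mxE mulrDl. Qed.

Lemma dotZl n a (u w : 'rV[R]_n) : dot (a *: u) w = a * dot u w.
Proof. by rewrite /dot mulr_sumr; apply: eq_bigr => i _; rewrite mxE mulrA. Qed.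

Lemma dotBl n (u v w : 'rV[R]_n) : dot (u - v) w = dot u w - dot v w.
Proof. by rewrite dotDl -scaleN1r dotZl mulN1r. Qed.

Lemma dotZr n a (u w : 'rV[R]_n) : dot w (a *: u) = a * dot w u.
Proof. by rewrite dotC dotZl (dotC w). Qed.

Lemma dot_delta n (u : 'rV[R]_n) i : dot u (delta_mx 0 i) = u 0 i.
Proof.
rewrite /dot (bigD1 i)//= mxE !eqxx mulr1 big1 ?addr0// => j ji.
by rewrite mxE (negPf ji) andbF mulr0.
Qed.

Lemma dot_gt0 n (u : 'rV[R]_n) : u != 0 -> 0 < dot u u.
Proof.
move=> u0; rewrite lt_neqAle eq_sym; apply/andP; split; last first.
  by apply: sumr_ge0 => i _; rewrite -expr2 sqr_ge0.
apply: contra u0 => /eqP H; apply/eqP/rowP => i; rewrite mxE; apply/eqP.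
rewrite -sqrf_eq0 expr2; apply/eqP.
move: H; rewrite /dot => /psumr_eq0P -> // j _; by rewrite -expr2 sqr_ge0.
Qed.

Lemma enorm_gt0 n (u : 'rV[R]_n) : u != 0 -> 0 < enorm u.
Proof. by move=> u0; rewrite /enorm sqrtr_gt0 dot_gt0. Qed.

Lemma enormZ n a (u : 'rV[R]_n) : 0 < a -> enorm (a *: u) = a * enorm u.
Proof.
move=> a0; rewrite /enorm dotZl dotZr mulrA -expr2 sqrtrM ?sqr_ge0//.
by rewrite sqrtr_sqr ger0_norm// ltW.
Qed.

Definition nz3 : set V3 := [set x | x != 0].

Lemma open_nz3 : open nz3.
Proof.
rewrite (_ : nz3 = ~` [set 0]); last by apply/seteqP; split=> v /= /eqP.
by apply: closed_openC; apply: accessible_closed_set1; exact: hausdorff_accessible (@norm_hausdorff _ _).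
Qed.

Lemma smooth_dot (V : normedModType R) (U : set V) (f g : V -> V3) : open U ->
  smooth_on U f -> smooth_on U g -> smooth_on U ((fun v => dot (f v) (g v)) : V -> R^o).
Proof.
move=> oU sf sg; apply: (smooth_sum (f := fun i v => f v 0 i * g v 0 i : R^o)) => // i.
by apply: smoothM => //; exact: smooth_coord.
Qed.

Lemma smooth_enorm (V : normedModType R) (U : set V) (f : V -> V3) : open U ->
  smooth_on U f -> (forall v, U v -> f v != 0) -> smooth_on U ((fun v => enorm (f v)) : V -> R^o).
Proof.
move=> oU sf f0; apply: smooth_sqrt => // [v Uv|]; first exact/dot_gt0/f0.
exact: smooth_dot.
Qed.

Lemma derive_dot (V : normedModType R) (f : V -> V3) (u : V3) (x v : V) : differentiable f x ->
  'D_v ((fun z => dot (f z) u) : V -> R^o) x = dot ('D_v f x) u.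
Proof.
pose h (y : V3) : R^o := dot y u.
have lin : linear h.
  by move=> a p q; rewrite /h dotDl dotZl.
pose l : {linear V3 -> R^o} := HB.pack h (GRing.isLinear.Build _ _ _ _ _ lin).
have cl : continuous l.
  by move=> y; apply: (smooth_continuous (U := setT)) => //; apply: smooth_dot; [exact: openT|exact: smooth_id|exact: smooth_cst].
by move=> df; exact: (derive_lin v cl df).
Qed.

Lemma derive_hom (W : normedModType R) (f : V3 -> W) (e c : R) w y : e != 0 ->
  y != 0 -> (forall z, z != 0 -> f (e *: z) = c *: f z) ->
  differentiable f (e *: y) -> differentiable f y ->
  e *: 'D_w f (e *: y) = c *: 'D_w f y.
Proof.
move=> e0 y0 hf d1 d2.
have E : 'D_w (fun z => f (e *: z)) y = 'D_w (fun z => c *: f z) y.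
  by apply: (derive_eq_open w open_nz3) => // z; exact: hf.
have ds : differentiable (fun z : V3 => e *: z) y by exact: differentiableZ.
have := derive_comp w ds d1; rewrite E => E2.
have dc := diff_derivable (v := w) d2.
rewrite -(deriveZ c dc).
rewrite -deriveZv//; rewrite -[LHS]/('D_(e *: w) f (e *: y)).
rewrite [RHS]E2; congr ('D_ _ f _).
by rewrite (deriveZ e (@derivable_id _ _ _ _)) derive_id.
Qed.

End Homogeneous.

Section Integrand.
Context {R : realType}.
Notation V3 := 'rV[R]_3.
Implicit Types (u w y : V3).
Variable gamma : V3 -> R.
Hypothesis gamma_smooth : sphere_smooth gamma.
Hypothesis gamma_convex : convex_integrand gamma.

Notation g0 := (radial gamma : V3 -> R^o).

(** The positively 1-homogeneous extension of the integrand. *)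
Definition hom_ext (y : V3) : R^o := enorm y * g0 y.

Lemma smooth_norm : smooth_on (@nz3 R) (fun y => enorm y : R^o).
Proof. by apply: smooth_enorm => //; [exact: open_nz3|exact: smooth_id]. Qed.

Lemma smooth_hom_ext : smooth_on (@nz3 R) hom_ext.
Proof. exact: (smoothM open_nz3 smooth_norm gamma_smooth). Qed.

Lemma radialZ (T : Type) (f : V3 -> T) e y : 0 < e -> radial f (e *: y) = radial f y.
Proof.
move=> e0; rewrite /radial enormZ// scalerA invfM mulrAC mulVf ?gt_eqF// mul1r//.
Qed.

Lemma hom_extZ e y : 0 < e -> hom_ext (e *: y) = e * hom_ext y.
Proof. by move=> e0; rewrite /hom_ext radialZ// enormZ// mulrA. Qed.

Lemma scale_nz e y : 0 < e -> y != 0 -> e *: y != 0.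
Proof. by move=> e0 y0; rewrite scaler_eq0 gt_eqF. Qed.

Lemma derive_hom_extZ e u y : 0 < e -> y != 0 -> 'D_u hom_ext (e *: y) = 'D_u hom_ext y.
Proof.
move=> e0 y0; have ey := scale_nz e0 y0.
have := derive_hom (f := hom_ext) (c := e) u (lt0r_neq0 e0) y0
  (fun z _ => hom_extZ z e0) (smooth_differentiable smooth_hom_ext ey)
  (smooth_differentiable smooth_hom_ext y0).
by move/scalerI => -> //; exact: lt0r_neq0.
Qed.

Lemma derive_radialZ e u y : 0 < e -> y != 0 -> e * 'D_u g0 (e *: y) = 'D_u g0 y.
Proof.
move=> e0 y0; have ey := scale_nz e0 y0.
have H z : z != 0 -> g0 (e *: z) = 1 *: g0 z by move=> _; rewrite radialZ// scale1r.
have := derive_hom (f := g0) u (lt0r_neq0 e0) y0 H (smooth_differentiable gamma_smooth ey)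
  (smooth_differentiable gamma_smooth y0).
by rewrite scale1r.
Qed.

(** Such a function is constant along the ray through [y]. *)
Lemma derive_radial_dir (f : V3 -> R^o) y : y != 0 ->
  (forall e z, 0 < e -> z != 0 -> f (e *: z) = f z) -> differentiable f y -> 'D_y f y = 0.
Proof.
move=> y0 hf df.
have df0 : differentiable f (y + (0 : R) *: y) by rewrite scale0r addr0.
have H := is_derive_seg df0; move: H; rewrite scale0r addr0 => -[_ <-].
have E : \forall t \near (0 : R^o), (fun s : R^o => f (y + s *: y)) t = (fun=> f y) t.
  near=> t; have t0 : 0 < 1 + t by rewrite -ltrBlDl sub0r; near: t; apply: lt_nbhsr; exact: ltrN10.
  have E : y + t *: y = (1 + t) *: y by rewrite scalerDl scale1r.
  by change (f (y + t *: y) = f y); rewrite E hf.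
by rewrite (near_eq_derive _ E) derive_cst.
Unshelve. all: by end_near. Qed.

Lemma derive_norm u y : y != 0 -> 'D_u (fun z : V3 => enorm z : R^o) y = dot u y / enorm y.
Proof.
move=> y0.
have e0 := enorm_gt0 y0.
have dn := smooth_differentiable smooth_norm y0.
have dd : differentiable (fun z : V3 => dot z z : R^o) y.
  by apply: (smooth_differentiable (U := setT)) => //; apply: smooth_dot; [exact: openT|exact: smooth_id|exact: smooth_id].
have E : 'D_u (fun z : V3 => enorm z * enorm z : R^o) y = 'D_u (fun z : V3 => dot z z : R^o) y.
  apply: (derive_eq_open u open_nz3) => // z z0; rewrite /enorm -expr2 sqr_sqrtr//.
  exact: (ltW (dot_gt0 z0)).
rewrite (derive_mul u dn dn) in E.
have E2 : 'D_u (fun z : V3 => dot z z : R^o) y = 2 * dot u y.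
  have sc (i : 'I_3) : differentiable ((fun z : V3 => z 0 i) : V3 -> R^o) y.
    apply: (smooth_differentiable (U := setT)) => //.
    by apply: (smooth_coord (f := id)); [exact: openT|exact: smooth_id].
  have si (i : 'I_3) : 'D_u ((fun z : V3 => z 0 i * z 0 i) : V3 -> R^o) y = 2 * (u 0 i * y 0 i).
    rewrite (derive_mul u (sc i) (sc i)).
    have di : differentiable (id : V3 -> V3) y by [].
    have := derive_coord i u di; rewrite derive_id => <-; ring.
  have -> : (fun z : V3 => dot z z : R^o) = \sum_(i < 3) (fun z : V3 => z 0 i * z 0 i : R^o).
    by apply/funext => z; rewrite fct_sumE.
  rewrite derive_sum; last first.
    move=> i; apply: diff_derivable; exact: differentiableM.
  rewrite /dot mulr_sumr; apply: eq_bigr => i _; exact: si.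
rewrite E2 in E.
have sol (D e t : R) : 0 < e -> e * D + e * D = 2 * t -> D = t / e.
  move=> ep H; apply: (mulIf (lt0r_neq0 ep)); rewrite divfK ?gt_eqF//; lra.
exact: sol e0 E.
Qed.

Lemma smooth_Dg0 u : smooth_on (@nz3 R) (fun y => 'D_u g0 y).
Proof. by apply: smooth_derive; exact: gamma_smooth. Qed.

Lemma derive_hom_ext u y : y != 0 -> 'D_u hom_ext y = enorm y * 'D_u g0 y + g0 y * (dot u y / enorm y).
Proof.
move=> y0; have d1 := smooth_differentiable smooth_norm y0.
have d2 := smooth_differentiable gamma_smooth y0.
by rewrite (derive_mul u d1 d2) (derive_norm u y0).
Qed.

Lemma sphere_neq0 y : sphere y -> y != 0.
Proof.
move=> sy; apply/eqP => y0; move: sy; rewrite y0 /sphere /= /enorm /dot big1 ?sqrtr0.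
  by move/eqP; rewrite eq_sym oner_eq0.
by move=> i _; rewrite mxE mul0r.
Qed.

Lemma hess_hom_ext_tangent u y : sphere y -> dot u y = 0 ->
  'D_u (fun z => 'D_u hom_ext z) y = 'D_u (fun z => 'D_u g0 z) y + gamma y * dot u u.
Proof.
move=> sy uy; have y0 := sphere_neq0 sy; have ey : enorm y = 1 by [].
have sd : smooth_on (@nz3 R) (fun z => dot z u : R^o).
  by apply: smooth_dot; [exact: open_nz3|exact: smooth_id|exact: smooth_cst].
have sV : smooth_on (@nz3 R) (fun z => (enorm z)^-1 : R^o).
  by apply: (smoothV open_nz3 _ smooth_norm) => z z0; exact: (lt0r_neq0 (enorm_gt0 z0)).
have sq : smooth_on (@nz3 R) (fun z => dot z u * (enorm z)^-1 : R^o) := smoothM open_nz3 sd sV.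
have D1 := smooth_differentiable smooth_norm y0; have D2 := smooth_differentiable gamma_smooth y0.
have D3 := smooth_differentiable (smooth_Dg0 u) y0; have D4 := smooth_differentiable sq y0.
have D5 := smooth_differentiable sd y0; have D6 := smooth_differentiable sV y0.
have D13 := smooth_differentiable (smoothM open_nz3 smooth_norm (smooth_Dg0 u)) y0.
have D24 := smooth_differentiable (smoothM open_nz3 gamma_smooth sq) y0.
rewrite (derive_eq_open (g := fun z => enorm z * 'D_u g0 z + g0 z * (dot z u * (enorm z)^-1)) u open_nz3 y0); last first.
  by move=> z z0; rewrite (derive_hom_ext u z0) dotC.
rewrite (derive_add u D13 D24) (derive_mul u D1 D3) (derive_mul u D2 D4) (derive_mul u D5 D6).
have Did : differentiable (id : V3 -> V3) y by [].
have -> : 'D_u (fun z => dot z u : R^o) y = dot u u by rewrite (derive_dot u u Did) derive_id.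
rewrite (derive_norm u y0) uy dotC uy ey /radial ey invr1 scale1r.
by rewrite !mul0r !mulr0 !addr0 add0r !mul1r.
Qed.

(** The 0-homogeneous extension of [sphere_grad gamma] is [enorm y] times the Euclidean gradient of that
    of [gamma], as this gradient is homogeneous of degree -1 and has no radial component. *)
Lemma dot_radial_grad u y : y != 0 -> dot (radial (sphere_grad gamma) y) u = enorm y * 'D_u g0 y.
Proof.
move=> y0; have e0 := enorm_gt0 y0; have i0 : 0 < (enorm y)^-1 by rewrite invr_gt0.
pose x := (enorm y)^-1 *: y.
have x0 : x != 0 by exact: scale_nz.
have Dx := smooth_differentiable gamma_smooth x0.
have gd w : dot (\row_i 'D_(delta_mx 0 i) g0 x) w = 'D_w g0 x.
  have -> : 'D_w g0 x = 'd g0 x (\sum_(i < 3) w 0 i *: delta_mx 0 i).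
    by rewrite derive_diff// {1}(matrix_sum_delta w) big_ord1.
  rewrite linear_sum /dot.
  by apply: eq_bigr => i _; rewrite linearZ mxE -(derive_diff (delta_mx 0 i) Dx) mulrC.
have r0 : 'D_x g0 x = 0.
  by apply: derive_radial_dir => // e z ep _; exact: radialZ.
rewrite {1}/radial -/x /sphere_grad /tangent_proj dotBl dotZl !gd r0 mul0r subr0.
have := derive_radialZ u i0 y0; rewrite -/x => <-.
by rewrite mulrA divff ?mul1r// gt_eqF.
Qed.

Lemma smooth_radial_grad : smooth_on (@nz3 R) (radial (sphere_grad gamma)).
Proof.
apply: (smooth_row open_nz3) => i.
apply: (@smooth_eq _ _ _ _ (fun y => enorm y * 'D_(delta_mx 0 i) g0 y : R^o) _ open_nz3).
  by move=> y y0; rewrite -(dot_radial_grad (delta_mx 0 i) y0) dot_delta.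
exact: (smoothM open_nz3 smooth_norm (smooth_Dg0 _)).
Qed.

(** On tangent vectors at a unit vector, the covariant Hessian plus [gamma] times the identity is the
    Euclidean Hessian of the 1-homogeneous extension. *)
Lemma dot_A_gamma u y : sphere y -> dot u y = 0 ->
  dot (A_gamma gamma y u) u = 'D_u (fun z => 'D_u hom_ext z) y.
Proof.
move=> sy uy; have y0 := sphere_neq0 sy; have ey : enorm y = 1 by [].
rewrite (hess_hom_ext_tangent sy uy) /A_gamma dotDl dotZl; congr (_ + _).
have Dg := smooth_differentiable smooth_radial_grad y0.
rewrite /sphere_hessian /tangent_proj dotBl dotZl (dotC y u) uy mulr0 subr0.
rewrite -(derive_dot u u Dg).
rewrite (derive_eq_open (g := fun z => enorm z * 'D_u g0 z) u open_nz3 y0); last first.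
  by move=> z z0; exact: dot_radial_grad.
have D1 := smooth_differentiable smooth_norm y0; have D3 := smooth_differentiable (smooth_Dg0 u) y0.
by rewrite (derive_mul u D1 D3) (derive_norm u y0) uy mul0r mulr0 addr0 ey mul1r.
Qed.

(** Since [hom_ext] is 1-homogeneous, its Hessian at [y] kills [y] and scales like the inverse of the
    norm; so the Hessian is determined by its tangential part at unit vectors. *)
Lemma hess_hom_ext_gt0 u y : y != 0 -> (forall a : R, u != a *: y) ->
  0 < 'D_u (fun z => 'D_u hom_ext z) y.
Proof.
move=> y0 uy.
pose a : R := dot u y / dot y y; pose t := u - a *: y.
have ut : u = t + a *: y by rewrite subrK.
have tn : t != 0 by rewrite subr_eq0.
have ty : dot t y = 0.
  by rewrite dotBl dotZl /a divfK ?subrr// gt_eqF// dot_gt0.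
have e0 := enorm_gt0 y0; pose x := (enorm y)^-1 *: y.
have i0 : 0 < (enorm y)^-1 by rewrite invr_gt0.
have sx : sphere x by rewrite /sphere /= /x enormZ// mulVf// gt_eqF.
have x0 := sphere_neq0 sx.
have tx : dot t x = 0 by rewrite /x dotZr ty mulr0.
have sD w : smooth_on (@nz3 R) (fun z => 'D_w hom_ext z) by apply: smooth_derive; exact: smooth_hom_ext.
have dD w := smooth_differentiable (sD w) y0.
have rad w : 'D_y (fun z => 'D_w hom_ext z) y = 0.
  by apply: derive_radial_dir => // e z ep z0; exact: derive_hom_extZ.
have rad2 w : 'D_w (fun z => 'D_y hom_ext z) y = 0.
  by rewrite (schwarz y w open_nz3 smooth_hom_ext y0).
have E : 'D_u (fun z => 'D_u hom_ext z) y = 'D_t (fun z => 'D_t hom_ext z) y.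
  have split_ z : z != 0 -> 'D_u hom_ext z = 'D_t hom_ext z + a * 'D_y hom_ext z.
    move=> z0; have dz := smooth_differentiable smooth_hom_ext z0.
    by rewrite {1}ut (deriveDv t (a *: y) dz) (deriveZv a y dz).
  have sc := smooth_cst (@nz3 R) (a : R^o).
  have ca := smooth_differentiable sc y0.
  have day := smooth_differentiable (smoothM open_nz3 sc (sD y)) y0.
  rewrite (derive_eq_open (g := fun z => 'D_t hom_ext z + a * 'D_y hom_ext z) u open_nz3 y0) //.
  rewrite (derive_add u (dD t) day) (derive_mul u ca (dD y)) rad2 derive_cst !mulr0 !addr0.
  by rewrite {1}ut (deriveDv t (a *: y) (dD t)) (deriveZv a y (dD t)) rad scaler0 addr0.
rewrite E.
have := gamma_convex sx tx tn; rewrite (dot_A_gamma sx tx) => H.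
have := derive_hom (f := fun z => 'D_t hom_ext z) (e := (enorm y)^-1) (c := 1) t (lt0r_neq0 i0) y0 _
  (smooth_differentiable (sD t) x0) (dD t).
rewrite scale1r => <-; first exact: (mulr_gt0 i0 H).
by move=> z z0; rewrite scale1r; exact: derive_hom_extZ.
Qed.

End Integrand.

(** * The integrand for graphs *)
Section GraphIntegrand.
Context {R : realType}.
Notation V3 := 'rV[R]_3.
Notation P := (R * R)%type.
Variable gamma : V3 -> R.
Hypothesis gamma_smooth : sphere_smooth gamma.
Hypothesis gamma_convex : convex_integrand gamma.
Variables (i j k : 'I_3) (eps : R).
Hypotheses (ij : i != j) (ik : i != k) (jk : j != k) (eps0 : eps != 0).

Notation dl l := (delta_mx 0 l : V3).

(** A normal of a graph over the (i, j)-plane with slopes [w], on the side given by [eps]. Its norm is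
    the area density of the graph, so that its image under the 1-homogeneous extension is the density
    of the anisotropic energy. *)
Definition graph_normal (w : P) : V3 :=
  eps *: (dl k - w.1 *: dl i - w.2 *: dl j).
Definition graph_normal0 (v : P) : V3 :=
  eps *: (- v.1 *: dl i - v.2 *: dl j).
Definition graph_integrand (w : P) : R^o := hom_ext gamma (graph_normal w).

Lemma graph_normalE w : [/\ graph_normal w 0 i = - eps * w.1,
  graph_normal w 0 j = - eps * w.2 & graph_normal w 0 k = eps].
Proof.
rewrite !mxE !eqxx /=. rewrite (negPf ij) (negPf ik) (negPf jk).
rewrite [j == i]eq_sym [k == i]eq_sym [k == j]eq_sym (negPf ij) (negPf ik) (negPf jk) /=; split; ring.
Qed.

Lemma graph_normal0E v : [/\ graph_normal0 v 0 i = - eps * v.1,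
  graph_normal0 v 0 j = - eps * v.2 & graph_normal0 v 0 k = 0].
Proof.
rewrite !mxE !eqxx /= (negPf ij).
rewrite [j == i]eq_sym [k == i]eq_sym [k == j]eq_sym (negPf ij) (negPf ik) (negPf jk) /=; split; ring.
Qed.

Lemma graph_normal_neq0 w : graph_normal w != 0.
Proof.
have [_ _ H] := graph_normalE w; apply: contra eps0 => /eqP E.
by move: H; rewrite E mxE => <-.
Qed.

Lemma smooth_graph_normal : smooth_on setT graph_normal.
Proof.
apply: smoothZ; first exact: openT.
apply: smoothB; first exact: openT.
  apply: smoothB; [exact: openT|exact: smooth_cst|].
  by apply: (smoothZl (f := fun w : P => w.1 : R^o)); [exact: openT|exact: smooth_fst].
by apply: (smoothZl (f := fun w : P => w.2 : R^o)); [exact: openT|exact: smooth_snd].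
Qed.

Lemma derive_graph_normal w v : 'D_v graph_normal w = graph_normal0 v.
Proof.
pose l (v : P) : V3 := graph_normal0 v.
have H (h : R) : h != 0 -> h^-1 *: (graph_normal (h *: v + w) - graph_normal w) = graph_normal0 v.
  move=> h0; rewrite /graph_normal -scalerBr scalerA mulrC -scalerA; congr (_ *: _).
  apply/rowP => m; rewrite !mxE /=.
  move: (dl i 0 m) (dl j 0 m) (dl k 0 m); case: v w => v1 v2 [w1 w2] /=.
  rewrite /GRing.scale /= => a b c; by field.
rewrite /derive; apply: cvg_lim => //.
apply: cvg_near_cst.
near=> h; apply: H; near: h; exact: nbhs_dnbhs_neq.
Unshelve. all: by end_near. Qed.

Lemma smooth_graph_comp (H : V3 -> R^o) : smooth_on (@nz3 R) H ->
  smooth_on setT (fun w => H (graph_normal w)).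
Proof.
apply: (@smooth_comp _ _ _ _ setT (@nz3 R) graph_normal H).
- exact: findim_rV.
- exact: findim_R.
- exact: openT.
- exact: open_nz3.
- by move=> w _; exact: graph_normal_neq0.
- exact: smooth_graph_normal.
Qed.

Lemma smooth_graph_integrand : smooth_on setT graph_integrand.
Proof. exact: (smooth_graph_comp (smooth_hom_ext gamma_smooth)). Qed.

Lemma derive_graph_comp (H : V3 -> R^o) w v : smooth_on (@nz3 R) H ->
  'D_v (fun w => H (graph_normal w)) w = 'D_(graph_normal0 v) H (graph_normal w).
Proof.
move=> sH; have d1 : differentiable graph_normal w.
  exact: (smooth_differentiable (U := setT) smooth_graph_normal).
have d2 := smooth_differentiable sH (graph_normal_neq0 w).
by rewrite (derive_comp v d1 d2) derive_graph_normal.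
Qed.

(** The direction in which the normal varies is horizontal, hence never parallel to the normal, whose
    vertical component is [eps]. *)
Lemma graph_integrand_convex w v : v != 0 ->
  0 < 'D_v (fun w => 'D_v graph_integrand w) w.
Proof.
move=> v0; set w0 := w.
have ind (a : R) : graph_normal0 v != a *: graph_normal w0.
  have [H1 H2 H3] := graph_normal0E v; have [K1 K2 K3] := graph_normalE w0.
  apply/eqP => E; move: v0; have E' m := congr1 (fun z : V3 => z 0 m) E.
  have a0 : a = 0.
    move: (E' k); rewrite H3 mxE K3 => /esym/eqP; rewrite mulf_eq0 (negPf eps0) orbF => /eqP//.
  have z0 (t : R) : - eps * t = 0 -> t = 0.
    by move/eqP; rewrite mulf_eq0 oppr_eq0 (negPf eps0) => /eqP.
  have v1 : v.1 = 0 by apply: z0; rewrite -H1 E' mxE a0 mul0r.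
  have v2 : v.2 = 0 by apply: z0; rewrite -H2 E' mxE a0 mul0r.
  by move=> /eqP; apply; apply: injective_projections.
have sG := smooth_hom_ext gamma_smooth.
have -> : (fun w => 'D_v graph_integrand w) =
    (fun w => (fun y => 'D_(graph_normal0 v) (hom_ext gamma) y) (graph_normal w)).
  by apply/funext => z; exact: (derive_graph_comp z v sG).
have sD : smooth_on (@nz3 R) (fun y => 'D_(graph_normal0 v) (hom_ext gamma) y).
  exact: smooth_derive.
rewrite (derive_graph_comp w0 v sD).
exact: (hess_hom_ext_gt0 gamma_smooth gamma_convex (graph_normal_neq0 w0) ind).
Qed.

Notation G := graph_integrand.

Lemma derive2_xy w (v : P) : 'D_v (fun w => 'D_v G w) w =
  v.1 ^+ 2 * px (px G) w + 2 * (v.1 * v.2) * px (py G) w + v.2 ^+ 2 * py (py G) w.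
Proof.
have sG := smooth_graph_integrand.
have s1 := smooth_px sG; have s2 := smooth_py sG.
have dG z : differentiable G z by exact: (smooth_differentiable sG).
have d1 : differentiable (px G) w by exact: (smooth_differentiable s1).
have d2 : differentiable (py G) w by exact: (smooth_differentiable s2).
have c1 := smooth_cst [set: P] (v.1 : R^o); have c2 := smooth_cst [set: P] (v.2 : R^o).
have -> : (fun w => 'D_v G w) = (fun w => v.1 * px G w + v.2 * py G w).
  by apply/funext => z; rewrite (derive_xy v (dG z)) pxEd pyEd.
have dc1 : differentiable (fun _ : P => v.1 : R^o) w by exact: (smooth_differentiable c1).
have dc2 : differentiable (fun _ : P => v.2 : R^o) w by exact: (smooth_differentiable c2).
have dm1 : differentiable (fun w => v.1 * px G w : R^o) w by exact: (smooth_differentiable (smoothM openT c1 s1)).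
have dm2 : differentiable (fun w => v.2 * py G w : R^o) w by exact: (smooth_differentiable (smoothM openT c2 s2)).
rewrite (derive_add v dm1 dm2) (derive_mul v dc1 d1) (derive_mul v dc2 d2) !derive_cst !mulr0 !addr0.
rewrite (derive_xy v d1) (derive_xy v d2) -!pxEd -!pyEd (pyx openT sG) // /GRing.scale /=.
ring.
Qed.

Lemma graph_integrand_hess w : 0 < px (px G) w /\
  0 < px (px G) w * py (py G) w - px (py G) w ^+ 2.
Proof.
have H v : v != 0 -> _ := fun v0 => graph_integrand_convex w v0.
have P1 : 0 < px (px G) w.
  have v0 : ((1, 0) : P) != 0.
    by apply/eqP => -[/eqP]; rewrite oner_eq0.
  by have := H _ v0; rewrite derive2_xy /= expr1n mul1r mulr0 mulr0 mul0r expr0n mul0r !addr0.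
split=> //.
have v0 : ((- px (py G) w, px (px G) w) : P) != 0.
  by apply/eqP => -[_ /eqP]; rewrite gt_eqF.
have := H _ v0; rewrite derive2_xy /= => K; rewrite -(pmulr_rgt0 _ P1).
by apply: lt_le_trans K _; rewrite le_eqVlt; apply/orP; left; apply/eqP; ring.
Qed.

(** A convex function lies above its tangent planes. *)
Lemma graph_integrand_tangent w (v : P) :
  G w + (v.1 * px G w + v.2 * py G w) <= G (w + v).
Proof.
have sG := smooth_graph_integrand.
have dG z : differentiable G z by exact: (smooth_differentiable sG).
have sD : smooth_on setT (fun z => 'D_v G z) by exact: smooth_derive.
have dD z : differentiable (fun z => 'D_v G z) z by exact: (smooth_differentiable sD).
have [s /andP[s0 s1] E] := mvt_seg (f := G) (z := w) (v := v) (fun t _ => dG _).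
have [t _ E2] := mvt_seg (f := fun z => 'D_v G z) (z := w) (v := s *: v) (fun t _ => dD _).
have nn z : 0 <= 'D_v (fun z => 'D_v G z) z.
  have [v0|v0] := eqVneq v 0; last exact: (ltW (graph_integrand_convex z v0)).
  by rewrite derive2_xy v0 /= expr0n !mul0r mulr0 mul0r !addr0.
rewrite (deriveZv s v (dD _)) in E2.
have dv : 'D_v G w = v.1 * px G w + v.2 * py G w by rewrite (derive_xy v (dG w)) pxEd pyEd.
rewrite -dv -lerBrDl E -subr_ge0 E2; exact: (mulr_ge0 (ltW s0) (nn _)).
Qed.

End GraphIntegrand.

(** * Integrals over boxes *)
Section BoxIntegral.
Context {R : realType}.
Notation P := (R * R)%type.
Notation leb := (@lebesgue_measure R).
Notation leb2 := ((@lebesgue_measure R) \x (@lebesgue_measure R))%E.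

Definition rat_box (a b c d : rat) : set P :=
  `]ratr a, ratr b[%classic `*` `]ratr c, ratr d[%classic.

(** Boxes with rational corners form a countable base of the topology. *)
Lemma open_measurable2 (A : set P) : open A -> measurable A.
Proof.
move=> oA.
have -> : A = \bigcup_a \bigcup_b \bigcup_c \bigcup_d
   (if `[< rat_box a b c d `<=` A >] then rat_box a b c d else set0).
  apply/seteqP; split=> [w Aw|w [a _ [b _ [c _ [d _]]]]]; last first.
    by case: asboolP => // sub; exact: sub.
  have /nbhs_ballP[e /= e0 He] : nbhs w A by exact: open_nbhs_nbhs.
  have L (t : R) : t - e < t by rewrite ltrBlDr ltrDl.
  have G (t : R) : t < t + e by rewrite ltrDl.
  have [a] := rat_in_itvoo (L w.1); have [b] := rat_in_itvoo (G w.1).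
  have [c] := rat_in_itvoo (L w.2); have [d] := rat_in_itvoo (G w.2).
  rewrite !in_itv /= => /andP[d1 d2] /andP[c1 c2] /andP[b1 b2] /andP[a1 a2].
  exists a => //; exists b => //; exists c => //; exists d => //.
  case: asboolP => [_|[]]; first by split; rewrite /= in_itv /=; apply/andP.
  move=> v [] /=; rewrite !in_itv /= => /andP[v1 v2] /andP[v3 v4].
  by apply: He; split; rewrite /ball /= ltr_distlC; apply/andP; lra.
do 4 (apply: bigcupT_measurable_rat => ?).
by case: ifP => // _; apply: measurableX; exact: measurable_itv.
Qed.

Lemma boxE (w0 : P) e : box w0 e =
  `[w0.1 - e, w0.1 + e]%classic `*` `[w0.2 - e, w0.2 + e]%classic.
Proof.
apply/seteqP; split=> v; rewrite /box /= prod_normE ge_max /= !in_itv /= !ler_distlC.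
  by move=> /andP[-> ->].
by move=> [-> ->].
Qed.

Lemma measurable_box w0 e : measurable (box w0 e : set P).
Proof. by rewrite boxE; apply: measurableX; exact: measurable_itv. Qed.

Lemma box_measure (w0 : P) (e : R) : 0 < e -> leb2 (box w0 e) = ((2 * e) * (2 * e))%:E.
Proof.
move=> e0; rewrite boxE product_measure1E; try exact: measurable_itv.
have H (t : R) : leb `[t - e, t + e] = (2 * e)%:E.
  rewrite lebesgue_measure_itv /= lte_fin ifT; last lra.
  by rewrite -EFinB; congr EFin; ring.
by rewrite EFinM; congr (_ * _)%E; exact: H.
Qed.

Lemma box_measure_fin (w0 : P) (e : R) : 0 < e -> (leb2 (box w0 e) < +oo)%E.
Proof. by move=> e0; rewrite box_measure// ltry. Qed.

Lemma continuous_measurable2 (U : set P) (f : P -> R) : open U ->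
  (forall w, U w -> {for w, continuous f}) -> measurable_fun U f.
Proof.
move=> oU cf; apply: (measurability _ (RGenOpens.measurableE R)).
move=> _ [_ [a [b ->] <-]]; apply: open_measurable2.
rewrite openE => w [Uw fw]; apply: filterI; first exact: open_nbhs_nbhs.
by apply: (cf w Uw); apply: open_nbhs_nbhs; split => //; exact: interval_open.
Qed.

Lemma continuous_integrable2 (U : set P) (f : P -> R) w0 e : open U -> 0 < e ->
  box w0 e `<=` U -> (forall w, U w -> {for w, continuous f}) ->
  leb2.-integrable (box w0 e) (EFin \o f).
Proof.
move=> oU e0 BU cf; apply: measurable_bounded_integrable.
- exact: measurable_box.
- exact: box_measure_fin.
- apply: (measurable_funS _ BU (continuous_measurable2 oU cf)); exact: open_measurable2.
- have cB : compact (f @` box w0 e).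
    apply: continuous_compact; last exact: compact_box.
    apply/subspace_continuousP => w Bw.
    by apply: cvg_within_filter; apply: cf; exact: BU.
  have [M [Mr HM]] := compact_bounded cB; exists M; split => // t Mt w Bw.
  by apply: (HM t Mt); exists w.
Qed.

Lemma integral_box_gt0 (U : set P) (f : P -> R) w0 e : open U -> 0 < e ->
  box w0 e `<=` U -> (forall w, U w -> {for w, continuous f}) ->
  (forall w, box w0 e w -> 0 <= f w) -> 0 < f w0 -> 0 < Rintegral leb2 (box w0 e) f.
Proof.
move=> oU e0 BU cf f0 fw0.
have Bw0 : box w0 e w0 by rewrite /box /= subrr normr0 ltW.
have /nbhs_ballP[r /= r0 Hr] : nbhs w0 [set w | f w0 / 2 < f w].
  have H : f w0 / 2 < f w0 by rewrite ltr_pdivrMr// ltr_pMr// ltr1n.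
  exact: (cf _ (BU _ Bw0) _ (lt_nbhsr H)).
pose m := Num.min (r / 2) e.
have m0 : 0 < m by rewrite lt_min e0 divr_gt0.
have mr : m < r by rewrite gt_min ltr_pdivrMr// ltr_pMr// ltr1n.
have me : m <= e by rewrite ge_min lexx orbT.
have sub : box w0 m `<=` box w0 e by move=> w /= H; apply: le_trans H _.
have mB := measurable_box w0 m; have mE := measurable_box w0 e.
have bd := box_measure_fin w0 e0.
pose g : P -> R := (cst (f w0 / 2) : P -> R) \_ (box w0 m).
have ig : leb2.-integrable (box w0 e) (EFin \o g).
  have -> : EFin \o g = (EFin \o cst (f w0 / 2)) \_ (box w0 m) by rewrite restrict_EFin.
  apply/integrable_restrict => //; rewrite setIidr//.
  exact: (continuous_integrable2 openT m0 (@subsetT _ _) (fun w _ => @cst_continuous _ _ _ w)).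
have H : Rintegral leb2 (box w0 e) g <= Rintegral leb2 (box w0 e) f.
  apply: le_Rintegral => //; first exact: (continuous_integrable2 oU e0 BU cf).
  move=> w Bw; rewrite /g /patch; case: ifPn => [|_]; last exact: f0.
  rewrite inE => Bm; apply: ltW; apply: Hr; rewrite -ball_normE /=; exact: le_lt_trans Bm mr.
apply: lt_le_trans H; rewrite -Rintegral_mkcondr setIidr// Rintegral_cst//.
rewrite [X in fine X](box_measure w0 m0) /=; by rewrite !mulr_gt0// divr_gt0.
Qed.

Lemma is_derive_horizontal (F : P -> R^o) (s y : R) : differentiable F (s, y) ->
  is_derive (s : R^o) (1 : R^o) (fun s : R^o => F (s, y)) (px F (s, y)).
Proof.
have E (t : R) : (0, y) + t *: (1, 0) = (t, y) :> P.
  by apply: injective_projections => /=; rewrite /GRing.scale /= ?mulr1 ?mulr0 ?add0r ?addr0.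
rewrite -(E s) pxEd => dF; have H := is_derive_seg dF.
by have -> : (fun s : R^o => F (s, y)) = (fun t : R^o => F ((0, y) + t *: (1, 0))) by apply/funext => t; rewrite E.
Qed.

Lemma is_derive_vertical (F : P -> R^o) (x s : R) : differentiable F (x, s) ->
  is_derive (s : R^o) (1 : R^o) (fun s : R^o => F (x, s)) (py F (x, s)).
Proof.
have E (t : R) : (x, 0) + t *: (0, 1) = (x, t) :> P.
  by apply: injective_projections => /=; rewrite /GRing.scale /= ?mulr1 ?mulr0 ?add0r ?addr0.
rewrite -(E s) pyEd => dF; have H := is_derive_seg dF.
by have -> : (fun s : R^o => F (x, s)) = (fun t : R^o => F ((x, 0) + t *: (0, 1))) by apply/funext => t; rewrite E.
Qed.

Lemma FTC_vanishing (h h' : R -> R) (a b : R) : a < b ->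
  (forall s, s \in `[a, b] -> is_derive (s : R^o) (1 : R^o) (h : R^o -> R^o) (h' s)) ->
  (forall s, s \in `[a, b] -> {for s, continuous h'}) -> h a = 0 -> h b = 0 ->
  (\int[leb]_(x in `[a, b]) (h' x)%:E = 0)%E.
Proof.
move=> ab dh ch' ha hb.
have ch s : s \in `[a, b] -> {for s, continuous h}.
  move=> /dh[dhs _]; apply: differentiable_continuous; exact/derivable1_diffP.
have ina : a \in `[a, b] by rewrite in_itv /= lexx ltW.
have inb : b \in `[a, b] by rewrite in_itv /= lexx ltW.
rewrite (@continuous_FTC2 _ h' h) ?ha ?hb ?subee//.
- apply/subspace_continuousP => s sab.
  by apply: cvg_within_filter; exact: ch'.
- split.
  + by move=> s sab; have [] := dh s (subset_itv_oo_cc sab).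
  + by apply: cvg_at_right_filter; exact: ch.
  + by apply: cvg_at_left_filter; exact: ch.
- by move=> s sab; rewrite derive1E; have [] := dh s (subset_itv_oo_cc sab).
Qed.

(* fundamental theorem of calculus on lines, integrated by Fubini *)
Section Vanishing.
Variables (U : set P) (F : P -> R^o) (w0 : P) (e : R).
Hypotheses (oU : open U) (e0 : 0 < e) (BU : box w0 e `<=` U) (sF : smooth_on U F).
Hypothesis F0 : forall w, ~ ball w0 e w -> F w = 0.

Lemma integral_px_vanishing : Rintegral leb2 (box w0 e) (px F) = 0.
Proof.
have sD := smooth_px sF.
have iD : leb2.-integrable (box w0 e) (EFin \o px F).
  by apply: (continuous_integrable2 oU e0 BU) => w Uw; exact: (smooth_continuous sD Uw).
move/integrable_mkcond : iD => /(_ (measurable_box w0 e)) iD.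
rewrite /Rintegral integral_mkcond -(integral21_prod_meas1 iD) integral0_eq // => y _.
rewrite boxE.
have [yB|yB] := boolP (y \in `[w0.2 - e, w0.2 + e]); last first.
  apply: integral0_eq => x _; rewrite patchE; case: ifPn => //.
  by rewrite inE => -[_ /=]; rewrite (negPf yB).
transitivity (\int[leb]_x (((fun x : R => (px F (x, y))%:E) \_ `[(w0.1 - e)%R, (w0.1 + e)%R]) x))%E.
  apply: eq_integral => x _; rewrite !patchE; congr (if _ then _ else _).
  by apply/idP/idP; rewrite !inE => //= -[].
have inU s : s \in `[w0.1 - e, w0.1 + e] -> U (s, y).
  by move=> sB; apply: BU; rewrite boxE.
rewrite -integral_mkcond; apply: (FTC_vanishing (h := fun s => F (s, y))).
- by rewrite ltrD2l gt0_cp.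
- by move=> s /inU Us; apply: is_derive_horizontal; exact: (smooth_differentiable sF).
- move=> s /inU Us; apply: (@continuous_comp _ _ _ (fun s : R => (s, y)) (px F)).
    by apply: (@cvg_pair _ _ _ (nbhs s) (nbhs s) (nbhs y)); [exact: cvg_id|exact: cvg_cst].
  exact: (smooth_continuous sD Us).
- by apply: F0 => -[]; rewrite /ball /= opprB addrC subrK ger0_norm ?ltxx// ltW.
- by apply: F0 => -[]; rewrite /ball /= opprD addrA subrr sub0r normrN ger0_norm ?ltxx// ltW.
Qed.

Lemma integral_py_vanishing : Rintegral leb2 (box w0 e) (py F) = 0.
Proof.
have sD := smooth_py sF.
have iD : leb2.-integrable (box w0 e) (EFin \o py F).
  by apply: (continuous_integrable2 oU e0 BU) => w Uw; exact: (smooth_continuous sD Uw).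
move/integrable_mkcond : iD => /(_ (measurable_box w0 e)) iD.
rewrite /Rintegral integral_mkcond -(integral12_prod_meas1 iD) integral0_eq // => x _.
rewrite boxE.
have [xB|xB] := boolP (x \in `[w0.1 - e, w0.1 + e]); last first.
  apply: integral0_eq => y _; rewrite patchE; case: ifPn => //.
  by rewrite inE => -[/=]; rewrite (negPf xB).
transitivity (\int[leb]_y (((fun y : R => (py F (x, y))%:E) \_ `[(w0.2 - e)%R, (w0.2 + e)%R]) y))%E.
  apply: eq_integral => y _; rewrite !patchE; congr (if _ then _ else _).
  by apply/idP/idP; rewrite !inE => //= -[].
have inU s : s \in `[w0.2 - e, w0.2 + e] -> U (x, s).
  by move=> sB; apply: BU; rewrite boxE.
rewrite -integral_mkcond; apply: (FTC_vanishing (h := fun s => F (x, s))).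
- by rewrite ltrD2l gt0_cp.
- by move=> s /inU Us; apply: is_derive_vertical; exact: (smooth_differentiable sF).
- move=> s /inU Us; apply: (@continuous_comp _ _ _ (fun s : R => (x, s)) (py F)).
    by apply: (@cvg_pair _ _ _ (nbhs s) (nbhs x) (nbhs s)); [exact: cvg_cst|exact: cvg_id].
  exact: (smooth_continuous sD Us).
- by apply: F0 => -[_]; rewrite /ball /= opprB addrC subrK ger0_norm ?ltxx// ltW.
- by apply: F0 => -[_]; rewrite /ball /= opprD addrA subrr sub0r normrN ger0_norm ?ltxx// ltW.
Qed.
End Vanishing.
End BoxIntegral.

(** * The first variation of the energy of graphs *)
Section FirstVariation.
Context {R : realType}.
Notation P := (R * R)%type.
Notation leb2 := ((@lebesgue_measure R) \x (@lebesgue_measure R))%E.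

(** [E] touches at 0 a line of slope [I] lying below it, so its derivative at 0 can only be [I]. *)
Lemma support_line_slope0 (E : R^o -> R^o) (I : R) : is_derive (0 : R^o) (1 : R^o) E 0 ->
  (forall t : R, E 0 + t * I <= E t) -> I = 0.
Proof.
move=> [dE E0] H; apply/eqP/negPn/negP => I0.
have lim0 : (fun h : R => h^-1 *: (E (h *: (1 : R^o) + 0) - E 0)) @ (0 : R)^' --> ('D_(1 : R^o) E (0 : R^o) : R^o).
  exact: dE.
rewrite E0 in lim0.
have nI : 0 < `|I| by rewrite normr_gt0.
have /nbhs_ballP[d /= d0 Hd] : nbhs (0 : R) [set h : R | h != 0 ->
    `|h^-1 *: (E (h *: (1 : R^o) + 0) - E 0)| < `|I|].
  by have /cvgr0Pnorm_lt/(_ _ nI) := lim0.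
pose h := Num.sg I * (d / 2).
have sI : `|Num.sg I| = 1 by rewrite normr_sg I0.
have nh : `|h| = d / 2 by rewrite normrM sI mul1r gtr0_norm// divr_gt0.
have h0 : h != 0 by rewrite -normr_gt0 nh divr_gt0.
have := Hd h; rewrite -ball_normE /= sub0r normrN nh ltr_pdivrMr// ltr_pMr// ltr1n => /(_ isT h0).
rewrite addr0 /GRing.scale /= mulr1 normrM normfV nh.
rewrite ltNge => /negP; apply.
rewrite ler_pdivlMl ?divr_gt0//.
have := H h; rewrite -lerBrDl => K.
apply: le_trans (ler_norm _); apply: le_trans K.
by rewrite /h [leRHS]mulrAC -normrEsg mulrC.
Qed.

Variables (U : set P) (x y z : P -> R^o) (G : P -> R^o).
Hypotheses (oU : open U) (sx : smooth_on U x) (sy : smooth_on U y) (sz : smooth_on U z).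
Hypothesis Jp : forall w, U w -> 0 < jacobian2 x y w.
Hypothesis sG : smooth_on setT G.
Hypothesis G_support : forall w v : P, G w + (v.1 * px G w + v.2 * py G w) <= G (w + v).
Notation D1 := (d1 x y).
Notation D2 := (d2 x y).
Notation p := (slope1 x y z).
Notation q := (slope2 x y z).
Notation J := (jacobian2 x y).

Lemma jacobian_neq0 w : U w -> J w != 0.
Proof. by move=> Uw; rewrite gt_eqF// Jp. Qed.

Definition varied_density (phi : P -> R^o) (t : R) : P -> R^o :=
  fun w => J w * G (p w + t * D1 phi w, q w + t * D2 phi w).

Definition graph_energy (w0 : P) (e : R) (t : R) : R :=
  Rintegral leb2 (box w0 e) (varied_density (bump w0 e) t).

Hypothesis stationary : forall w0 e, 0 < e -> box w0 e `<=` U ->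
  is_derive (0 : R^o) (1 : R^o) (graph_energy w0 e : R^o -> R^o) 0.

Implicit Types (f g phi : P -> R^o) (w : P) (e : R).
Notation g1 := (coef x y z (px G)).
Notation g2 := (coef x y z (py G)).

Let sJ : smooth_on U (J : P -> R^o) := smooth_jac oU sx sy.
Let sp' : smooth_on U p := smooth_slope1 oU sx sy sz jacobian_neq0.
Let sq' : smooth_on U q := smooth_slope2 oU sx sy sz jacobian_neq0.
Let sg1 : smooth_on U g1 := smooth_coef oU sx sy sz jacobian_neq0 (smooth_px sG).
Let sg2 : smooth_on U g2 := smooth_coef oU sx sy sz jacobian_neq0 (smooth_py sG).

Lemma smooth_bump_on w0 e : smooth_on U (bump w0 e).
Proof. exact: (smooth_sub (@subsetT _ U) (smooth_bump w0 e)). Qed.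

Lemma smooth_varied_density phi t : smooth_on U phi -> smooth_on U (varied_density phi t).
Proof.
move=> sphi; have s1 := smooth_d1 oU sx sy jacobian_neq0 sphi; have s2 := smooth_d2 oU sx sy jacobian_neq0 sphi.
have ct := smooth_cst U (t : R^o).
apply: (smoothM oU sJ).
apply: (@smooth_comp _ _ _ _ U setT (fun w => (p w + t * D1 phi w, q w + t * D2 phi w)) G) => //.
- exact: (findim_pair findim_R findim_R).
- exact: findim_R.
- exact: openT.
- exact: (smooth_pair oU (smoothD oU sp' (smoothM oU ct s1)) (smoothD oU sq' (smoothM oU ct s2))).
Qed.

Definition energy_slope (phi : P -> R^o) : P -> R^o :=
  fun w => J w * (g1 w * D1 phi w + g2 w * D2 phi w).

Lemma smooth_energy_slope phi : smooth_on U phi -> smooth_on U (energy_slope phi).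
Proof.
move=> sphi; have s1 := smooth_d1 oU sx sy jacobian_neq0 sphi; have s2 := smooth_d2 oU sx sy jacobian_neq0 sphi.
exact: (smoothM oU sJ (smoothD oU (smoothM oU sg1 s1) (smoothM oU sg2 s2))).
Qed.

(** By convexity of the integrand the energy lies above its formal tangent line at t = 0, which it
    touches there; as the energy is stationary, the slope of that line is 0. *)
Lemma energy_slope_integral w0 e : 0 < e -> box w0 e `<=` U ->
  Rintegral leb2 (box w0 e) (energy_slope (bump w0 e)) = 0.
Proof.
move=> e0 BU; apply: (support_line_slope0 (stationary e0 BU)) => t.
have sb := smooth_bump_on w0 e.
have int (f : P -> R^o) : smooth_on U f -> leb2.-integrable (box w0 e) (EFin \o (f : P -> R)).
  by move=> sf; apply: (continuous_integrable2 oU e0 BU) => w Uw; exact: (smooth_continuous sf Uw).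
have i0 := int _ (smooth_varied_density 0 sb); have it := int _ (smooth_varied_density t sb).
have se := smooth_energy_slope sb; have ie := int _ se.
have ste : smooth_on U (fun w => t * energy_slope (bump w0 e) w : R^o).
  exact: (smoothM oU (smooth_cst U (t : R^o)) se).
have ite := int _ ste.
have iD := int _ (smoothD oU (smooth_varied_density 0 sb) ste).
have mB := measurable_box w0 e.
rewrite /graph_energy -RintegralZl// -RintegralD//.
apply: le_Rintegral => //.
move=> w /BU Uw; rewrite /varied_density /energy_slope !mul0r !addr0.
have := G_support (p w, q w) (t * D1 (bump w0 e) w, t * D2 (bump w0 e) w).
rewrite -(ler_pM2l (Jp Uw)) /= /coef; apply: le_trans.
by rewrite le_eqVlt; apply/orP; left; apply/eqP; ring.
Qed.

(** The vector field W for which [energy_slope phi] is the scalar product of W with the gradient of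
    [phi]; the jacobian cancels against the denominators of the coordinate derivatives. *)
Definition flux1 : P -> R^o := fun w => g1 w * py y w - g2 w * py x w.
Definition flux2 : P -> R^o := fun w => g2 w * px x w - g1 w * px y w.

Lemma smooth_flux : smooth_on U flux1 /\ smooth_on U flux2.
Proof.
have [xu xv yu yv] := And4 (smooth_px sx) (smooth_py sx) (smooth_px sy) (smooth_py sy).
split; first exact: (smoothB oU (smoothM oU sg1 yv) (smoothM oU sg2 xv)).
exact: (smoothB oU (smoothM oU sg2 xu) (smoothM oU sg1 yu)).
Qed.

Lemma px_mul f g w : U w -> smooth_on U f -> smooth_on U g ->
  px (fun w => f w * g w) w = f w * px g w + g w * px f w.
Proof.
move=> Uw sf sg; rewrite !pxEd.
exact: (derive_mul _ (smooth_differentiable sf Uw) (smooth_differentiable sg Uw)).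
Qed.

Lemma py_mul f g w : U w -> smooth_on U f -> smooth_on U g ->
  py (fun w => f w * g w) w = f w * py g w + g w * py f w.
Proof.
move=> Uw sf sg; rewrite !pyEd.
exact: (derive_mul _ (smooth_differentiable sf Uw) (smooth_differentiable sg Uw)).
Qed.

Lemma px_sub f g w : U w -> smooth_on U f -> smooth_on U g ->
  px (fun w => f w - g w) w = px f w - px g w.
Proof.
move=> Uw sf sg; rewrite !pxEd.
rewrite (derive_add _ (smooth_differentiable sf Uw) (smooth_differentiable (smoothN oU sg) Uw)).
by rewrite (derive_opp _ (smooth_differentiable sg Uw)).
Qed.

Lemma py_sub f g w : U w -> smooth_on U f -> smooth_on U g ->
  py (fun w => f w - g w) w = py f w - py g w.
Proof.
move=> Uw sf sg; rewrite !pyEd.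
rewrite (derive_add _ (smooth_differentiable sf Uw) (smooth_differentiable (smoothN oU sg) Uw)).
by rewrite (derive_opp _ (smooth_differentiable sg Uw)).
Qed.

(** The terms with second derivatives of x and y cancel by equality of mixed partials. *)
Lemma flux_div w : U w -> px flux1 w + py flux2 w = J w * (D1 g1 w + D2 g2 w).
Proof.
move=> Uw.
have [xu xv yu yv] := And4 (smooth_px sx) (smooth_py sx) (smooth_px sy) (smooth_py sy).
rewrite (px_sub Uw (smoothM oU sg1 yv) (smoothM oU sg2 xv)).
rewrite (py_sub Uw (smoothM oU sg2 xu) (smoothM oU sg1 yu)).
rewrite (px_mul Uw sg1 yv) (px_mul Uw sg2 xv) (py_mul Uw sg2 xu) (py_mul Uw sg1 yu).
rewrite (pyx oU sx Uw) (pyx oU sy Uw).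
rewrite (D1E x y (smooth_differentiable sg1 Uw)) (D2E x y (smooth_differentiable sg2 Uw)).
have := jacobian_neq0 Uw; rewrite /jacobian2 => Jn; by field.
Qed.

(** Otherwise the divergence has a constant sign on a small box, and integrating by parts against the
    bump supported in the box gives a first variation different from zero. *)
Lemma flux_div_eq0 w0 : U w0 -> px flux1 w0 + py flux2 w0 = 0.
Proof.
move=> Uw0; apply/eqP/negPn/negP => d0.
have [s1 s2] := smooth_flux.
pose dv : P -> R^o := fun w => px flux1 w + py flux2 w.
have sdv : smooth_on U dv := smoothD oU (smooth_px s1) (smooth_py s2).
pose k : R := Num.sg (dv w0).
have kd : 0 < k * dv w0 by rewrite /k -normrEsg normr_gt0.
have skd : smooth_on U (fun w => k * dv w : R^o) := smoothM oU (smooth_cst U (k : R^o)) sdv.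
have ckd := smooth_continuous skd Uw0.
have H : nbhs w0 (U `&` [set w | 0 < k * dv w]).
  apply: filterI; first exact: open_nbhs_nbhs.
  exact: (ckd _ (lt_nbhsr kd)).
move/nbhs_ballP : H => [d /= dp Hd].
pose e := d / 2; have e0 : 0 < e by rewrite divr_gt0.
have BH : box w0 e `<=` U `&` [set w | 0 < k * dv w].
  move=> w Bw; apply: Hd; rewrite -ball_normE /=; apply: le_lt_trans Bw _.
  by rewrite ltr_pdivrMr// ltr_pMr// ltr1n.
have BU : box w0 e `<=` U by move=> w /BH[].
have sb := smooth_bump_on w0 e; set phi := bump w0 e in sb *.
have sF : smooth_on U (fun w => phi w * (k * dv w) : R^o) := smoothM oU sb skd.
have cF w : U w -> {for w, continuous (fun w => phi w * (k * dv w) : R)}.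
  by move=> Uw; exact: (smooth_continuous sF Uw).
have := integral_box_gt0 oU e0 BU cF.
suff -> : Rintegral leb2 (box w0 e) (fun w => phi w * (k * dv w)) = 0.
  rewrite ltxx => K; have : false; last by [].
  apply: K; last exact: (mulr_gt0 (bump_gt0 w0 e0) kd).
  by move=> w /BH[_ K]; apply: mulr_ge0; [exact: bump_ge0|exact: ltW].
have int (f : P -> R^o) : smooth_on U f -> leb2.-integrable (box w0 e) (EFin \o (f : P -> R)).
  by move=> sf; apply: (continuous_integrable2 oU e0 BU) => w Uw; exact: (smooth_continuous sf Uw).
have mB := measurable_box w0 e.
have f1 := smoothM oU sb s1; have f2 := smoothM oU sb s2.
have van (f : P -> R^o) w : ~ ball w0 e w -> phi w * f w = 0.
  by move=> nB; rewrite /phi bump_out// mul0r.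
have I1 := integral_px_vanishing oU e0 BU f1 (van _).
have I2 := integral_py_vanishing oU e0 BU f2 (van _).
have I3 := energy_slope_integral e0 BU.
have E : forall w, box w0 e w -> phi w * (k * dv w) =
   k * (px (fun w => phi w * flux1 w) w + py (fun w => phi w * flux2 w) w - energy_slope phi w).
  move=> w /BU Uw; rewrite (px_mul Uw sb s1) (py_mul Uw sb s2) /energy_slope.
  rewrite (D1E x y (smooth_differentiable sb Uw)) (D2E x y (smooth_differentiable sb Uw)).
  have := jacobian_neq0 Uw; rewrite /dv /flux1 /flux2; set j := J w => Jn; rewrite /flux1 /flux2.
  by field.
rewrite (@eq_Rintegral _ _ _ leb2 _ (fun w => k * (px (fun w => phi w * flux1 w) w + py (fun w => phi w * flux2 w) w - energy_slope phi w))); last first.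
  by move=> w; rewrite inE; exact: E.
have i1 := int _ (smooth_px f1); have i2 := int _ (smooth_py f2); have i3 := int _ (smooth_energy_slope sb).
have i12 := int _ (smoothD oU (smooth_px f1) (smooth_py f2)).
have i123 := int _ (smoothB oU (smoothD oU (smooth_px f1) (smooth_py f2)) (smooth_energy_slope sb)).
by rewrite RintegralZl// RintegralB// RintegralD// I1 I2 I3 addr0 subr0 mulr0.
Qed.

(** The Euler-Lagrange equation in non-divergence form. *)
Lemma euler_lagrange w : U w ->
  coef x y z (px (px G)) w * hess11 x y z w + 2 * coef x y z (px (py G)) w * hess12 x y z w
  + coef x y z (py (py G)) w * hess22 x y z w = 0.
Proof.
move=> Uw; have := flux_div_eq0 Uw; rewrite (flux_div Uw) => /eqP.
rewrite mulf_eq0 (negPf (jacobian_neq0 Uw)) /= => /eqP <-.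
have dp := smooth_differentiable sp' Uw; have dq := smooth_differentiable sq' Uw.
have d1' : differentiable (px G) (p w, q w) by exact: (smooth_differentiable (smooth_px sG)).
have d2' : differentiable (py G) (p w, q w) by exact: (smooth_differentiable (smooth_py sG)).
rewrite /coef D1Ed D2Ed (chain2 _ d1' dp dq) (chain2 _ d2' dp dq) -!D1Ed -!D2Ed.
rewrite (pyx openT sG)//.
rewrite (_ : D2 (slope1 x y z) w = hess12 x y z w); last first.
  exact: (d2_slope1 oU sx sy sz jacobian_neq0 Uw).
rewrite /hess11 /hess12 /hess22; ring.
Qed.

End FirstVariation.

(** * Immersions as graphs *)
Section GraphMap.
Context {R : realType}.
Notation P := (R * R)%type.
Notation V3 := 'rV[R]_3.

Lemma dot_ijk (i j k : 'I_3) (u v : V3) : i != j -> i != k -> j != k ->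
  dot u v = u 0 i * v 0 i + u 0 j * v 0 j + u 0 k * v 0 k.
Proof.
move=> ij ik jk; rewrite /dot (bigD1 i)//= (bigD1 j) 1?eq_sym//= (bigD1 k)/=; last first.
  by rewrite ![k == _]eq_sym ik jk.
rewrite big1 ?addr0 ?addrA// => l /andP[/andP[li lj] lk].
have u4 : uniq [:: i; j; k; l].
  by rewrite /= !inE (negPf ij) (negPf ik) (negPf jk) ![_ == l]eq_sym (negPf li) (negPf lj) (negPf lk).
by have := max_card (mem [:: i; j; k; l]); rewrite (card_uniqP u4) card_ord.
Qed.

Definition coord_fun (F : P -> V3) (l : 'I_3) : P -> R^o := fun w => F w 0 l.

Variables (U : set P) (F : P -> V3) (i j k : 'I_3) (eps : R).
Hypotheses (oU : open U) (sF : smooth_on U F).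
Hypotheses (ij : i != j) (ik : i != k) (jk : j != k) (eps1 : eps ^+ 2 = 1).
Notation x := (coord_fun F i).
Notation y := (coord_fun F j).
Notation z := (coord_fun F k).
Notation J := (jacobian2 x y).
Hypothesis Jn : forall w, U w -> J w != 0.
Notation p := (slope1 x y z).
Notation q := (slope2 x y z).
Notation n := (graph_normal i j k eps).

Lemma smooth_coord_fun l : smooth_on U (coord_fun F l).
Proof. exact: smooth_coord. Qed.

Lemma derive_coord_fun l w v : U w -> 'D_v F w 0 l = 'D_v (coord_fun F l) w.
Proof. by move=> Uw; apply: derive_coord; exact: smooth_differentiable Uw. Qed.

Lemma derive_frame (f : P -> R^o) w v : U w -> smooth_on U f ->
  'D_v f w = d1 x y f w * 'D_v x w + d2 x y f w * 'D_v y w.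
Proof.
move=> Uw sf; have df := smooth_differentiable sf Uw.
have dx := smooth_differentiable (smooth_coord_fun i) Uw.
have dy := smooth_differentiable (smooth_coord_fun j) Uw.
rewrite (derive_xy v df) (derive_xy v dx) (derive_xy v dy) -!pxEd -!pyEd.
rewrite (pxE Jn Uw df) (pyE Jn Uw df) /GRing.scale /=; ring.
Qed.

Lemma derive_z w v : U w -> 'D_v z w = p w * 'D_v x w + q w * 'D_v y w.
Proof. by move=> Uw; apply: derive_frame => //; exact: smooth_coord_fun. Qed.

Lemma graph_normal_orthogonal w v : U w -> dot ('D_v F w) (n (p w, q w)) = 0.
Proof.
move=> Uw; rewrite (dot_ijk _ _ ij ik jk) !derive_coord_fun// derive_z//.
by have [-> -> ->] := graph_normalE eps ij ik jk (p w, q w); rewrite /=; ring.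
Qed.

Lemma derive_xy_eq0 w (v : P) : U w -> 'D_v x w = 0 -> 'D_v y w = 0 -> v = 0.
Proof.
move=> Uw.
have dx := smooth_differentiable (smooth_coord_fun i) Uw.
have dy := smooth_differentiable (smooth_coord_fun j) Uw.
rewrite (derive_xy v dx) (derive_xy v dy) -!pxEd -!pyEd /GRing.scale /= => E1 E2.
have jn := Jn Uw.
have v1 : v.1 * J w = 0.
  transitivity ((v.1 * px x w + v.2 * py x w) * py y w - (v.1 * px y w + v.2 * py y w) * py x w).
    by rewrite /jacobian2; ring.
  by rewrite E1 E2 !mul0r subrr.
have v2 : v.2 * J w = 0.
  transitivity ((v.1 * px y w + v.2 * py y w) * px x w - (v.1 * px x w + v.2 * py x w) * px y w).
    by rewrite /jacobian2; ring.
  by rewrite E1 E2 !mul0r subrr.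
apply: injective_projections; apply/eqP.
  by move/eqP: v1; rewrite mulf_eq0 (negPf jn) orbF.
by move/eqP: v2; rewrite mulf_eq0 (negPf jn) orbF.
Qed.

Lemma graph_map_immersive w (v : P) : U w -> 'D_v F w = 0 -> v = 0.
Proof.
by move=> Uw E; apply: (derive_xy_eq0 Uw); rewrite -derive_coord_fun// E mxE.
Qed.

Lemma dot_graph_normal (w : P) : dot (n w) (n w) = 1 + w.1 ^+ 2 + w.2 ^+ 2.
Proof.
rewrite (dot_ijk _ _ ij ik jk); have [-> -> ->] := graph_normalE eps ij ik jk w.
transitivity (eps ^+ 2 * (1 + w.1 ^+ 2 + w.2 ^+ 2)); first ring.
by rewrite eps1 mul1r.
Qed.

Lemma det2 (A : 'M[R]_2) : \det A = A 0 0 * A 1 1 - A 0 1 * A 1 0.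
Proof.
rewrite (expand_det_row _ 0) !big_ord_recl big_ord0 addr0 /cofactor !det_mx11 !mxE /=.
rewrite expr0 expr1 !mul1r mulN1r mulrN.
by congr (A _ _ * A _ _ - A _ _ * A _ _); apply/val_inj.
Qed.

Lemma dot_derive w u v : U w -> dot ('D_u F w) ('D_v F w) =
  'D_u x w * 'D_v x w + 'D_u y w * 'D_v y w
  + (p w * 'D_u x w + q w * 'D_u y w) * (p w * 'D_v x w + q w * 'D_v y w).
Proof.
move=> Uw; rewrite (dot_ijk _ _ ij ik jk).
have Dz t := etrans (derive_coord_fun k t Uw) (derive_z t Uw).
congr (_ * _ + _ * _ + _ * _);
  by [exact: derive_coord_fun | exact: (Dz u) | exact: (Dz v)].
Qed.

(** The area element of a graph. *)
Lemma gram_det w : U w ->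
  \det (\matrix_(a < 2, b < 2) dot ('D_(basis_vec a : P) F w) ('D_(basis_vec b : P) F w)) =
  J w ^+ 2 * enorm (n (p w, q w)) ^+ 2.
Proof.
move=> Uw.
have -> : enorm (n (p w, q w)) ^+ 2 = 1 + p w ^+ 2 + q w ^+ 2.
  rewrite /enorm dot_graph_normal sqr_sqrtr //=.
  exact: (addr_ge0 (addr_ge0 ler01 (sqr_ge0 _)) (sqr_ge0 _)).
have b0 : basis_vec 0 = (1, 0) :> P by [].
have b1 : basis_vec 1 = (0, 1) :> P by [].
pose g (u v : P) : R := 'D_u x w * 'D_v x w + 'D_u y w * 'D_v y w
  + (p w * 'D_u x w + q w * 'D_u y w) * (p w * 'D_v x w + q w * 'D_v y w).
transitivity (g (1, 0) (1, 0) * g (0, 1) (0, 1) - g (1, 0) (0, 1) * g (0, 1) (1, 0)).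
  rewrite det2 !mxE b0 b1; congr (_ * _ - _ * _); exact: dot_derive.
rewrite /g -!pxEd -!pyEd /jacobian2; ring.
Qed.

Section GaussMap.
Variable N : P -> V3.
Hypothesis sN : smooth_on U N.
Hypothesis N_unit : forall w, U w -> sphere (N w).
Hypothesis N_orth : forall w v, U w -> dot ('D_v F w) (N w) = 0.
Hypothesis N_side : forall w, U w -> 0 < eps * N w 0 k.
Notation mu := (coord_fun N k).
Let sx := smooth_coord_fun i.
Let sy := smooth_coord_fun j.
Let sz := smooth_coord_fun k.
Let spp : smooth_on U p := smooth_slope1 oU sx sy sz Jn.
Let sqq : smooth_on U q := smooth_slope2 oU sx sy sz Jn.

Lemma normal_coords w : U w -> N w 0 i = - mu w * p w /\ N w 0 j = - mu w * q w.
Proof.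
move=> Uw.
have E v : 'D_v x w * (N w 0 i + mu w * p w) + 'D_v y w * (N w 0 j + mu w * q w) = 0.
  rewrite -(N_orth v Uw) (dot_ijk _ _ ij ik jk) !(derive_coord_fun _ _ Uw) (derive_z v Uw).
  rewrite /coord_fun; ring.
have Eu := E (1, 0); have Ev := E (0, 1).
rewrite -!pxEd in Eu; rewrite -!pyEd in Ev.
have jn := Jn Uw.
set A := N w 0 i + _ in Eu Ev; set B := N w 0 j + _ in Eu Ev.
have A0 : J w * A = 0.
  transitivity ((px x w * A + px y w * B) * py y w - (py x w * A + py y w * B) * px y w).
    by rewrite /jacobian2; ring.
  by rewrite Eu Ev !mul0r subrr.
have B0 : J w * B = 0.
  transitivity ((py x w * A + py y w * B) * px x w - (px x w * A + px y w * B) * py x w).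
    by rewrite /jacobian2; ring.
  by rewrite Eu Ev !mul0r subrr.
have /eqP := A0; have /eqP := B0; rewrite !mulf_eq0 (negPf jn) /= /A /B => /eqP b0 /eqP a0.
by split; apply/eqP; rewrite -subr_eq0 mulNr opprK; apply/eqP.
Qed.

Lemma mu_neq0 w : U w -> mu w != 0.
Proof. by move=> /N_side; apply: contraTneq; rewrite /coord_fun => ->; rewrite mulr0 ltxx. Qed.

(** Orthogonality to the two coordinate directions and the side fix the direction of the normal. *)
Lemma normal_graph w : U w -> N w = (enorm (n (p w, q w)))^-1 *: n (p w, q w).
Proof.
move=> Uw; have [Ni Nj] := normal_coords Uw.
have [ni nj nk] := graph_normalE eps ij ik jk (p w, q w).
have NE : N w = (eps * mu w) *: n (p w, q w).
  have ee (t : R) : t = (eps * eps) * t by rewrite -expr2 eps1 mul1r.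
  apply/rowP => l; rewrite mxE.
  have : [|| l == i, l == j | l == k].
    apply/negPn/negP; rewrite !negb_or => /and3P[li lj lk].
    have u4 : uniq [:: i; j; k; l].
      by rewrite /= !inE (negPf ij) (negPf ik) (negPf jk) ![_ == l]eq_sym (negPf li) (negPf lj) (negPf lk).
    by have := max_card (mem [:: i; j; k; l]); rewrite (card_uniqP u4) card_ord.
  move=> /or3P[] /eqP ->.
  - by rewrite Ni ni [LHS]ee /=; ring.
  - by rewrite Nj nj [LHS]ee /=; ring.
  - by rewrite nk [LHS]ee /coord_fun; ring.
have E : 1 = eps * mu w * enorm (n (p w, q w)).
  by rewrite -(enormZ _ (N_side Uw)) -/(mu w) -NE; have := N_unit Uw.
have n0 : enorm (n (p w, q w)) != 0.
  by apply: contraTneq isT => e0; move: E; rewrite e0 mulr0 => /eqP; rewrite oner_eq0.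
by rewrite {1}NE; congr (_ *: _); apply: (mulIf n0); rewrite -E mulVf.
Qed.

Lemma normal_derive w v : U w ->
  [/\ 'D_v N w 0 i = - mu w * 'D_v p w - p w * 'D_v mu w,
      'D_v N w 0 j = - mu w * 'D_v q w - q w * 'D_v mu w &
      'D_v N w 0 k = 'D_v mu w].
Proof.
move=> Uw; have dN := smooth_differentiable sN Uw.
have dmu : differentiable mu w by exact: (smooth_differentiable (smooth_coord k oU sN) Uw).
have dp := smooth_differentiable spp Uw; have dq := smooth_differentiable sqq Uw.
have dmu' : differentiable (fun w => - mu w : R^o) w.
  by exact: (smooth_differentiable (smoothN oU (smooth_coord k oU sN)) Uw).
have E (f : P -> R^o) : differentiable f w ->
    'D_v (fun w => - mu w * f w : R^o) w = - mu w * 'D_v f w - f w * 'D_v mu w.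
  by move=> df; rewrite (derive_mul v dmu' df) (derive_opp v dmu) mulrN.
split; rewrite (derive_coord _ _ dN) //.
- rewrite -(E _ dp); apply: (derive_eq_open v oU Uw) => t Ut; by have [] := normal_coords Ut.
- rewrite -(E _ dq); apply: (derive_eq_open v oU Uw) => t Ut; by have [] := normal_coords Ut.
Qed.

Lemma dot_derive_normal w u v : U w -> dot ('D_u F w) ('D_v N w) =
  - mu w * ('D_u x w * 'D_v p w + 'D_u y w * 'D_v q w).
Proof.
move=> Uw; have [Di Dj Dk] := normal_derive v Uw.
rewrite (dot_ijk _ _ ij ik jk) Di Dj Dk !(derive_coord_fun _ _ Uw) (derive_z u Uw); ring.
Qed.

Definition slope_jac w : R := px p w * py q w - py p w * px q w.

Lemma slope_jacE w : U w -> slope_jac w = - J w * hdet x y z w.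
Proof.
move=> Uw; have dp := smooth_differentiable spp Uw; have dq := smooth_differentiable sqq Uw.
rewrite /slope_jac (pxE Jn Uw dp) (pyE Jn Uw dp) (pxE Jn Uw dq) (pyE Jn Uw dq).
rewrite (d2_slope1 oU sx sy sz Jn Uw) /hdet /hess11 /hess22 /jacobian2.
rewrite -/(hess12 x y z w); ring.
Qed.

(** The normal is [mu] times (- p, - q, 1), and the derivative of the factor [mu] only contributes a
    multiple of the normal. *)
Lemma second_form_det w : U w ->
  \det (\matrix_(a < 2, b < 2) dot ('D_(basis_vec a : P) F w) ('D_(basis_vec b : P) N w)) =
  - (mu w * J w) ^+ 2 * hdet x y z w.
Proof.
move=> Uw.
have b0 : basis_vec 0 = (1, 0) :> P by [].
have b1 : basis_vec 1 = (0, 1) :> P by [].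
pose g (u v : P) : R := - mu w * ('D_u x w * 'D_v p w + 'D_u y w * 'D_v q w).
transitivity (g (1, 0) (1, 0) * g (0, 1) (0, 1) - g (1, 0) (0, 1) * g (0, 1) (1, 0)).
  rewrite det2 !mxE b0 b1; congr (_ * _ - _ * _); exact: dot_derive_normal.
rewrite /g -!pxEd -!pyEd.
transitivity (mu w ^+ 2 * J w * slope_jac w); first by rewrite /slope_jac /jacobian2; ring.
rewrite (slope_jacE Uw); ring.
Qed.

Lemma tangent_coords_eq0 w (u : V3) : U w -> dot u (N w) = 0 ->
  u 0 i + p w * u 0 k = 0 -> u 0 j + q w * u 0 k = 0 -> u = 0.
Proof.
move=> Uw; rewrite (dot_ijk _ _ ij ik jk); have [-> ->] := normal_coords Uw.
have m0 := mu_neq0 Uw; rewrite -/(mu w) => E Ei Ej.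
have ui : u 0 i = - (p w * u 0 k) by apply/eqP; rewrite -addr_eq0; apply/eqP.
have uj : u 0 j = - (q w * u 0 k) by apply/eqP; rewrite -addr_eq0; apply/eqP.
have uk : u 0 k = 0.
  have : mu w * (1 + p w ^+ 2 + q w ^+ 2) * u 0 k = 0 by rewrite -E ui uj; ring.
  move/eqP; rewrite !mulf_eq0 (negPf m0) /= gt_eqF => [/eqP//|].
  by rewrite -addrA ltr_wpDr// addr_ge0// sqr_ge0.
apply/eqP/negPn/negP => /dot_gt0; rewrite (dot_ijk _ _ ij ik jk) ui uj uk; lra.
Qed.

Lemma derive_normal_tangent w v : U w -> dot ('D_v N w) (N w) = 0.
Proof.
move=> Uw; have dN := smooth_differentiable sN Uw.
have d1 l : differentiable (coord_fun N l) w by exact: (smooth_differentiable (smooth_coord l oU sN) Uw).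
have E : 'D_v (fun w => dot (N w) (N w) : R^o) w = 0.
  rewrite -(derive_cst (1 : R^o) w v); apply: (derive_eq_open v oU Uw) => t /N_unit.
  rewrite /sphere /= /enorm => H.
  have N0 : 0 <= dot (N t) (N t) by apply: sumr_ge0 => l _; rewrite -expr2 sqr_ge0.
  by rewrite -(sqr_sqrtr N0) H expr1n.
have sq l : smooth_on U (fun w => coord_fun N l w * coord_fun N l w : R^o).
  exact: (smoothM oU (smooth_coord l oU sN) (smooth_coord l oU sN)).
have dq l := smooth_differentiable (sq l) Uw.
have dij := smooth_differentiable (smoothD oU (sq i) (sq j)) Uw.
have H : 2 * dot ('D_v N w) (N w) = 0.
  rewrite -E (_ : (fun w => dot (N w) (N w) : R^o) = fun w => coord_fun N i w * coord_fun N i w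
     + coord_fun N j w * coord_fun N j w + coord_fun N k w * coord_fun N k w); last first.
    by apply/funext => t; rewrite (dot_ijk _ _ ij ik jk).
  rewrite (derive_add v dij (dq k)) (derive_add v (dq i) (dq j)).
  rewrite (derive_mul v (d1 i) (d1 i)) (derive_mul v (d1 j) (d1 j)) (derive_mul v (d1 k) (d1 k)).
  rewrite (dot_ijk _ _ ij ik jk) !(derive_coord _ v dN) /coord_fun; ring.
by apply/eqP; move/eqP: H; rewrite mulf_eq0 pnatr_eq0.
Qed.

Lemma normal_derive_eq w v (u : V3) : U w -> dot u (N w) = 0 ->
  - mu w * 'D_v p w = u 0 i + p w * u 0 k -> - mu w * 'D_v q w = u 0 j + q w * u 0 k ->
  'D_v N w = u.
Proof.
move=> Uw uN Ei Ej; have [Di Dj Dk] := normal_derive v Uw.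
apply/eqP; rewrite -subr_eq0; apply/eqP; apply: (tangent_coords_eq0 Uw).
- by rewrite dotBl uN (derive_normal_tangent v Uw) subrr.
- rewrite !mxE Di Dk.
  transitivity (- mu w * 'D_v p w - (u 0 i + p w * u 0 k)); first ring.
  by rewrite Ei subrr.
- rewrite !mxE Dj Dk.
  transitivity (- mu w * 'D_v q w - (u 0 j + q w * u 0 k)); first ring.
  by rewrite Ej subrr.
Qed.

Lemma normal_derive_eq0 w v : U w -> 'D_v N w = 0 -> 'D_v p w = 0 /\ 'D_v q w = 0.
Proof.
move=> Uw E; have [] := normal_derive v Uw; rewrite E !mxE => Di Dj Dk.
have m0 := mu_neq0 Uw; rewrite -Dk !mulr0 !subr0 in Di Dj.
by split; apply/eqP; [move/esym/eqP: Di|move/esym/eqP: Dj];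
  rewrite mulf_eq0 oppr_eq0 (negPf m0).
Qed.

Lemma slope_derive w (v : P) : U w -> 'D_v p w = v.1 * px p w + v.2 * py p w /\
  'D_v q w = v.1 * px q w + v.2 * py q w.
Proof.
move=> Uw; rewrite (derive_xy v (smooth_differentiable spp Uw)).
by rewrite (derive_xy v (smooth_differentiable sqq Uw)) -!pxEd -!pyEd.
Qed.

(** The normal is stationary in a direction exactly when both slopes are, and the Jacobian determinant
    of the slopes is a nonzero multiple of [hdet]. *)
Lemma gauss_kernel w : U w -> hdet x y z w = 0 <-> exists2 v : P, v != 0 & 'D_v N w = 0.
Proof.
move=> Uw; have jn := Jn Uw; have sj := slope_jacE Uw.
split=> [h0|[v v0 E]].
  have s0 : slope_jac w = 0 by rewrite sj h0 mulr0.
  have [v v0 [Ep Eq]] : exists2 v : P, v != 0 & 'D_v p w = 0 /\ 'D_v q w = 0.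
    have pn (a b : R) : ((a, b) : P) != 0 = (a != 0) || (b != 0).
      by rewrite -negb_and -[in RHS]xpair_eqE.
    have [qn|] := boolP (((py q w, - px q w) : P) != 0).
      exists (py q w, - px q w) => //; have [-> ->] := slope_derive (py q w, - px q w) Uw.
      by move: s0; rewrite /slope_jac /= => s0; split; [rewrite -s0|]; ring.
    rewrite negbK => /eqP[q2 /eqP]; rewrite oppr_eq0 => /eqP q1.
    have [qn|] := boolP (((py p w, - px p w) : P) != 0).
      exists (py p w, - px p w) => //; have [-> ->] := slope_derive (py p w, - px p w) Uw.
      by rewrite /= q1 q2; split; ring.
    rewrite negbK => /eqP[p2 /eqP]; rewrite oppr_eq0 => /eqP p1.
    exists (1, 0); first by rewrite pn oner_eq0.
    by have [-> ->] := slope_derive (1, 0) Uw; rewrite /= p1 p2 q1 q2; split; ring.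
  exists v => //; apply: (normal_derive_eq Uw).
  - by rewrite /dot big1// => l _; rewrite mxE mul0r.
  - by rewrite Ep !mxE; ring.
  - by rewrite Eq !mxE; ring.
have [Ep Eq] := normal_derive_eq0 Uw E.
have [Dp Dq] := slope_derive v Uw; rewrite Ep in Dp; rewrite Eq in Dq.
have s0 : slope_jac w = 0.
  apply/eqP/negPn/negP => sn; move/eqP: v0; apply; apply: injective_projections.
    apply: (mulIf sn); rewrite mul0r.
    transitivity ((v.1 * px p w + v.2 * py p w) * py q w - (v.1 * px q w + v.2 * py q w) * py p w).
      by rewrite /slope_jac; ring.
    by rewrite -Dp -Dq !mul0r subrr.
  apply: (mulIf sn); rewrite mul0r.
  transitivity ((v.1 * px q w + v.2 * py q w) * px p w - (v.1 * px p w + v.2 * py p w) * px q w).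
    by rewrite /slope_jac; ring.
  by rewrite -Dp -Dq !mul0r subrr.
by apply/eqP; move/eqP: s0; rewrite sj mulf_eq0 oppr_eq0 (negPf jn).
Qed.

Lemma gauss_invertible w : U w -> hdet x y z w != 0 ->
  forall u, sphere_tangent (N w) u -> exists! v : P, 'D_v N w = u.
Proof.
move=> Uw h0 u tu; have m0 := mu_neq0 Uw.
have sn : slope_jac w != 0 by rewrite (slope_jacE Uw) mulf_neq0// oppr_eq0 Jn.
pose a := - (u 0 i + p w * u 0 k) / mu w; pose b := - (u 0 j + q w * u 0 k) / mu w.
exists ((a * py q w - b * py p w) / slope_jac w, (b * px p w - a * px q w) / slope_jac w).
set v := (_, _); have [Dp Dq] := slope_derive v Uw.
have Dv : 'D_v N w = u.
  apply: (normal_derive_eq Uw tu).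
    rewrite Dp /= /a /b; move: sn; rewrite /slope_jac => sn.
    by field; apply/andP.
  rewrite Dq /= /a /b; move: sn; rewrite /slope_jac => sn.
  by field; apply/andP.
split=> // v' Ev'.
have dN := smooth_differentiable sN Uw.
have K : 'D_(v - v') N w = 0.
  by rewrite (deriveDv v (- v') dN) -scaleN1r (deriveZv (-1) v' dN) scaleN1r Dv Ev' subrr.
apply/eqP; rewrite -subr_eq0; apply/negPn/negP => vn.
by move/negP: h0; apply; apply/eqP; apply/(gauss_kernel Uw); exists (v - v').
Qed.

End GaussMap.
End GraphMap.

(** * Vertical variations in a graph chart *)
Section Charts.
Context {R : realType} {S : surface R}.
Notation P := (R * R)%type.
Notation V3 := 'rV[R]_3.
Implicit Types (c : chart R S) (a b : S) (w v : P).

Lemma chart_imP c w : chart_im c w -> chart_dom c (chart_inv c w) /\ chart_map c (chart_inv c w) = w.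
Proof. by move=> [a da <-]; rewrite chart_mapK. Qed.

Lemma chart_im_map c a : chart_dom c a -> chart_im c (chart_map c a).
Proof. by move=> da; exists a. Qed.

Lemma open_chart_im c : open (chart_im c).
Proof. exact: chart_im_open. Qed.

Lemma open_in_chart c (A : set S) : open A -> open [set w | chart_im c w /\ A (chart_inv c w)].
Proof.
move=> oA; rewrite openE => w [iw Aw]; apply: filterI.
  by apply: open_nbhs_nbhs; split => //; exact: open_chart_im.
exact: (chart_inv_continuous iw (open_nbhs_nbhs (conj oA Aw))).
Qed.

Lemma open_pull_chart c (A : set P) : open A -> open [set a | chart_dom c a /\ A (chart_map c a)].
Proof.
move=> oA; rewrite openE => a [da Aa]; apply: filterI.
  by apply: open_nbhs_nbhs; split => //; exact: chart_dom_open.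
exact: (chart_map_continuous da (open_nbhs_nbhs (conj oA Aa))).
Qed.

Definition transition c c' : P -> P := chart_map c' \o chart_inv c.

Definition overlap c c' : set P := [set w | chart_im c w /\ chart_dom c' (chart_inv c w)].

Lemma open_overlap c c' : open (overlap c c').
Proof. by apply: open_in_chart; exact: chart_dom_open. Qed.

Lemma smooth_transition c c' : atlas c -> atlas c' -> smooth_on (overlap c c') (transition c c').
Proof.
move=> ac ac'; apply: smooth_sub (atlas_smooth ac ac') => w [iw dw].
by have [d1 e1] := chart_imP iw; exists (chart_inv c w).
Qed.

Lemma derive_transition c c' (f : S -> V3) (g : P -> V3) (O : set P) w v :
  atlas c -> atlas c' -> open O -> O w ->
  (forall w', O w' -> overlap c c' w' /\ f (chart_inv c w') = g (transition c c' w')) ->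
  differentiable g (transition c c' w) ->
  'D_v (f \o chart_inv c) w = 'D_('D_v (transition c c') w) g (transition c c' w).
Proof.
move=> ac ac' oO Ow H dg.
rewrite -(derive_comp v _ dg); last first.
  by apply: (smooth_differentiable (smooth_transition ac ac')); have [] := H w Ow.
by apply: (derive_eq_open v oO Ow) => w' Ow'; have [] := H w' Ow'.
Qed.

(** The differential of a map in one chart is that in another chart composed with the differential of
    the transition map. *)
Lemma derive_change_chart c c' (f : S -> V3) a v : atlas c -> atlas c' -> smooth_map f ->
  chart_dom c a -> chart_dom c' a ->
  'D_v (f \o chart_inv c) (chart_map c a) =
  'D_('D_v (transition c c') (chart_map c a)) (f \o chart_inv c') (chart_map c' a).
Proof.
move=> ac ac' sf da da'.
have tr : transition c c' (chart_map c a) = chart_map c' a by rewrite /transition /= chart_mapK.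
have Ow : overlap c c' (chart_map c a).
  by split; [exact: chart_im_map|rewrite /= chart_mapK].
have H w' : overlap c c' w' -> overlap c c' w' /\
    f (chart_inv c w') = (f \o chart_inv c') (transition c c' w').
  by move=> [i1 d1]; split => //=; rewrite /transition /= chart_mapK.
have dg : differentiable (f \o chart_inv c') (transition c c' (chart_map c a)).
  by rewrite tr; apply: (smooth_differentiable (sf _ ac')); exact: chart_im_map.
by rewrite (derive_transition v ac ac' (@open_overlap c c') Ow H dg) tr.
Qed.

End Charts.

Section SmoothScale.
Context {R : realType} {V : normedModType R}.
Lemma smooth_scale n (U : set V) (f : V -> R^o) (g : V -> 'rV[R]_n) : open U ->
  smooth_on U f -> smooth_on U g -> smooth_on U (fun v => f v *: g v).
Proof.
move=> oU sf sg; apply: (smooth_row oU) => i.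
apply: (@smooth_eq _ _ _ _ (fun v => f v * g v 0 i : R^o) _ oU).
  by move=> v _; rewrite mxE.
exact: (smoothM oU sf (smooth_coord i oU sg)).
Qed.

Lemma smooth_normalize (U : set V) (g : V -> 'rV[R]_3) : open U ->
  smooth_on U g -> (forall v, U v -> g v != 0) -> smooth_on U (fun v => (enorm (g v))^-1 *: g v).
Proof.
move=> oU sg g0; apply: (smooth_scale oU _ sg).
apply: (smoothV oU); last exact: smooth_enorm.
by move=> v Uv; exact: (lt0r_neq0 (enorm_gt0 (g0 v Uv))).
Qed.
End SmoothScale.

Section GraphVariation.
Context {R : realType} {S : surface R}.
Notation P := (R * R)%type.
Notation V3 := 'rV[R]_3.
Notation dl l := (delta_mx 0 l : V3).
Variables (X nu : S -> V3) (c : chart R S) (U : set P) (i j k : 'I_3) (eps : R).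
Hypotheses (X_imm : immersion X) (nu_normal : unit_normal_field X nu) (ac : atlas c).
Hypotheses (oU : open U) (UI : U `<=` chart_im c).
Hypotheses (ij : i != j) (ik : i != k) (jk : j != k) (eps1 : eps ^+ 2 = 1).
Notation Xc := (X \o chart_inv c).
Notation Nc := (nu \o chart_inv c).
Notation x := (coord_fun Xc i).
Notation y := (coord_fun Xc j).
Notation z := (coord_fun Xc k).
Notation J := (jacobian2 x y).
Hypothesis Jp : forall w, U w -> 0 < J w.
Hypothesis side : forall w, U w -> 0 < eps * Nc w 0 k.
Notation p := (slope1 x y z).
Notation q := (slope2 x y z).
Notation D1 := (d1 x y).
Notation D2 := (d2 x y).
Notation n := (graph_normal i j k eps).

Lemma eps_neq0 : eps != 0.
Proof. by apply: contraTneq isT => e0; move: eps1; rewrite e0 expr0n => /eqP; rewrite eq_sym oner_eq0. Qed.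

Lemma chart_jac_neq0 w : U w -> J w != 0. Proof. by move=> Uw; rewrite gt_eqF// Jp. Qed.

Lemma smooth_Xc : smooth_on U Xc.
Proof. by apply: smooth_sub UI _; exact: X_imm.1. Qed.
Lemma smooth_Nc : smooth_on U Nc.
Proof. by apply: smooth_sub UI _; case: nu_normal => sn _ _; exact: sn. Qed.
Lemma Nc_unit w : U w -> sphere (Nc w).
Proof. by move=> _; case: nu_normal => _ sn _; exact: sn. Qed.
Lemma Nc_orth w v : U w -> dot ('D_v Xc w) (Nc w) = 0.
Proof. by move=> Uw; case: nu_normal => _ _ H; exact: (H c ac w (UI Uw) v). Qed.

Let sx : smooth_on U x := smooth_coord i oU smooth_Xc.
Let sy : smooth_on U y := smooth_coord j oU smooth_Xc.
Let sz : smooth_on U z := smooth_coord k oU smooth_Xc.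
Let spp : smooth_on U p := smooth_slope1 oU sx sy sz chart_jac_neq0.
Let sqq : smooth_on U q := smooth_slope2 oU sx sy sz chart_jac_neq0.

Variables (w0 : P) (e : R).
Hypotheses (e0 : 0 < e) (BU : box w0 e `<=` U).
Notation phi := (bump w0 e).

Definition lifted_chart (t : R) (w : P) : V3 := Xc w + (t * phi w) *: dl k.
Definition lifted_slopes (t : R) (w : P) : P := (p w + t * D1 phi w, q w + t * D2 phi w).
Definition lifted_normal (t : R) (w : P) : V3 :=
  (enorm (n (lifted_slopes t w)))^-1 *: n (lifted_slopes t w).

Let sphi : smooth_on U phi := smooth_sub (@subsetT _ U) (smooth_bump w0 e).
Let s1phi : smooth_on U (D1 phi) := smooth_d1 oU sx sy chart_jac_neq0 sphi.
Let s2phi : smooth_on U (D2 phi) := smooth_d2 oU sx sy chart_jac_neq0 sphi.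

Definition graph_domain : set S := [set a | chart_dom c a /\ U (chart_map c a)].
Definition surface_bump (a : S) : R := if `[< chart_dom c a >] then phi (chart_map c a) else 0.
(** The surface is moved in the direction of the k-th axis. The coordinates x and y, hence the jacobian,
    do not change, so that every surface of the family is still a graph in the chart and in
    particular immersed, whatever the size of t. *)
Definition lifted (t : R) (a : S) : V3 := X a + (t * surface_bump a) *: dl k.
Definition lifted_nu (t : R) (a : S) : V3 :=
  if `[< graph_domain a >] then lifted_normal t (chart_map c a) else nu a.
Definition lift_support : set S := chart_inv c @` box w0 e.

Lemma graph_domain_inv w : U w -> graph_domain (chart_inv c w).
Proof. by move=> Uw; have [d E] := chart_imP (UI Uw); split => //; rewrite E. Qed.

Lemma open_graph_domain : open graph_domain.
Proof. exact: open_pull_chart. Qed.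

Lemma compact_lift_support : compact lift_support.
Proof.
apply: continuous_compact; last exact: compact_box.
apply/subspace_continuousP => w Bw; apply: cvg_within_filter.
exact: (chart_inv_continuous (UI (BU Bw))).
Qed.

Lemma open_off_support : open (~` lift_support).
Proof.
by apply: closed_openC; apply: compact_closed; [exact: surface_hausdorff|exact: compact_lift_support].
Qed.

Lemma support_graph_domain a : lift_support a -> graph_domain a.
Proof. by move=> [w Bw <-]; apply: graph_domain_inv; exact: BU. Qed.

Lemma box_of_dom a : chart_dom c a -> box w0 e (chart_map c a) -> lift_support a.
Proof. by move=> da B; exists (chart_map c a) => //; exact: chart_mapK. Qed.

Lemma bump_off_box w : ~ box w0 e w -> phi w = 0.
Proof.
move=> nB; apply: bump_out => // /boxP H; apply: nB; exact: (ltW H).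
Qed.

Lemma surface_bump_off a : ~ lift_support a -> surface_bump a = 0.
Proof.
move=> nK; rewrite /surface_bump; case: asboolP => // da.
by apply: bump_off_box => B; apply: nK; exact: box_of_dom.
Qed.

Lemma lifted_off t a : ~ lift_support a -> lifted t a = X a.
Proof. by move=> nK; rewrite /lifted surface_bump_off// mulr0 scale0r addr0. Qed.

Lemma lifted_normal_eq t w : U w -> t * D1 phi w = 0 -> t * D2 phi w = 0 -> lifted_normal t w = Nc w.
Proof.
move=> Uw E1 E2; rewrite /lifted_normal /lifted_slopes E1 E2 !addr0.
by rewrite (normal_graph oU smooth_Xc ij ik jk eps1 chart_jac_neq0 Nc_unit Nc_orth side Uw).
Qed.

Lemma open_off_box : open (~` box w0 e).
Proof.
by apply: closed_openC; apply: compact_closed; [exact: norm_hausdorff|exact: compact_box].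
Qed.

Lemma D_bump_off w : ~ box w0 e w -> D1 phi w = 0 /\ D2 phi w = 0.
Proof.
move=> nB; have H v : (~` box w0 e) v -> phi v = (fun _ => 0 : R^o) v by exact: bump_off_box.
split.
  by rewrite (D1_eq x y open_off_box nB H) D1_cst.
by rewrite (D2_eq x y open_off_box nB H) D2_cst.
Qed.

Lemma lifted_nu_off t a : ~ lift_support a -> lifted_nu t a = nu a.
Proof.
move=> nK; rewrite /lifted_nu; case: asboolP => // -[da Ua].
have nB : ~ box w0 e (chart_map c a) by move=> B; apply: nK; exact: box_of_dom.
have [E1 E2] := D_bump_off nB.
by rewrite lifted_normal_eq ?E1 ?E2 ?mulr0//= chart_mapK.
Qed.

Lemma lifted0 : lifted 0 = X.
Proof. by apply/funext => a; rewrite /lifted mul0r scale0r addr0. Qed.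

Lemma lifted_nu0 : lifted_nu 0 = nu.
Proof.
apply/funext => a; rewrite /lifted_nu; case: asboolP => // -[da Ua].
by rewrite lifted_normal_eq ?mul0r//= chart_mapK.
Qed.

Lemma lifted_in t a : graph_domain a -> lifted t a = lifted_chart t (chart_map c a).
Proof.
move=> [da Ua]; rewrite /lifted /surface_bump /lifted_chart /= chart_mapK//.
by case: asboolP.
Qed.

Lemma lifted_nu_in t a : graph_domain a -> lifted_nu t a = lifted_normal t (chart_map c a).
Proof. by move=> ga; rewrite /lifted_nu; case: asboolP. Qed.

Lemma smooth_lifted_chart t : smooth_on U (lifted_chart t).
Proof.
apply: (smoothD oU smooth_Xc); apply: (smoothZl (f := fun w => t * phi w : R^o) _ oU).
exact: (smoothM oU (smooth_cst U (t : R^o)) sphi).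
Qed.

Lemma lifted_coord t : [/\ coord_fun (lifted_chart t) i = x, coord_fun (lifted_chart t) j = y &
  coord_fun (lifted_chart t) k = fun w => z w + t * phi w].
Proof.
by split; apply/funext => w; rewrite /coord_fun /lifted_chart !mxE eqxx /= ?(negPf ik) ?(negPf jk)
  ?eqxx ?mulr0 ?addr0 ?mulr1.
Qed.

Lemma lifted_slope t w : U w -> slope1 x y (coord_fun (lifted_chart t) k) w = (lifted_slopes t w).1 /\
  slope2 x y (coord_fun (lifted_chart t) k) w = (lifted_slopes t w).2.
Proof.
move=> Uw; have [_ _ ->] := lifted_coord t; rewrite /slope1 /slope2 /lifted_slopes /=.
have st : smooth_on U (fun w => t : R^o) := smooth_cst U (t : R^o).
rewrite (D1_add x y Uw sz (smoothM oU st sphi)) (D2_add x y Uw sz (smoothM oU st sphi)).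
rewrite (D1_mul x y Uw st sphi) (D2_mul x y Uw st sphi) D1_cst D2_cst !mulr0 !addr0.
by [].
Qed.

Lemma lifted_jac_neq0 t w : U w ->
  jacobian2 (coord_fun (lifted_chart t) i) (coord_fun (lifted_chart t) j) w != 0.
Proof. by have [-> -> _] := lifted_coord t; exact: chart_jac_neq0. Qed.

Lemma lifted_chart_orthogonal t w v : U w -> dot ('D_v (lifted_chart t) w) (lifted_normal t w) = 0.
Proof.
move=> Uw; rewrite /lifted_normal dotZr.
have := graph_normal_orthogonal eps oU (smooth_lifted_chart t) ij ik jk (@lifted_jac_neq0 t) v Uw.
have [E1 E2 E3] := lifted_coord t; have [F1 F2] := lifted_slope t Uw.
by rewrite E1 E2 F1 F2 => ->; rewrite mulr0.
Qed.

Lemma lifted_chart_immersive t w v : U w -> 'D_v (lifted_chart t) w = 0 -> v = 0.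
Proof.
move=> Uw; exact: (graph_map_immersive oU (smooth_lifted_chart t) (@lifted_jac_neq0 t) Uw).
Qed.

Lemma normal_neq0 w : n w != 0.
Proof. exact: (graph_normal_neq0 ij ik jk eps_neq0). Qed.

Lemma lifted_area t w : U w ->
  area_density (lifted t) c w = J w * enorm (n (lifted_slopes t w)).
Proof.
move=> Uw.
have E v : 'D_v (lifted t \o chart_inv c) w = 'D_v (lifted_chart t) w.
  apply: (derive_eq_open v oU Uw) => u Uu; rewrite /= (lifted_in t (graph_domain_inv Uu)).
  by have [_ ->] := chart_imP (UI Uu).
rewrite /area_density /chart_gram.
have -> : (\matrix_(a < 2, b < 2) dot ('D_(basis_vec a) (lifted t \o chart_inv c) w)
     ('D_(basis_vec b) (lifted t \o chart_inv c) w)) =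
   \matrix_(a < 2, b < 2) dot ('D_(basis_vec a : P) (lifted_chart t) w) ('D_(basis_vec b : P) (lifted_chart t) w).
  by apply/matrixP => a b; rewrite !mxE !E.
rewrite (gram_det oU (smooth_lifted_chart t) ij ik jk eps1 (@lifted_jac_neq0 t) Uw).
have [E1 E2 E3] := lifted_coord t; have [F1 F2] := lifted_slope t Uw.
rewrite E1 E2 F1 F2 -surjective_pairing -exprMn sqrtr_sqr ger0_norm//.
apply: mulr_ge0; first exact: (ltW (Jp Uw)).
exact: (ltW (enorm_gt0 (normal_neq0 _))).
Qed.

(** The area density is the jacobian times the norm of [graph_normal], which is absorbed by the
    1-homogeneous extension of the integrand. *)
Lemma lifted_energy (gamma : V3 -> R) t :
  aniso_energy gamma (lifted t) (lifted_nu t) (fun _ : 'I_1 => c) lift_support =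
  graph_energy x y z (graph_integrand gamma i j k eps) w0 e t.
Proof.
rewrite /aniso_energy /surface_integral big_ord1 /graph_energy.
have -> : chart_map c @` ((lift_support `&` chart_dom c) `\`
    \bigcup_(j0 in [set j0 : 'I_1 | (j0 < (ord0 : 'I_1))%N]) chart_dom c) = box w0 e.
  apply/seteqP; split=> [w [a [[[v Bv <-] _] _] <-]|w Bw].
    by have [_ ->] := chart_imP (UI (BU Bv)).
  have [d1 E] := chart_imP (UI (BU Bw)).
  exists (chart_inv c w) => //; split; first by split => //; exists w.
  by move=> [].
apply: eq_Rintegral => w; rewrite inE => Bw; have Uw := BU Bw.
have [_ E] := chart_imP (UI Uw).
rewrite /= (lifted_nu_in t (graph_domain_inv Uw)) E (lifted_area t Uw).
rewrite /lifted_normal /varied_density /graph_integrand /hom_ext /radial -/(lifted_slopes t w).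
by rewrite mulrC mulrA.
Qed.

Notation T3 := (R * P)%type.

Let findimP : findim P := findim_pair findim_R findim_R.
Let findimT : findim T3 := findim_pair findim_R findimP.

Lemma smooth_lifted_joint : smooth_on [set u : T3 | U u.2] (fun u : T3 => lifted_chart u.1 u.2) /\
  smooth_on [set u : T3 | U u.2] (fun u : T3 => lifted_normal u.1 u.2).
Proof.
set U3 := [set u : T3 | U u.2].
have oU3 : open U3 by apply: open_comp => // u _; exact: cvg_snd.
have s2 : smooth_on U3 snd by exact: smooth_snd.
have s1 : smooth_on U3 (fst : T3 -> R^o) by exact: smooth_fst.
have lift (W : normedModType R) (f : P -> W) : findim W -> smooth_on U f -> smooth_on U3 (fun u => f u.2).
  move=> fW sf; apply: (@smooth_comp _ _ _ _ U3 U snd f) => //.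
have sX := lift _ _ (findim_rV 3) smooth_Xc.
have sb := lift _ _ findim_R sphi.
have sb1 := lift _ _ findim_R s1phi; have sb2 := lift _ _ findim_R s2phi.
have sp3 := lift _ _ findim_R spp; have sq3 := lift _ _ findim_R sqq.
split.
  apply: (smoothD oU3 sX); apply: (smoothZl (f := fun u : T3 => u.1 * phi u.2 : R^o) _ oU3).
  exact: (smoothM oU3 s1 sb).
apply: (smooth_normalize oU3); last by move=> u _; exact: normal_neq0.
apply: (@smooth_comp _ _ _ _ U3 setT (fun u : T3 => lifted_slopes u.1 u.2) n).
- exact: findimP.
- exact: findim_rV.
- exact: oU3.
- exact: openT.
- by [].
- exact: (smooth_pair oU3 (smoothD oU3 sp3 (smoothM oU3 s1 sb1)) (smoothD oU3 sq3 (smoothM oU3 s1 sb2))).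
- exact: smooth_graph_normal.
Qed.

(** The graph domain and the complement of the compact support are two open sets covering the surface.
    On the first one regularity is transported from the given chart by the transition map, on the
    second one nothing depends on t. *)
Lemma smooth_glue (f : R -> S -> V3) (g : R -> P -> V3) (h : S -> V3) c' : atlas c' ->
  smooth_map h ->
  smooth_on [set u : T3 | U u.2] (fun u : T3 => g u.1 u.2) ->
  (forall t a, graph_domain a -> f t a = g t (chart_map c a)) ->
  (forall t a, ~ lift_support a -> f t a = h a) ->
  smooth_on [set u : T3 | chart_im c' u.2] (fun u : T3 => f u.1 (chart_inv c' u.2)).
Proof.
move=> ac' sh sg fg fh; apply: smooth_local => u iu.
have cs : continuous (snd : T3 -> P) by move=> v; exact: cvg_snd.
have [K|nK] := pselect (lift_support (chart_inv c' u.2)).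
  pose O := [set w | chart_im c' w /\ graph_domain (chart_inv c' w)].
  have oO : open O by apply: open_in_chart; exact: open_graph_domain.
  have oO3 : open [set v : T3 | O v.2] by apply: open_comp.
  exists [set v : T3 | O v.2]; split => //.
    by split => //; exact: support_graph_domain.
  apply: (@smooth_eq _ _ _ _ (fun v : T3 => g (v.1, transition c' c v.2).1 (v.1, transition c' c v.2).2) _ oO3).
    by move=> v [_ gd]; rewrite (fg _ _ gd).
  apply: (@smooth_comp _ _ _ _ [set v : T3 | O v.2] [set u : T3 | U u.2]
    (fun v : T3 => (v.1, transition c' c v.2)) (fun v : T3 => g v.1 v.2)).
  - exact: findimT.
  - exact: findim_rV.
  - exact: oO3.
  - by apply: open_comp.
  - by move=> v [_ []].
  - apply: (smooth_pair oO3); first exact: smooth_fst.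
    apply: (@smooth_comp _ _ _ _ [set v : T3 | O v.2] (overlap c' c) snd (transition c' c)).
    + exact: findimP.
    + exact: findimP.
    + exact: oO3.
    + exact: open_overlap.
    + by move=> v [iv [dv _]].
    + exact: smooth_snd.
    + exact: smooth_transition.
  - exact: sg.
pose O := [set w | chart_im c' w /\ (~` lift_support) (chart_inv c' w)].
have oO : open O by apply: open_in_chart; exact: open_off_support.
have oO3 : open [set v : T3 | O v.2] by apply: open_comp.
exists [set v : T3 | O v.2]; split => //.
apply: (@smooth_eq _ _ _ _ (fun v : T3 => (h \o chart_inv c') v.2) _ oO3).
  by move=> v [_ nv]; rewrite (fh _ _ nv).
apply: (@smooth_comp _ _ _ _ [set v : T3 | O v.2] (chart_im c') snd (h \o chart_inv c')).
- exact: findimP.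
- exact: findim_rV.
- exact: oO3.
- exact: open_chart_im.
- by move=> v [].
- exact: smooth_snd.
- exact: sh.
Qed.

Lemma smooth_lifted c' : atlas c' ->
  smooth_on [set u : T3 | chart_im c' u.2] (fun u : T3 => lifted u.1 (chart_inv c' u.2)).
Proof.
move=> ac'; apply: (smooth_glue ac' X_imm.1 smooth_lifted_joint.1).
- exact: lifted_in.
- exact: lifted_off.
Qed.

Lemma smooth_lifted_nu c' : atlas c' ->
  smooth_on [set u : T3 | chart_im c' u.2] (fun u : T3 => lifted_nu u.1 (chart_inv c' u.2)).
Proof.
move=> ac'; have [sn _ _] := nu_normal; apply: (smooth_glue ac' sn smooth_lifted_joint.2).
- exact: lifted_nu_in.
- exact: lifted_nu_off.
Qed.

Lemma smooth_slice (f : T3 -> V3) (c' : chart R S) (t : R) : smooth_on [set u : T3 | chart_im c' u.2] f ->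
  smooth_on (chart_im c') (fun w => f (t, w)).
Proof.
move=> sf; apply: (@smooth_comp _ _ _ _ (chart_im c') [set u : T3 | chart_im c' u.2] (fun w => (t, w)) f).
- exact: findimT.
- exact: findim_rV.
- exact: open_chart_im.
- by apply: open_comp; [move=> v _; exact: cvg_snd|exact: open_chart_im].
- by [].
- apply: (@smooth_pair _ _ _ _ _ (fun=> t : R^o) id (@open_chart_im _ _ c')).
    exact: smooth_cst.
  exact: smooth_id.
- exact: sf.
Qed.

(** The same dichotomy for derivatives: they are computed in the graph chart, or nothing has moved. *)
Lemma lifted_cases t (c' : chart R S) w : atlas c' -> chart_im c' w ->
  (forall v, exists2 u, U u & [/\ 'D_v (lifted t \o chart_inv c') w = 'D_('D_v (transition c' c) w) (lifted_chart t) u,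
      'D_v (X \o chart_inv c') w = 'D_('D_v (transition c' c) w) Xc u &
      lifted_nu t (chart_inv c' w) = lifted_normal t u]) \/
  ((forall v, 'D_v (lifted t \o chart_inv c') w = 'D_v (X \o chart_inv c') w) /\
   lifted_nu t (chart_inv c' w) = nu (chart_inv c' w)).
Proof.
move=> ac' iw; have [K|nK] := pselect (lift_support (chart_inv c' w)); [left|right].
  move=> v; pose O := [set w | chart_im c' w /\ graph_domain (chart_inv c' w)].
  have oO : open O by apply: open_in_chart; exact: open_graph_domain.
  have Ow : O w by split => //; exact: support_graph_domain.
  have [_ [dw Uw]] := Ow; exists (transition c' c w) => //; split.
  - apply: (derive_transition (g := lifted_chart t) v ac' ac oO Ow).
      move=> w' [iw' gd]; split; last exact: lifted_in.
      by split => //; have [] := gd.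
    exact: (smooth_differentiable (smooth_lifted_chart t) Uw).
  - apply: (derive_transition (g := Xc) v ac' ac oO Ow).
      move=> w' [iw' [dw' _]]; split; first by split.
      by rewrite /transition /= chart_mapK.
    exact: (smooth_differentiable smooth_Xc Uw).
  - exact: lifted_nu_in.
split; last exact: lifted_nu_off.
pose O := [set w | chart_im c' w /\ (~` lift_support) (chart_inv c' w)].
have oO : open O by apply: open_in_chart; exact: open_off_support.
have Ow : O w by [].
by move=> v; apply: (derive_eq_open v oO Ow) => w' [_ nw']; exact: lifted_off.
Qed.

Lemma immersion_lifted t : immersion (lifted t).
Proof.
split=> [c' ac'|c' ac' w iw v E].
  exact: (smooth_slice t (smooth_lifted ac')).
have XI : 'D_v (X \o chart_inv c') w = 0 -> v = 0 by exact: (X_imm.2 _ ac').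
have [H|[H _]] := lifted_cases t ac' iw; last by apply: XI; rewrite -H.
have [u Uu [E1 E2 _]] := H v; apply: XI; rewrite E2.
have -> : 'D_v (transition c' c) w = 0.
  by apply: (lifted_chart_immersive (t := t) Uu); rewrite -E1.
by rewrite (derive_diff _ (smooth_differentiable smooth_Xc Uu)) linear0.
Qed.

Lemma unit_normal_lifted t : unit_normal_field (lifted t) (lifted_nu t).
Proof.
have [sn nn no] := nu_normal; split.
- by move=> c' ac'; exact: (smooth_slice t (smooth_lifted_nu ac')).
- move=> a; rewrite /lifted_nu; case: asboolP => // _.
  have N0 := enorm_gt0 (normal_neq0 (lifted_slopes t (chart_map c a))).
  by rewrite /sphere /= /lifted_normal enormZ ?invr_gt0// mulVf// gt_eqF.
- move=> c' ac' w iw v.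
  have [H|[H ->]] := lifted_cases t ac' iw; last by rewrite H; exact: no.
  by have [u Uu [-> _ ->]] := H v; exact: lifted_chart_orthogonal.
Qed.

Lemma variation_lifted : Defs.variation X nu 1 lift_support lifted lifted_nu.
Proof.
split.
- by split; [exact: ltr01|exact: compact_lift_support].
- by split; [exact: lifted0|exact: lifted_nu0].
- by move=> t a _; exact: lifted_off.
- by move=> t _; split; [exact: immersion_lifted|exact: unit_normal_lifted].
- move=> c' ac' D; split.
    by apply: smooth_sub (smooth_lifted ac') => u [].
  by apply: smooth_sub (smooth_lifted_nu ac') => u [].
Qed.

Lemma stationary_graph_energy (gamma : V3 -> R) : aniso_minimal gamma X nu ->
  is_derive (0 : R^o) (1 : R^o)
    (graph_energy x y z (graph_integrand gamma i j k eps) w0 e : R^o -> R^o) 0.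
Proof.
move=> min; have cov : chart_cover lift_support (fun _ : 'I_1 => c).
  split=> // a /support_graph_domain[da _]; by exists ord0.
have := min _ _ _ _ variation_lifted _ _ cov.
by under eq_fun do rewrite lifted_energy.
Qed.

End GraphVariation.

(** * Degenerate points of the Gauss map *)
Section GraphCharts.
Context {R : realType} {S : surface R}.
Notation P := (R * R)%type.
Notation V3 := 'rV[R]_3.
Variables (X nu : S -> V3).
Hypotheses (X_imm : immersion X) (nu_normal : unit_normal_field X nu).
Implicit Types (c : chart R S) (a b : S) (U : set P).

Definition graph_chart c U (i j k : 'I_3) (eps : R) : Prop :=
  [/\ open U, U `<=` chart_im c, [/\ i != j, i != k & j != k], eps ^+ 2 = 1 &
   forall w, U w -> 0 < jacobian2 (coord_fun (X \o chart_inv c) i) (coord_fun (X \o chart_inv c) j) w /\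
     0 < eps * (nu \o chart_inv c) w 0 k].

Lemma det_opp2 (A : 'M[R]_2) : \det (- A) = \det A.
Proof. by rewrite !det2 !mxE !mulrNN. Qed.

Lemma other_two (k : 'I_3) : exists i j : 'I_3, [/\ i != j, i != k & j != k].
Proof.
case: k => -[|[|[|//]]] H.
- by exists 1, 2.
- by exists 0, 2.
- by exists 0, 1.
Qed.

(** Where the normal is not horizontal, the horizontal projection of the immersion is a local
    diffeomorphism. *)
Lemma horizontal_jacobian_neq0 c w (i j k : 'I_3) : atlas c -> chart_im c w ->
  i != j -> i != k -> j != k -> (nu \o chart_inv c) w 0 k != 0 ->
  jacobian2 (coord_fun (X \o chart_inv c) i) (coord_fun (X \o chart_inv c) j) w != 0.
Proof.
move=> ac iw ij ik jk nk; apply/negP => /eqP J0.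
set Xc := X \o chart_inv c in J0 *; set x := coord_fun Xc i in J0; set y := coord_fun Xc j in J0.
have sX : smooth_on (chart_im c) Xc by exact: X_imm.1.
have oI := @open_chart_im _ _ c.
have dX := smooth_differentiable sX iw.
have dx : differentiable x w := smooth_differentiable (smooth_coord i oI sX) iw.
have dy : differentiable y w := smooth_differentiable (smooth_coord j oI sX) iw.
have key (v : P) : v.1 * px x w + v.2 * py x w = 0 -> v.1 * px y w + v.2 * py y w = 0 -> v = 0.
  move=> Ex Ey; apply: (X_imm.2 _ ac _ iw).
  have Di : 'D_v Xc w 0 i = 0.
    by rewrite (derive_coord i v dX) -[LHS]/('D_v x w) (derive_xy v dx) -pxEd -pyEd.
  have Dj : 'D_v Xc w 0 j = 0.
    by rewrite (derive_coord j v dX) -[LHS]/('D_v y w) (derive_xy v dy) -pxEd -pyEd.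
  have := nu_normal; case=> _ _ /(_ c ac w iw v).
  rewrite (dot_ijk _ _ ij ik jk) Di Dj !mul0r !add0r => /eqP.
  rewrite mulf_eq0 (negPf nk) orbF => /eqP Dk.
  apply/eqP/negPn/negP => /dot_gt0; rewrite (dot_ijk _ _ ij ik jk) Di Dj Dk; lra.
have k1 : (py y w, - px y w) = 0 :> P.
  by apply: key => /=; [rewrite -J0 /jacobian2|]; ring.
have k2 : (py x w, - px x w) = 0 :> P.
  by apply: key => /=; [|rewrite -[RHS]oppr0 -J0 /jacobian2]; ring.
have [yv /eqP] := k1; rewrite oppr_eq0 => /eqP yu; have [xv /eqP] := k2; rewrite oppr_eq0 => /eqP xu.
have : ((1, 0) : P) = 0 by apply: key; rewrite /= ?yv ?yu ?xv ?xu; ring.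
by case=> /eqP; rewrite oner_eq0.
Qed.

Lemma exists_graph_chart c a : atlas c -> chart_dom c a ->
  exists U i j k eps, graph_chart c U i j k eps /\ U (chart_map c a).
Proof.
move=> ac da; have iw := chart_im_map da; set w := chart_map c a in iw *.
have [sn nn no] := nu_normal.
have [k nk] : exists k, (nu \o chart_inv c) w 0 k != 0.
  have /sphere_neq0 n0 := nn (chart_inv c w).
  apply/existsP; apply: contraNT n0 => /existsPn H; apply/eqP/rowP => l.
  by rewrite mxE; apply/eqP; have := H l; rewrite negbK.
have [i [j [ij ik jk Jp]]] : exists i j : 'I_3, [/\ i != j, i != k, j != k &
   0 < jacobian2 (coord_fun (X \o chart_inv c) i) (coord_fun (X \o chart_inv c) j) w].
  have [i [j [ij ik jk]]] := other_two k.
  have := horizontal_jacobian_neq0 ac iw ij ik jk nk; rewrite neq_lt => /orP[Jn|Jp].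
    exists j, i; split => //; first by rewrite eq_sym.
    by rewrite -oppr_lt0; apply: le_lt_trans Jn; rewrite le_eqVlt /jacobian2; apply/orP; left; apply/eqP; ring.
  by exists i, j.
pose eps := Num.sg ((nu \o chart_inv c) w 0 k).
have side : 0 < eps * (nu \o chart_inv c) w 0 k by rewrite /eps -normrEsg normr_gt0.
have sX : smooth_on (chart_im c) (X \o chart_inv c) by exact: X_imm.1.
have sN : smooth_on (chart_im c) (nu \o chart_inv c) by exact: sn.
have oI := @open_chart_im _ _ c.
have sJ := smooth_jac oI (smooth_coord i oI sX) (smooth_coord j oI sX).
have se : smooth_on (chart_im c) (fun w => eps * (nu \o chart_inv c) w 0 k : R^o).
  exact: (smoothM oI (smooth_cst _ (eps : R^o)) (smooth_coord k oI sN)).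
exists ([set w | chart_im c w /\ 0 < jacobian2 (coord_fun (X \o chart_inv c) i) (coord_fun (X \o chart_inv c) j) w]
  `&` [set w | chart_im c w /\ 0 < eps * (nu \o chart_inv c) w 0 k]), i, j, k, eps.
split; last by split.
split => //.
- apply: openI; exact: open_gt0.
- by move=> w' [[]].
- by rewrite /eps sqr_sg nk.
- by move=> w' [[_ H1] [_ H2]].
Qed.

Section InGraphChart.
Variables (c : chart R S) (U : set P) (i j k : 'I_3) (eps : R).
Hypotheses (ac : atlas c) (gc : graph_chart c U i j k eps).
Notation Xc := (X \o chart_inv c).
Notation Nc := (nu \o chart_inv c).
Notation x := (coord_fun Xc i).
Notation y := (coord_fun Xc j).
Notation z := (coord_fun Xc k).
Notation h := (hdet x y z).

Let oU : open U. Proof. by case: gc. Qed.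
Let UI : U `<=` chart_im c. Proof. by case: gc. Qed.
Let ij : i != j. Proof. by case: gc => _ _ []. Qed.
Let ik : i != k. Proof. by case: gc => _ _ []. Qed.
Let jk : j != k. Proof. by case: gc => _ _ []. Qed.
Let eps1 : eps ^+ 2 = 1. Proof. by case: gc. Qed.
Let Jp w : U w -> 0 < jacobian2 x y w. Proof. by case: gc => _ _ _ _ H /H[]. Qed.
Let side w : U w -> 0 < eps * Nc w 0 k. Proof. by case: gc => _ _ _ _ H /H[]. Qed.
Let Jn w : U w -> jacobian2 x y w != 0. Proof. by move=> Uw; rewrite gt_eqF// Jp. Qed.
Let sX : smooth_on U Xc := smooth_Xc X_imm ac UI.
Let sN : smooth_on U Nc := smooth_Nc nu_normal ac UI.
Let Nu w : U w -> sphere (Nc w) := @Nc_unit _ _ _ _ c U nu_normal w.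
Let No w v : U w -> dot ('D_v Xc w) (Nc w) = 0 := @Nc_orth _ _ _ _ c U nu_normal ac UI w v.
Let sx : smooth_on U x := smooth_coord i oU sX.
Let sy : smooth_on U y := smooth_coord j oU sX.
Let sz : smooth_on U z := smooth_coord k oU sX.

Lemma kernel_hdet w : U w -> h w = 0 <-> exists2 v : P, v != 0 & 'D_v Nc w = 0.
Proof. exact: (gauss_kernel oU sX ij ik jk Jn sN Nu No side). Qed.

Lemma invertible_hdet a : chart_dom c a -> U (chart_map c a) ->
  gauss_differential_invertible nu c a <-> h (chart_map c a) != 0.
Proof.
move=> da Uw; split=> [inv|h0 u tu].
  apply/negP => /eqP /(kernel_hdet Uw) [v v0 E].
  have [|v1 [E1 uniq_]] := inv 0; first by rewrite /sphere_tangent /= /dot big1// => l _; rewrite mxE mul0r.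
  have Z : 'D_(0 : P) Nc (chart_map c a) = 0.
    by rewrite (derive_diff _ (smooth_differentiable sN Uw)) linear0.
  by move/eqP: v0; apply; rewrite -(uniq_ _ E) (uniq_ _ Z).
apply: (gauss_invertible oU sX ij ik jk Jn sN Nu No side Uw h0).
by rewrite /= chart_mapK.
Qed.

Lemma curvature_hdet a : chart_dom c a -> U (chart_map c a) ->
  gauss_curvature X nu c a = 0 <-> h (chart_map c a) = 0.
Proof.
move=> da Uw; set w := chart_map c a in Uw *.
rewrite /gauss_curvature -/w /shape_matrix det_mulmx det_inv.
have dG : \det (chart_gram X X c w) != 0.
  rewrite /chart_gram (gram_det oU sX ij ik jk eps1 Jn Uw).
  have n0 := graph_normal_neq0 ij ik jk (eps_neq0 eps1) (slope1 x y z w, slope2 x y z w).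
  by rewrite mulf_neq0// sqrf_eq0 ?(negPf (Jn Uw))// gt_eqF// enorm_gt0.
have dN : \det (- chart_gram X nu c w) = \det (chart_gram X nu c w).
  exact: det_opp2.
rewrite dN /chart_gram (second_form_det oU sX ij ik jk Jn sN No Uw).
have m0 : (coord_fun Nc k w * jacobian2 x y w) ^+ 2 != 0.
  by rewrite sqrf_eq0 mulf_neq0 ?Jn// (mu_neq0 side Uw).
split=> [/eqP|->]; last by rewrite mulr0 mulr0.
by rewrite !mulf_eq0 invr_eq0 (negPf dG) /= oppr_eq0 (negPf m0) => /eqP.
Qed.

Section Minimal.
Variable gamma : V3 -> R.
Hypotheses (gamma_smooth : sphere_smooth gamma) (gamma_convex : convex_integrand gamma).
Hypothesis X_minimal : aniso_minimal gamma X nu.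
Notation G := (graph_integrand gamma i j k eps).

Let e0 : eps != 0 := eps_neq0 eps1.
Let sG : smooth_on setT G := smooth_graph_integrand gamma_smooth ij ik jk e0.
Let GH w := graph_integrand_hess gamma_smooth gamma_convex ij ik jk e0 w.

Lemma graph_euler_lagrange w : U w ->
  coef x y z (px (px G)) w * hess11 x y z w + 2 * coef x y z (px (py G)) w * hess12 x y z w
  + coef x y z (py (py G)) w * hess22 x y z w = 0.
Proof.
apply: (euler_lagrange oU sx sy sz Jp sG).
  exact: (graph_integrand_tangent gamma_smooth gamma_convex ij ik jk e0).
move=> w0 e ep BU.
exact: (stationary_graph_energy X_imm nu_normal ac oU UI ij ik jk eps1 Jp side ep BU X_minimal).
Qed.

Lemma graph_hdet_zero_near w : U w ->
  (forall e : R, 0 < e -> forall N, exists s : seq P,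
     [/\ uniq s, size s = N & forall v, v \in s -> ball w e v /\ h v = 0]) ->
  \forall v \near w, h v = 0.
Proof.
move=> Uw; apply: (hdet_zero_near oU sx sy sz Jn sG _ _ graph_euler_lagrange Uw).
  by move=> v _; have [] := GH (slope1 x y z v, slope2 x y z v).
by move=> v _; have [] := GH (slope1 x y z v, slope2 x y z v).
Qed.

(** Where the Hessian determinant vanishes the Euler-Lagrange equation forces the whole Hessian to
    vanish, so that the Gauss map is stationary in every direction. *)
Lemma graph_normal_derive0 w v : U w -> h w = 0 -> 'D_v Nc w = 0.
Proof.
move=> Uw hw.
have a0 v' : U v' -> 0 < coef x y z (px (px G)) v' by move=> _; have [] := GH (slope1 x y z v', slope2 x y z v').
have d0 v' : U v' -> 0 < coef x y z (px (px G)) v' * coef x y z (py (py G)) v' - coef x y z (px (py G)) v' ^+ 2.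
  by move=> _; have [] := GH (slope1 x y z v', slope2 x y z v').
have [r0 s0 t0] := hdet_eq0 a0 d0 graph_euler_lagrange Uw hw.
have dp := smooth_differentiable (smooth_slope1 oU sx sy sz Jn) Uw.
have dq := smooth_differentiable (smooth_slope2 oU sx sy sz Jn) Uw.
have p2 := d2_slope1 oU sx sy sz Jn Uw.
have [Dp Dq] := slope_derive k oU sX Jn v Uw.
apply: (normal_derive_eq oU sX ij ik jk Jn sN Nu No side Uw).
- by rewrite /dot big1// => l _; rewrite mxE mul0r.
- rewrite Dp (pxE Jn Uw dp) (pyE Jn Uw dp) p2 s0.
  rewrite (_ : d1 x y (slope1 x y z) w = 0); last exact: r0.
  by rewrite !mxE; ring.
- rewrite Dq (pxE Jn Uw dq) (pyE Jn Uw dq).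
  rewrite (_ : d1 x y (slope2 x y z) w = 0); last exact: s0.
  rewrite (_ : d2 x y (slope2 x y z) w = 0); last exact: t0.
  by rewrite !mxE; ring.
Qed.

End Minimal.
End InGraphChart.
End GraphCharts.

(** * From local to global *)
Section Global.
Context {R : realType} {S : surface R}.
Notation P := (R * R)%type.
Notation V3 := 'rV[R]_3.
Variables (X nu : S -> V3).
Hypotheses (X_imm : immersion X) (nu_normal : unit_normal_field X nu).
Implicit Types (c : chart R S) (a b : S).

(** Degeneracy as a kernel vector, the form in which it is seen not to depend on the chart. *)
Definition degenerate c a : Prop :=
  exists2 v : P, v != 0 & 'D_v (nu \o chart_inv c) (chart_map c a) = 0.

Lemma degenerate_chart c c' a : atlas c -> atlas c' -> chart_dom c a -> chart_dom c' a ->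
  degenerate c a -> degenerate c' a.
Proof.
move=> ac ac' da da' [v v0 E]; have [sn _ _] := nu_normal.
exists ('D_v (transition c c') (chart_map c a)).
  apply/negP => /eqP E0; move/eqP: v0; apply; apply: (X_imm.2 _ ac _ (chart_im_map da)).
  rewrite (derive_change_chart v ac ac' X_imm.1 da da') E0.
  by rewrite (derive_diff _ (smooth_differentiable (X_imm.1 _ ac') (chart_im_map da'))) linear0.
by rewrite -(derive_change_chart v ac ac' sn da da').
Qed.

Lemma not_invertible_degenerate c a : atlas c -> chart_dom c a ->
  ~ gauss_differential_invertible nu c a <-> degenerate c a.
Proof.
move=> ac da; have [U [i [j [k [eps [gc Ua]]]]]] := exists_graph_chart X_imm nu_normal ac da.
have I := invertible_hdet X_imm nu_normal ac gc da Ua.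
have K := kernel_hdet X_imm nu_normal ac gc Ua.
split=> [ni|/(proj2 K) h0 /(proj1 I)]; last by rewrite h0 eqxx.
apply/(proj1 K); apply/eqP/negPn/negP => h0; exact/ni/(proj2 I).
Qed.

Lemma criticalP c a : atlas c -> chart_dom c a -> critical_set nu a <-> degenerate c a.
Proof.
move=> ac da; split=> [[c' [ac' da' /(not_invertible_degenerate ac' da') H]]|H].
  exact: degenerate_chart H.
by exists c; split => //; exact/(not_invertible_degenerate ac da).
Qed.

Lemma critical_zero_curvature : critical_set nu = zero_curvature_set X nu.
Proof.
have E c a : atlas c -> chart_dom c a ->
    ~ gauss_differential_invertible nu c a <-> gauss_curvature X nu c a = 0.
  move=> ac da; have [U [i [j [k [eps [gc Ua]]]]]] := exists_graph_chart X_imm nu_normal ac da.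
  have K := kernel_hdet X_imm nu_normal ac gc Ua.
  have C := curvature_hdet X_imm nu_normal ac gc da Ua.
  split=> [/(not_invertible_degenerate ac da)/(proj2 K)/(proj2 C)//|].
  by move=> /(proj1 C)/(proj1 K)/(not_invertible_degenerate ac da).
by apply/seteqP; split=> a [c [ac da H]]; exists c; split => //; apply/(E c a ac da).
Qed.

Variable gamma : V3 -> R.
Hypotheses (gamma_smooth : sphere_smooth gamma) (gamma_convex : convex_integrand gamma).
Hypothesis X_minimal : aniso_minimal gamma X nu.
Notation E := (critical_set nu).

(** Infinitely many critical points near [a] give infinitely many zeros of [hdet] in a graph chart. *)
Lemma near_limit_point_critical a : limit_point E a -> \forall b \near a, E b.
Proof.
move=> la; have [c ac da] := atlas_cover a.
have [U [i [j [k [eps [gc Ua]]]]]] := exists_graph_chart X_imm nu_normal ac da.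
have oU : open U by case: gc.
have K := kernel_hdet X_imm nu_normal ac gc.
have near_chart (O : set P) : open O -> O (chart_map c a) ->
    nbhs a [set b | chart_dom c b /\ O (chart_map c b)].
  by move=> oO Oa; apply: open_nbhs_nbhs; split; [exact: open_pull_chart|].
set w := chart_map c a in Ua near_chart *.
have zeros (e : R) : 0 < e -> forall N, exists s : seq P, [/\ uniq s, size s = N &
    forall v, v \in s -> [/\ v != w, ball w e v &
      hdet (coord_fun (X \o chart_inv c) i) (coord_fun (X \o chart_inv c) j) (coord_fun (X \o chart_inv c) k) v = 0]].
  move=> e0; elim=> [|N [s [us ss Hs]]]; first by exists [::].
  pose O := U `&` ball w e `&` [set v | v \notin s].
  have oO : open O.
    apply: openI; first by apply: openI => //; exact: ball_open.
    rewrite (_ : [set v | v \notin s] = ~` [set` s]); last first.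
      by apply/seteqP; split=> v /= /negP.
    apply: closed_openC; apply: compact_closed; first exact: norm_hausdorff.
    exact/finite_compact/finite_seq.
  have Ow : O w.
    split; first by split => //; exact: ballxx.
    by apply/negP => /Hs[]; rewrite eqxx.
  have [b [ba Eb [db [[Ub Bb] nb]]]] := la _ (near_chart _ oO Ow).
  exists (chart_map c b :: s); split; first by rewrite /= us andbT.
    by rewrite /= ss.
  move=> v; rewrite inE => /predU1P[->|/Hs//]; split => //.
    apply: contra ba => /eqP E1; apply/eqP.
    by rewrite -(chart_mapK db) E1 /w chart_mapK.
  by apply/(proj2 (K _ Ub)); exact/(criticalP ac db).
have H0 := graph_hdet_zero_near X_imm nu_normal ac gc gamma_smooth gamma_convex X_minimal Ua.
have hw : \forall v \near w, hdet (coord_fun (X \o chart_inv c) i) (coord_fun (X \o chart_inv c) j)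
    (coord_fun (X \o chart_inv c) k) v = 0.
  apply: H0 => e e0 N; have [s [us ss Hs]] := zeros e e0 N.
  by exists s; split => // v /Hs[].
have nUw : nbhs w U by exact: open_nbhs_nbhs.
have [e /= e0 He] := (@nbhs_ballP _ _ w _).1 (filterI hw nUw).
have := near_chart (ball w e) (ball_open _ _) (ballxx _ e0).
apply: filterS => b [db /He [hb Ub]].
by apply/(criticalP ac db)/(proj1 (K _ Ub)).
Qed.

(** The interior of the critical set is closed: a point of its closure outside the interior would be a
    limit point of the critical set, hence interior. *)
Lemma all_critical a0 : connected [set: S] -> limit_point E a0 -> forall a, E a.
Proof.
move=> conn la0; suff H : E^° = [set: S].
  by move=> a; apply: (@interior_subset _ E a); rewrite H.
apply: conn.
- by exists a0; exact: (near_limit_point_critical la0).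
- by exists E^°; [exact: open_interior|rewrite setTI].
- exists E^°; last by rewrite setTI.
  move=> a ca; have [//|na] := pselect (E^° a).
  apply: near_limit_point_critical => V Va; have [b [Eb Vb]] := ca V Va.
  exists b; split => //; last exact: interior_subset Eb.
  by apply/eqP => ba; apply: na; rewrite -ba.
Qed.

(** The normal has zero derivative, and then so has the height above the tangent plane. *)
Lemma near_normal_constant a : (forall b, E b) ->
  \forall b \near a, nu b = nu a /\ dot (nu a) (X b) = dot (nu a) (X a).
Proof.
move=> allE; have [c ac da] := atlas_cover a.
have [U [i [j [k [eps [gc Ua]]]]]] := exists_graph_chart X_imm nu_normal ac da.
have oU : open U by case: gc.
have UI : U `<=` chart_im c by case: gc.
have sN := smooth_Nc nu_normal ac UI; have sX := smooth_Xc X_imm ac UI.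
have dN v u : U v -> 'D_u (nu \o chart_inv c) v = 0.
  move=> Uv; have [dv Ev] := chart_imP (UI v Uv).
  apply: (graph_normal_derive0 X_imm nu_normal ac gc gamma_smooth gamma_convex X_minimal u Uv).
  apply/(proj2 (kernel_hdet X_imm nu_normal ac gc Uv)).
  by have := (proj1 (criticalP ac dv)) (allE _); rewrite /degenerate Ev.
have /nbhs_ballP[e /= e0 He] : nbhs (chart_map c a) U by exact: open_nbhs_nbhs.
have wB : ball (chart_map c a) e (chart_map c a) by exact: ballxx.
have cst (f : P -> R^o) v : smooth_on U f -> (forall v u, U v -> 'D_u f v = 0) ->
    ball (chart_map c a) e v -> f v = f (chart_map c a).
  move=> sf df Bv.
  have [v' /He Uv' D] := mvt_ball (fun v Bv => smooth_differentiable sf (He v Bv)) wB Bv.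
  by apply/eqP; rewrite -subr_eq0 D df.
have Nconst v : ball (chart_map c a) e v -> (nu \o chart_inv c) v = nu a.
  move=> Bv; apply/rowP => l.
  have sl : smooth_on U (coord_fun (nu \o chart_inv c) l) := smooth_coord l oU sN.
  have dl v' u : U v' -> 'D_u (coord_fun (nu \o chart_inv c) l) v' = 0.
    by move=> Uv'; rewrite -(derive_coord l u (smooth_differentiable sN Uv')) (dN _ _ Uv') mxE.
  have := cst _ v sl dl Bv; rewrite /coord_fun /= => ->.
  by rewrite (chart_mapK da).
have oB : open [set b | chart_dom c b /\ ball (chart_map c a) e (chart_map c b)].
  by apply: open_pull_chart; exact: ball_open.
apply: filterS (open_nbhs_nbhs (conj oB (conj da wB))) => b [db Bb].
have Nb : nu b = nu a by have := Nconst _ Bb; rewrite /= chart_mapK.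
split=> //.
have sd : smooth_on U (fun v => dot ((X \o chart_inv c) v) (nu a) : R^o).
  by apply: (smooth_dot oU sX); exact: smooth_cst.
have dd v u : ball (chart_map c a) e v -> 'D_u (fun v => dot ((X \o chart_inv c) v) (nu a) : R^o) v = 0.
  move=> Bv; rewrite (derive_dot (nu a) u (smooth_differentiable sX (He v Bv))).
  rewrite -(Nconst v Bv); case: nu_normal => _ _ H; exact: (H c ac v (UI v (He v Bv)) u).
have [v' Bv' D] := mvt_ball (fun v Bv => smooth_differentiable sd (He v Bv)) wB Bb.
move: D; rewrite (dd _ _ Bv') /= !chart_mapK// => /eqP; rewrite subr_eq0 => /eqP D.
by rewrite dotC D dotC.
Qed.

(** The points sharing the normal and the height of a given point form an open and closed set. *)
Lemma planar_of_all_critical a0 : connected [set: S] -> (forall b, E b) -> planar X.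
Proof.
move=> conn allE; exists (nu a0), (dot (nu a0) (X a0)).
have [_ nn _] := nu_normal; split; first exact: sphere_neq0.
pose B : set S := [set b | nu b = nu a0 /\ dot (nu a0) (X b) = dot (nu a0) (X a0)].
suff H : B = [set: S].
  by move=> b; have [] : B b by rewrite H.
apply: conn.
- by exists a0.
- exists B; last by rewrite setTI.
  rewrite openE => b [Nb Xb]; have := near_normal_constant b allE.
  by apply: filterS => b' [N' X']; split; [rewrite N'|rewrite -Nb X' Nb].
- exists B; last by rewrite setTI.
  move=> b cb; have [b' [[N1 X1] [N2 X2]]] := cb _ (near_normal_constant b allE).
  have Nb : nu b = nu a0 by rewrite -N2.
  by split=> //; rewrite -Nb -X2 Nb.
Qed.

End Global.

Theorem theorem1p1 (R : realType) (gamma : 'rV[R]_3 -> R)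
    (gamma_smooth : sphere_smooth gamma)
    (gamma_gt0 : forall x, sphere x -> 0 < gamma x)
    (gamma_convex : convex_integrand gamma)
    (S : surface R) (S_connected : connected [set: S])
    (X nu : S -> 'rV[R]_3)
    (X_immersion : immersion X)
    (nu_normal : unit_normal_field X nu)
    (X_nonplanar : ~ planar X)
    (X_minimal : aniso_minimal gamma X nu) :
  critical_set nu = zero_curvature_set X nu /\
  limit_point (critical_set nu) = set0.
Proof.
split; first exact: (critical_zero_curvature X_immersion nu_normal).
apply/seteqP; split=> // a la; case: X_nonplanar.
have allE := all_critical X_immersion nu_normal gamma_smooth gamma_convex X_minimal S_connected la.
exact: (planar_of_all_critical X_immersion nu_normal gamma_smooth gamma_convex X_minimal a S_connected allE).
Qed.
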